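(* Let $r\in\mathbb{N}_{\ge 1}$ and let $M=(M_p)_{p\in\mathbb{N}}$, $N=(N_p)_{p\in\mathbb{N}}$ be sequences of positive real numbers such that $M,N\in\mathcal{LC}$ and there is $C\ge 1$ with $M_p\le C^pN_p$ for all $p\in\mathbb{N}$. (Roumieu case) Assume in addition $\liminf_{p\to\infty}\left(\frac{(M_p)^{1/r}}{p!}\right)^{1/p}>0$. Let $\mathcal{A}$ be any one of the classes $\mathcal{D}_{r,\{N\}}([-1,1])$, $\mathcal{L}_{r,\{N\}}$, $\mathcal{N}_{r,\{N\}}$, $\mathcal{E}_{r,\{N\}}$. Then the following are equivalent: (i) $\Lambda_{\{M\}}\subseteq\{(f^{(rj)}(0))_{j\in\mathbb{N}}:\ f\in\mathcal{A}\}$; (ii) condition $(M,N)_{SV_r}$ holds. (Beurling case) Assume in addition $\lim_{p\to\infty}\left(\frac{(M_p)^{1/r}}{p!}\right)^{1/p}=\infty$. Let $\mathcal{A}$ be any one of the classes $\mathcal{D}_{r,(N)}([-1,1])$, $\mathcal{L}_{r,(N)}$, $\mathcal{N}_{r,(N)}$, $\mathcal{E}_{r,(N)}$. Then the following are equivalent: (i) $\Lambda_{(M)}\subseteq\{(f^{(rj)}(0))_{j\in\mathbb{N}}:\ f\in\mathcal{A}\}$; (ii) condition $(M,N)_{SV_r}$ holds.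
   Context: $\mathbb{N}=\{0,1,2,\dots\}$, $\mathbb{N}_{>0}=\{1,2,\dots\}$. For sequences $M,N$ of positive reals put $\mu_p=M_p/M_{p-1}$, $\nu_p=N_p/N_{p-1}$ for $p\ge1$, $\mu_0=\nu_0=1$. $\mathcal{LC}$ is the set of all positive sequences $M$ that are normalized ($1=M_0\le M_1$), log-convex ($M_j^2\le M_{j-1}M_{j+1}$ for all $j\ge 1$), and satisfy $\lim_{k\to\infty}(M_k)^{1/k}=\infty$. For $p,s\in\mathbb{N}_{>0}$ let $\lambda^{M,N}_{p,s}:=\sup_{0\le j<p}\left(\frac{M_p}{s^pN_j}\right)^{1/(p-j)}$. Condition $(M,N)_{SV_r}$ means: there exists $s\in\mathbb{N}_{>0}$ such that $\sup_{p\in\mathbb{N}_{>0}}\frac{(\lambda^{M,N}_{p,s})^{1/r}}{p}\sum_{k\ge p}\left(\frac{1}{\nu_k}\right)^{1/r}<\infty$ (in particular the series converges). $\Lambda_{\{M\}}$ (resp. $\Lambda_{(M)}$) is the set of all complex sequences $(a_p)_{p\in\mathbb{N}}$ such that for some $h>0$ (resp. for every $h>0$) one has $\sup_{p\in\mathbb{N}}\frac{|a_p|}{h^pM_p}<\infty$. Function classes. For an interval $I\in\{\mathbb{R},[0,\infty),[0,1]\}$ consider $\mathcal{C}^\infty$ functions $f:I\to\mathbb{C}$ (one-sided derivatives at boundary points) satisfying (a) $f^{(rn+j)}(0)=0$ for all $n\in\mathbb{N}$, $j\in\{1,\dots,r-1\}$; and (b) for some $h>0$ (Roumieu case, subscript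 $\{N\}$), resp. for every $h>0$ (Beurling case, subscript $(N)$), $\sup_{n\in\mathbb{N},x\in I}\frac{|f^{(rn)}(x)|}{h^nN_n}<\infty$. Then: $\mathcal{D}_{r,\{N\}}([-1,1])$, $\mathcal{D}_{r,(N)}([-1,1])$ consist of such $f$ with $I=\mathbb{R}$ and $\operatorname{supp}(f)\subseteq[-1,1]$; $\mathcal{L}_{r,\{N\}}$, $\mathcal{L}_{r,(N)}$ consist of such $f$ with $I=[0,\infty)$ and $\operatorname{supp}(f)\subseteq[0,1]$; $\mathcal{N}_{r,\{N\}}$, $\mathcal{N}_{r,(N)}$ consist of all such $f$ with $I=[0,\infty)$; $\mathcal{E}_{r,\{N\}}$, $\mathcal{E}_{r,(N)}$ consist of all such $f$ with $I=[0,1]$. *)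

(* Defs.v *)
(** Written for the standard library's reals [R] with Coquelicot: limits are
    Coquelicot filters and complex numbers are Coquelicot's [C]. *)
From Stdlib Require Import Reals Rtopology.
From Coquelicot Require Import Coquelicot.
Open Scope R_scope.

(** * Weight sequences *)

Definition class_LC (M : nat -> R) : Prop :=
  (forall p, 0 < M p) /\
  (M 0%nat = 1 /\ 1 <= M 1%nat) /\
  (forall j, M (S j) ^ 2 <= M j * M (S (S j))) /\
  is_lim_seq (fun k => Rpower (M k) (/ INR k)) p_infty.

Definition quotients (N : nat -> R) (p : nat) : R :=
  match p with
  | O => 1
  | S q => N (S q) / N q
  end.

(** For [1 <= p] the set is finite and nonempty, so the supremum is a real
    number and the coercion [real] loses nothing. *)
Definition lambda (M N : nat -> R) (p s : nat) : R :=
  real (Lub_Rbar (fun x => exists j : nat, (j < p)%nat /\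
    x = Rpower (M p / (INR s ^ p * N j)) (/ INR (p - j)))).

(** [Series] is total, so convergence of the tail series is a separate
    conjunct. *)
Definition cond_SV (r : nat) (M N : nat -> R) : Prop :=
  exists s : nat, (1 <= s)%nat /\
    let term k := Rpower (/ quotients N k) (/ INR r) in
    (forall p, (1 <= p)%nat -> ex_series (fun k => term (p + k)%nat)) /\
    exists B : R, forall p, (1 <= p)%nat ->
      Rpower (lambda M N p s) (/ INR r) / INR p
        * Series (fun k => term (p + k)%nat) <= B.

(** * Roumieu and Beurling types *)

Inductive ultra_type := Roumieu | Beurling.

Definition quantify_h (t : ultra_type) (P : R -> Prop) : Prop :=
  match t with
  | Roumieu => exists h, 0 < h /\ P h
  | Beurling => forall h, 0 < h -> P h
  end.

Definition Lambda (t : ultra_type) (M : nat -> R) (a : nat -> C) : Prop :=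
  quantify_h t (fun h =>
    exists B : R, forall p, Cmod (a p) / (h ^ p * M p) <= B).

(** * Derivatives on an interval

    A function [I -> C] is represented by a total function [R -> C] whose
    values outside [I] are never used.  The limit of the difference quotient
    is taken inside [I], hence it is one-sided at the endpoints of [I].
    [derive_on] returns a meaningless value where that limit does not exist,
    like Coquelicot's [Derive]; existence is stated by [smooth_on]. *)

Definition diff_quot (f : R -> C) (x y : R) : C :=
  ((f y - f x) / RtoC (y - x))%C.

Definition derive_on (I : R -> Prop) (f : R -> C) (x : R) : C :=
  @lim C_R_CompleteNormedModule
    (filtermap (diff_quot f x) (within I (locally' x))).

Definition ex_derive_on (I : R -> Prop) (f : R -> C) (x : R) : Prop :=
  exists l : C, filterlim (diff_quot f x) (within I (locally' x)) (locally l).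

Fixpoint derive_n_on (I : R -> Prop) (n : nat) (f : R -> C) : R -> C :=
  match n with
  | O => f
  | S m => derive_on I (derive_n_on I m f)
  end.

Definition smooth_on (I : R -> Prop) (f : R -> C) : Prop :=
  forall n x, I x -> ex_derive_on I (derive_n_on I n f) x.

(** The closure is taken in [R]; it agrees with the closure in [I] for the
    closed intervals used below. *)
Definition support_on (I : R -> Prop) (f : R -> C) : R -> Prop :=
  adherence (fun x => I x /\ f x <> RtoC 0).

(** * The function classes *)

Definition ultra_smooth (t : ultra_type) (r : nat) (N : nat -> R)
    (I : R -> Prop) (f : R -> C) : Prop :=
  smooth_on I f /\
  (forall n j, (1 <= j)%nat -> (j < r)%nat ->
     derive_n_on I (r * n + j) f 0 = RtoC 0) /\
  quantify_h t (fun h => exists B : R, forall n x, I x ->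
     Cmod (derive_n_on I (r * n) f x) / (h ^ n * N n) <= B).

Inductive fun_class := ClassD | ClassL | ClassN | ClassE.

Definition class_dom (A : fun_class) : R -> Prop :=
  match A with
  | ClassD => fun _ => True
  | ClassL | ClassN => fun x => 0 <= x
  | ClassE => fun x => 0 <= x <= 1
  end.

Definition class_supp (A : fun_class) (f : R -> C) : Prop :=
  match A with
  | ClassD => included (support_on (class_dom A) f) (fun x => -1 <= x <= 1)
  | ClassL => included (support_on (class_dom A) f) (fun x => 0 <= x <= 1)
  | ClassN | ClassE => True
  end.

Definition in_class (A : fun_class) (t : ultra_type) (r : nat) (N : nat -> R)
    (f : R -> C) : Prop :=
  ultra_smooth t r N (class_dom A) f /\ class_supp A f.

(** The set of sequences [(f^(rj)(0))_j] for [f] in the class. *)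
Definition jets (A : fun_class) (t : ultra_type) (r : nat) (N : nat -> R)
    (a : nat -> C) : Prop :=
  exists f : R -> C, in_class A t r N f /\
    forall j, a j = derive_n_on (class_dom A) (r * j) f 0.

(* Main.v *)
(** A sequence in the weight class [M] is realized by superposing the blocks
    [chi_p(x) x^(rp) / (rp)!].  The cut-off [chi_p] is an infinite convolution of
    normalized indicator functions: about [rp] of them share the width
    [rho_p / (rp)], and those of index [k > rp] have width of order [1 / e_k], where
    [e_k] is the [r]-th root of the quotient [nu] belonging to the derivative of order
    [k].  With [rho_p] comparable to [sum_(k >= p) nu_k^(-1/r) + p nu_p^(-1/r)], the
    condition [SV_r] is exactly what bounds the derivatives of order [rm] of such a block
    by [C^(p+m) N_m / M_p].  Rescaling the widths by [tau_p] makes the superposition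
    converge: [tau_p] is constant in the Roumieu case and tends slowly to infinity in the
    Beurling case.

    Conversely, Baire's theorem turns surjectivity into bounds, uniform in [p], for
    functions [f] whose jet at [0] is approximately the [p]-th unit vector.  By Bang's
    argument [f - x^(rp)/(rp)!], being nearly flat at [0], stays small up to a distance
    of order [sum_(k > p) nu_k^(-1/r)]; there [x^(rp)/(rp)!] and its derivatives obey
    the bounds for [f], which is the condition [SV_r].  The growth assumption on [M]
    rules out that this distance exceeds the length of the interval. *)
Require Import Defs.
From Stdlib Require Import Reals Rtopology Factorial Compare_dec ClassicalEpsilon Lra Lia.
From Coquelicot Require Import Coquelicot.
Open Scope R_scope.

(** One construction and one estimate serve all four classes. The blocks live on the whole line with
    support in $[-1,1]$ and are restricted afterwards; the converse looks only at the open interval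
    $(0,1)$, contained in every domain, and at one-sided limits at $0$. The classes bound only the
    orders divisible by [r]. Spreading each quotient over [r] consecutive orders as [r]-th roots
    gives one weight $e_0\cdots e_{k-1}$ for every order $k$. The orders in between are recovered by
    integration for compactly supported blocks and by Landau-Kolmogorov interpolation in the
    converse. Baire's theorem is used in the sequence space alone. The price is that a unit vector
    is attained only up to an arbitrarily small error on finitely many orders; Bang's argument
    tolerates this, because it reads finitely many derivatives at a point near $0$. In the Roumieu
    case the scale [h] of the sequence space can be prescribed, in the Beurling case Baire's theorem
    dictates it. Hence a positive lower limit is enough for the former, while the latter asks for an
    infinite limit. *)

Fixpoint psum (a : nat -> R) (n : nat) : R :=
  match n with O => 0 | S m => psum a m + a m end.

Fixpoint pprod (a : nat -> R) (n : nat) : R :=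
  match n with O => 1 | S m => pprod a m * a m end.

(** A function is carried along with all its derivatives, so that smoothness and bounds of every
    order are statements about explicit functions. *)
Definition deriv_family (D : R -> Prop) (F : nat -> R -> R) : Prop :=
  forall n x, D x -> is_derive (F n) x (F (S n) x).

Lemma is_derive_congr (f g : R -> R) (x l l' : R) :
  (forall y, f y = g y) -> l = l' -> is_derive f x l -> is_derive g x l'.
Proof. intros H -> Hf. now apply (is_derive_ext f). Qed.

Lemma mvt (f df : R -> R) (a b : R) :
  a <= b -> (forall x, a <= x <= b -> is_derive f x (df x)) ->
  exists c, a <= c <= b /\ f b - f a = df c * (b - a).
Proof.
  intros Hab Hd.
  destruct (MVT_gen f a b df) as [c Hc];
    rewrite ?Rmin_left, ?Rmax_right in * by easy.
  - intros x Hx. apply Hd. lra.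
  - intros x Hx. apply derivable_continuous_pt.
    exists (df x). apply is_derive_Reals. now apply Hd.
  - exists c. exact Hc.
Qed.

Lemma psum_le (a : nat -> R) (m n : nat) :
  (forall i, 0 < a i) -> (m <= n)%nat -> psum a m <= psum a n.
Proof.
  intros Ha Hmn. induction Hmn as [|n _ IH]; [lra|].
  simpl. specialize (Ha n). lra.
Qed.

Lemma is_lim_seq_dist (u v : nat -> R) (l : R) :
  (forall n, Rabs (u n - l) <= v n) -> is_lim_seq v 0 -> is_lim_seq u l.
Proof.
  intros H Hv. apply is_lim_seq_spec. intros eps.
  destruct (proj2 (is_lim_seq_spec _ _) Hv eps) as [n0 Hn0].
  exists n0. intros n Hn. specialize (Hn0 n Hn). simpl in Hn0.
  rewrite Rminus_0_r in Hn0. pose proof (Rle_abs (v n)). specialize (H n). lra.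
Qed.

(** * Cut-off functions *)

Definition lipschitz (k : R) (f : R -> R) : Prop :=
  forall x y, Rabs (f x - f y) <= k * Rabs (x - y).

Lemma lipschitz_continuous (k : R) (f : R -> R) (x : R) :
  0 <= k -> lipschitz k f -> continuous f x.
Proof.
  intros Hk Hf. apply continuity_pt_filterlim. intros eps Heps.
  exists (eps / (k + 1)). split.
  - apply Rdiv_lt_0_compat; lra.
  - intros y [_ Hy]. simpl in *. unfold R_dist in *.
    apply Rle_lt_trans with (1 := Hf y x).
    apply Rle_lt_trans with ((k + 1) * Rabs (y - x)).
    { pose proof (Rabs_pos (y - x)). nra. }
    apply Rmult_lt_compat_l with (r := k + 1) in Hy; [|lra].
    replace ((k + 1) * (eps / (k + 1))) with eps in Hy by (field; lra). exact Hy.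
Qed.

Definition dq (w : R) (f : R -> R) (x : R) : R := (f (x + w) - f (x - w)) / (2 * w).

(** Convolution with the normalized indicator function of $[-w,w]$. Written as a difference quotient
    of the primitive, it is differentiated by [is_derive_dq]. *)
Definition avg (w : R) (f : R -> R) : R -> R := dq w (fun x => RInt f 0 x).

Lemma is_derive_primitive (f : R -> R) (x : R) :
  (forall y, continuous f y) -> is_derive (fun y => RInt f 0 y) x (f x).
Proof.
  intros Hf. apply is_derive_RInt with 0; [|apply Hf].
  apply filter_forall. intros y. apply @RInt_correct.
  apply ex_RInt_continuous. intros z _. apply Hf.
Qed.

Lemma is_derive_shift (f : R -> R) (w x l : R) :
  is_derive f (x + w) l -> is_derive (fun y => f (y + w)) x l.
Proof.
  intros Hf.
  rewrite <- (Rmult_1_l l).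
  apply (is_derive_comp f (fun y => y + w)); [exact Hf|].
  rewrite <- (Rplus_0_r 1). apply @is_derive_plus; [apply @is_derive_id|apply @is_derive_const].
Qed.

Lemma is_derive_dq (w : R) (f df : R -> R) :
  (forall x, is_derive f x (df x)) -> forall x, is_derive (dq w f) x (dq w df x).
Proof.
  intros Hf x. unfold dq, Rdiv.
  apply (is_derive_congr (fun y => / (2 * w) * (f (y + w) - f (y + - w))) _ _
    (/ (2 * w) * (df (x + w) - df (x + - w)))); [intros y; apply Rmult_comm|apply Rmult_comm|].
  apply is_derive_scal.
  apply @is_derive_minus; apply is_derive_shift; apply Hf.
Qed.

Lemma is_derive_avg (w : R) (f : R -> R) :
  (forall x, continuous f x) -> forall x, is_derive (avg w f) x (dq w f x).
Proof.
  intros Hf. apply is_derive_dq. intros x. now apply is_derive_primitive.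
Qed.

Lemma avg_value (w : R) (f : R -> R) (x : R) :
  0 < w -> (forall y, continuous f y) ->
  exists c, Rabs (c - x) <= w /\ avg w f x = f c.
Proof.
  intros Hw Hf.
  destruct (mvt (fun y => RInt f 0 y) f (x - w) (x + w)) as [c [Hc E]]; [lra| |].
  { intros y _. now apply is_derive_primitive. }
  exists c. split; [apply Rabs_le; lra|].
  unfold avg, dq. rewrite E. field. lra.
Qed.

(** The mean value theorem is applied to the difference of the two primitives, so a single [c]
    serves both averages. Hence averaging enlarges neither a Lipschitz constant ([f = g]) nor the
    distance of two functions ([x = y]). *)
Lemma avg_minus (w : R) (f g : R -> R) (x y : R) :
  0 < w -> (forall z, continuous f z) -> (forall z, continuous g z) ->
  exists c, avg w f x - avg w g y = f (x + c) - g (y + c).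
Proof.
  intros Hw Hf Hg.
  destruct (mvt (fun t => RInt f 0 (t + x) - RInt g 0 (t + y))
    (fun t => f (t + x) - g (t + y)) (- w) w) as [c [_ E]]; [lra| |].
  { intros t _. apply @is_derive_minus.
    - apply (is_derive_shift (fun s => RInt f 0 s)). now apply is_derive_primitive.
    - apply (is_derive_shift (fun s => RInt g 0 s)). now apply is_derive_primitive. }
  exists c. unfold avg, dq.
  rewrite (Rplus_comm x c), (Rplus_comm y c).
  replace (f (c + x) - g (c + y)) with ((f (c + x) - g (c + y)) * (w - - w) / (2 * w))
    by (field; lra).
  rewrite <- E.
  replace (- w + x) with (x - w) by ring. replace (- w + y) with (y - w) by ring.
  rewrite (Rplus_comm w x), (Rplus_comm w y). field. lra.
Qed.

Lemma lipschitz_avg (k w : R) (f : R -> R) :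
  0 <= k -> 0 < w -> lipschitz k f -> lipschitz k (avg w f).
Proof.
  intros Hk Hw Hf x y.
  assert (Hc : forall z, continuous f z) by (intros z; now apply lipschitz_continuous with k).
  destruct (avg_minus w f f x y) as [c ->]; auto.
  replace (x - y) with ((x + c) - (y + c)) by ring. apply Hf.
Qed.

Lemma avg_close (k w : R) (f : R -> R) (x : R) :
  0 <= k -> 0 < w -> lipschitz k f -> Rabs (avg w f x - f x) <= k * w.
Proof.
  intros Hk Hw Hf.
  destruct (avg_value w f x) as [c [Hc ->]]; auto.
  { intros z; now apply lipschitz_continuous with k. }
  apply Rle_trans with (1 := Hf c x). now apply Rmult_le_compat_l.
Qed.

Fixpoint avgs (w : nat -> R) (phi : R -> R) (k m : nat) : R -> R :=
  match m with O => phi | S n => avg (w k) (avgs w phi (S k) n) end.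

(** The last index is applied first, whereas [avgs] has its smallest index outermost. This makes
    [dqs w (S k) f] convertible with [dqs w k] of a quotient of width [w k], the form in which the
    next derivative appears. *)
Fixpoint dqs (w : nat -> R) (k : nat) (f : R -> R) : R -> R :=
  match k with O => f | S j => dqs w j (dq (w j) f) end.

Lemma is_derive_dqs (w : nat -> R) (k : nat) (f df : R -> R) :
  (forall x, is_derive f x (df x)) ->
  forall x, is_derive (dqs w k f) x (dqs w k df x).
Proof.
  revert f df. induction k as [|k IH]; intros f df Hf; simpl; [exact Hf|].
  apply IH. now apply is_derive_dq.
Qed.

Lemma dqs_bound (w : nat -> R) (k : nat) (f : R -> R) (B : R) :
  (forall i, 0 < w i) -> (forall x, Rabs (f x) <= B) ->
  forall x, Rabs (dqs w k f x) <= B * pprod (fun i => / w i) k.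
Proof.
  intros Hw. revert f B. induction k as [|k IH]; intros f B Hf x; simpl.
  - rewrite Rmult_1_r. apply Hf.
  - rewrite (Rmult_comm _ (/ w k)), <- Rmult_assoc. apply IH. intros y. unfold dq.
    specialize (Hw k). unfold Rdiv. rewrite Rabs_mult, (Rabs_pos_eq (/ (2 * w k))).
    2: { left. apply Rinv_0_lt_compat. lra. }
    apply Rle_trans with (2 * B * / (2 * w k)).
    + apply Rmult_le_compat_r; [left; apply Rinv_0_lt_compat; lra|].
      apply Rle_trans with (1 := Rabs_triang _ _). rewrite Rabs_Ropp.
      pose proof (Hf (y + w k)). pose proof (Hf (y - w k)). lra.
    + right. field. lra.
Qed.

Section Cutoff.

Variables (w : nat -> R) (phi : R -> R) (k0 : R).
Hypothesis w_pos : forall i, 0 < w i.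
Hypothesis k0_pos : 0 <= k0.
Hypothesis phi_lip : lipschitz k0 phi.

Lemma avgs_lip (k m : nat) : lipschitz k0 (avgs w phi k m).
Proof.
  revert k. induction m as [|m IH]; intros k; simpl; [exact phi_lip|].
  apply lipschitz_avg; auto.
Qed.

Lemma avgs_cont (k m : nat) (x : R) : continuous (avgs w phi k m) x.
Proof. apply lipschitz_continuous with k0; [easy|apply avgs_lip]. Qed.

Lemma avgs_range (k m : nat) (x a b : R) :
  (forall y, Rabs (y - x) <= psum w (k + m) - psum w k -> a <= phi y <= b) ->
  a <= avgs w phi k m x <= b.
Proof.
  revert k x. induction m as [|m IH]; intros k x H; simpl.
  - apply H. rewrite Nat.add_0_r, Rminus_diag, Rabs_R0. lra.
  - destruct (avg_value (w k) (avgs w phi (S k) m) x) as [c [Hc ->]]; auto.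
    { intros y. apply avgs_cont. }
    apply IH. intros y Hy. apply H.
    replace (k + S m)%nat with (S k + m)%nat by lia. simpl in Hy |- *.
    replace (y - x) with ((y - c) + (c - x)) by ring.
    apply Rle_trans with (1 := Rabs_triang _ _). lra.
Qed.

(** The additional average is the innermost one and acts on [phi] itself, where the Lipschitz
    constant bounds its effect; the outer averages do not enlarge the error. *)
Lemma avgs_step (k m : nat) (x : R) :
  Rabs (avgs w phi k (S m) x - avgs w phi k m x) <= k0 * w (k + m)%nat.
Proof.
  revert k x. induction m as [|m IH]; intros k x.
  - rewrite Nat.add_0_r. now apply avg_close.
  - change (Rabs (avg (w k) (avgs w phi (S k) (S m)) x - avg (w k) (avgs w phi (S k) m) x)
      <= k0 * w (k + S m)%nat).
    destruct (avg_minus (w k) (avgs w phi (S k) (S m)) (avgs w phi (S k) m) x x) as [c ->];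
      auto using avgs_cont.
    replace (k + S m)%nat with (S k + m)%nat by lia. apply IH.
Qed.

Lemma avgs_cauchy (k m n : nat) (x : R) :
  Rabs (avgs w phi k (m + n) x - avgs w phi k m x)
    <= k0 * (psum w (k + (m + n)) - psum w (k + m)).
Proof.
  induction n as [|n IH].
  - rewrite Nat.add_0_r, !Rminus_diag, Rabs_R0. lra.
  - rewrite Nat.add_succ_r.
    replace (avgs w phi k (S (m + n)) x - avgs w phi k m x) with
      ((avgs w phi k (S (m + n)) x - avgs w phi k (m + n) x)
       + (avgs w phi k (m + n) x - avgs w phi k m x)) by ring.
    apply Rle_trans with (1 := Rabs_triang _ _).
    pose proof (avgs_step k (m + n) x).
    rewrite Nat.add_succ_r. simpl psum. lra.
Qed.

Variable l : R.
Hypothesis w_sum : is_lim_seq (psum w) l.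

Definition avg_lim (k : nat) (x : R) : R := real (Lim_seq (fun m => avgs w phi k m x)).

Lemma psum_le_lim (n : nat) : psum w n <= l.
Proof.
  apply (is_lim_seq_incr_compare (psum w) l w_sum). intros m. simpl.
  specialize (w_pos m). lra.
Qed.

Lemma avg_lim_correct (k : nat) (x : R) :
  is_lim_seq (fun m => avgs w phi k m x) (avg_lim k x).
Proof.
  apply Lim_seq_correct', ex_lim_seq_cauchy_corr. intros eps.
  assert (He : 0 < eps / (2 * (k0 + 1))).
  { apply Rdiv_lt_0_compat; [apply cond_pos|lra]. }
  destruct (proj2 (is_lim_seq_spec _ _) w_sum (mkposreal _ He)) as [n0 Hn0]. simpl in Hn0.
  assert (H : forall n, (n0 <= n)%nat ->
    Rabs (avgs w phi k n x - avgs w phi k n0 x) < eps / 2).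
  { intros n Hn. replace n with (n0 + (n - n0))%nat by lia.
    apply Rle_lt_trans with (1 := avgs_cauchy _ _ _ _).
    specialize (Hn0 (k + n0)%nat ltac:(lia)). apply Rabs_def2 in Hn0.
    pose proof (psum_le_lim (k + (n0 + (n - n0)))).
    pose proof (psum_le w (k + n0) (k + (n0 + (n - n0))) w_pos ltac:(lia)).
    apply Rle_lt_trans with ((k0 + 1) *
      (psum w (k + (n0 + (n - n0))) - psum w (k + n0))); [nra|].
    apply Rlt_le_trans with ((k0 + 1) * (eps / (2 * (k0 + 1)))).
    - apply Rmult_lt_compat_l; lra.
    - right. field. lra. }
  exists n0. intros n m Hn Hm.
  replace (avgs w phi k n x - avgs w phi k m x) with
    ((avgs w phi k n x - avgs w phi k n0 x) + - (avgs w phi k m x - avgs w phi k n0 x)) by ring.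
  apply Rle_lt_trans with (1 := Rabs_triang _ _). rewrite Rabs_Ropp.
  pose proof (H n Hn). pose proof (H m Hm). lra.
Qed.

Lemma avg_lim_close (k m : nat) (x : R) :
  Rabs (avg_lim k x - avgs w phi k m x) <= k0 * (l - psum w (k + m)).
Proof.
  assert (H : Rbar_le (Rabs (avg_lim k x - avgs w phi k m x)) (k0 * (l - psum w (k + m)))).
  { apply is_lim_seq_le_loc with (fun n => Rabs (avgs w phi k n x - avgs w phi k m x))
      (fun _ => k0 * (l - psum w (k + m))).
    - exists m. intros n Hn. replace n with (m + (n - m))%nat by lia.
      apply Rle_trans with (1 := avgs_cauchy _ _ _ _).
      apply Rmult_le_compat_l; [easy|].
      pose proof (psum_le_lim (k + (m + (n - m)))). lra.
    - apply (is_lim_seq_abs _ (avg_lim k x - avgs w phi k m x)).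
      apply is_lim_seq_minus'; [apply avg_lim_correct|apply is_lim_seq_const].
    - apply is_lim_seq_const. }
  exact H.
Qed.

Lemma avg_lim_lip (k : nat) : lipschitz k0 (avg_lim k).
Proof.
  intros x y.
  assert (H : Rbar_le (Rabs (avg_lim k x - avg_lim k y)) (k0 * Rabs (x - y))).
  { apply is_lim_seq_le with (fun n => Rabs (avgs w phi k n x - avgs w phi k n y))
      (fun _ => k0 * Rabs (x - y)).
    - intros n. apply avgs_lip.
    - apply (is_lim_seq_abs _ (avg_lim k x - avg_lim k y)).
      apply is_lim_seq_minus'; apply avg_lim_correct.
    - apply is_lim_seq_const. }
  exact H.
Qed.

Lemma avg_lim_cont (k : nat) (x : R) : continuous (avg_lim k) x.
Proof. apply lipschitz_continuous with k0; [easy|apply avg_lim_lip]. Qed.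

(** The outermost average commutes with the limit because the bound in [avg_lim_close] is uniform in
    the point. *)
Lemma avg_lim_avg (k : nat) (x : R) : avg_lim k x = avg (w k) (avg_lim (S k)) x.
Proof.
  assert (H : is_lim_seq (fun m => avgs w phi k (S m) x) (avg (w k) (avg_lim (S k)) x)).
  { apply is_lim_seq_dist with (fun m => k0 * (l - psum w (S k + m))).
    - intros m. simpl avgs.
      destruct (avg_minus (w k) (avgs w phi (S k) m) (avg_lim (S k)) x x) as [c ->];
        auto using avgs_cont, avg_lim_cont.
      rewrite Rabs_minus_sym. apply avg_lim_close.
    - replace 0 with (k0 * (l - l)) by ring.
      apply (is_lim_seq_scal_l _ k0 (Finite (l - l))).
      apply is_lim_seq_minus'; [apply is_lim_seq_const|].
      apply (is_lim_seq_ext (fun m => psum w (m + S k))).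
      { intros m. now rewrite Nat.add_comm. }
      now apply is_lim_seq_incr_n. }
  apply is_lim_seq_unique in H. pose proof (avg_lim_correct k x) as H2.
  apply is_lim_seq_incr_1 in H2. apply is_lim_seq_unique in H2.
  rewrite H in H2. now inversion H2.
Qed.

Lemma avg_lim_range (k : nat) (x a b : R) :
  (forall y, Rabs (y - x) <= l -> a <= phi y <= b) -> a <= avg_lim k x <= b.
Proof.
  intros H.
  assert (Hm : forall m, a <= avgs w phi k m x <= b).
  { intros m. apply avgs_range. intros y Hy. apply H.
    pose proof (psum_le_lim (k + m)). pose proof (psum_le w 0 k w_pos ltac:(lia)).
    simpl in *. lra. }
  split.
  - apply (is_lim_seq_le (fun _ => a) _ a (avg_lim k x)) with (2 := is_lim_seq_const a)
      (3 := avg_lim_correct k x). apply Hm.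
  - apply (is_lim_seq_le _ (fun _ => b) (avg_lim k x) b) with (3 := is_lim_seq_const b)
      (2 := avg_lim_correct k x). apply Hm.
Qed.

(** Each differentiation trades the outermost remaining average for a difference quotient of the
    same width, so the derivative of order [k] costs exactly the first [k] widths. *)
Lemma dqs_avg_lim_family : deriv_family (fun _ => True) (fun k => dqs w k (avg_lim k)).
Proof.
  intros k x _. simpl.
  apply is_derive_dqs. intros y.
  apply (is_derive_ext (avg (w k) (avg_lim (S k)))).
  { intros t. now rewrite <- avg_lim_avg. }
  apply is_derive_avg. intros z. apply avg_lim_cont.
Qed.

End Cutoff.

Lemma family_locally_const (F : nat -> R -> R) (D : R -> Prop) (c : R) :
  deriv_family (fun _ => True) F ->
  (forall x, D x -> locally x D) -> (forall x, D x -> F O x = c) ->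
  forall k x, D x -> F (S k) x = 0.
Proof.
  intros HF HD H0.
  assert (step : forall k c', (forall x, D x -> F k x = c') -> forall x, D x -> F (S k) x = 0).
  { intros k c' Hk x Hx. pose proof (is_derive_unique _ _ _ (HF k x I)) as <-.
    apply is_derive_unique.
    apply (is_derive_ext_loc (fun _ => c')); [|apply @is_derive_const].
    generalize (HD x Hx). apply filter_imp. intros y Hy. now rewrite Hk. }
  induction k as [|k IH]; [now apply step with c|now apply step with 0].
Qed.

Lemma cutoff_exists (w : nat -> R) (rho : R) :
  (forall i, 0 < w i) -> 0 < rho -> (forall n, psum w n <= rho) ->
  exists u : nat -> R -> R,
    deriv_family (fun _ => True) u /\
    (forall k x, Rabs (u k x) <= pprod (fun i => / w i) k) /\
    u O 0 = 1 /\ (forall k, u (S k) 0 = 0) /\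
    (forall k x, 4 * rho < Rabs x -> u k x = 0).
Proof.
  intros Hw Hr Hs.
  (* A trapezoid, equal to 1 up to distance [2 * rho] and to 0 from [3 * rho] on. The averages look
     at most [rho] away, which leaves the value 1 on $|x|<\rho$ and 0 beyond $4\rho$. *)
  set (phi := fun x => Rmin 1 (Rmax 0 (3 - Rabs x / rho))).
  assert (Hk : 0 <= / rho) by (left; now apply Rinv_0_lt_compat).
  assert (Hlip : lipschitz (/ rho) phi).
  { intros x y. unfold phi.
    assert (Rabs (Rabs x / rho - Rabs y / rho) <= / rho * Rabs (x - y)).
    { replace (Rabs x / rho - Rabs y / rho) with (/ rho * (Rabs x - Rabs y))
        by (unfold Rdiv; ring).
      rewrite Rabs_mult, (Rabs_pos_eq (/ rho)) by easy.
      apply Rmult_le_compat_l; [easy|]. apply Rabs_triang_inv2. }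
    revert H. generalize (Rabs x / rho) (Rabs y / rho) (/ rho * Rabs (x - y)).
    intros a b c. unfold Rmin, Rmax, Rabs.
    repeat (destruct Rle_dec || destruct Rcase_abs); lra. }
  assert (Hl : exists l, is_lim_seq (psum w) (Finite l)).
  { destruct (ex_finite_lim_seq_incr (psum w) rho) as [l Hl].
    - intros n. simpl. specialize (Hw n). lra.
    - exact Hs.
    - now exists l. }
  destruct Hl as [l Hl].
  assert (Hlr : l <= rho).
  { apply (is_lim_seq_le (psum w) (fun _ => rho) l rho); auto. apply is_lim_seq_const. }
  set (V := avg_lim w phi).
  assert (HF : deriv_family (fun _ => True) (fun k => dqs w k (V k))).
  { now apply dqs_avg_lim_family with (/ rho) l. }
  assert (Hphi : forall y, 0 <= phi y <= 1).
  { intros y. unfold phi, Rmin, Rmax. repeat destruct Rle_dec; lra. }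
  assert (H1 : forall x, Rabs x < rho -> V O x = 1).
  { intros x Hx. assert (1 <= V O x <= 1); [|lra].
    apply (avg_lim_range w phi (/ rho)) with l; auto. intros y Hy.
    assert (Hy2 : Rabs y <= 2 * rho).
    { replace y with ((y - x) + x) by ring.
      apply Rle_trans with (1 := Rabs_triang _ _). lra. }
    assert (Rabs y / rho <= 2) by (apply Rle_div_l; lra).
    unfold phi, Rmin, Rmax; repeat destruct Rle_dec; lra. }
  assert (H0 : forall x, 4 * rho < Rabs x -> V O x = 0).
  { intros x Hx. assert (0 <= V O x <= 0); [|lra].
    apply (avg_lim_range w phi (/ rho)) with l; auto. intros y Hy.
    assert (Hy2 : 3 * rho <= Rabs y).
    { pose proof (Rabs_triang_inv x y). rewrite Rabs_minus_sym in Hy. lra. }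
    assert (3 <= Rabs y / rho) by (apply Rle_div_r; lra).
    unfold phi, Rmin, Rmax; repeat destruct Rle_dec; lra. }
  exists (fun k => dqs w k (V k)). split; [exact HF|]. split; [|split; [|split]].
  - intros k x. rewrite <- (Rmult_1_l (pprod _ k)). apply dqs_bound; [exact Hw|].
    intros y. apply Rabs_le.
    assert (0 <= V k y <= 1); [|lra].
    apply (avg_lim_range w phi (/ rho)) with l; auto.
  - simpl. apply H1. rewrite Rabs_R0. exact Hr.
  - intros k.
    apply (family_locally_const _ (fun x => Rabs x < rho) 1 HF); [|exact H1|now rewrite Rabs_R0].
    intros x Hx. apply (locally_open (fun y => Rabs y < rho)); [|easy|exact Hx].
    apply (open_comp Rabs (fun y => y < rho)).
    + intros y _. apply continuous_Rabs.
    + apply open_lt.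
  - intros [|k] x Hx; [now apply H0|].
    apply (family_locally_const _ (fun x => 4 * rho < Rabs x) 0 HF); [|exact H0|exact Hx].
    clear x Hx. intros x Hx. apply (locally_open (fun y => 4 * rho < Rabs y)); [|easy|exact Hx].
    apply (open_comp Rabs (fun y => 4 * rho < y)).
    + intros y _. apply continuous_Rabs.
    + apply open_gt.
Qed.

(** * Finite products and the exponential bound for factorials *)

Lemma pprod_pos (a : nat -> R) (n : nat) : (forall i, 0 < a i) -> 0 < pprod a n.
Proof.
  intros Ha. induction n as [|n IH]; simpl; [lra|]. now apply Rmult_lt_0_compat.
Qed.

Lemma pprod_le (a b : nat -> R) (n : nat) :
  (forall i, 0 <= a i <= b i) -> 0 <= pprod a n <= pprod b n.
Proof.
  intros H. induction n as [|n IH]; simpl; [lra|].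
  specialize (H n). split; [apply Rmult_le_pos|apply Rmult_le_compat]; lra.
Qed.

Lemma pprod_scal (c : R) (a : nat -> R) (n : nat) :
  pprod (fun i => c * a i) n = c ^ n * pprod a n.
Proof. induction n as [|n IH]; simpl; [ring|]. rewrite IH. ring. Qed.

Lemma psum_scal (c : R) (a : nat -> R) (n : nat) :
  psum (fun i => c * a i) n = c * psum a n.
Proof. induction n as [|n IH]; simpl; [ring|]. rewrite IH. ring. Qed.

Lemma pprod_add_ge (a : nat -> R) (c : R) (m n : nat) :
  0 <= c -> (forall i, 0 < a i) -> (forall i, c <= a i) ->
  pprod a m * c ^ n <= pprod a (m + n).
Proof.
  intros Hc Ha Hca. induction n as [|n IH]; simpl.
  - rewrite Nat.add_0_r. lra.
  - rewrite Nat.add_succ_r. simpl.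
    apply Rle_trans with (pprod a m * c ^ n * a (m + n)%nat).
    + rewrite (Rmult_comm c), <- Rmult_assoc. apply Rmult_le_compat_l; [|apply Hca].
      apply Rmult_le_pos; [left; now apply pprod_pos|now apply pow_le].
    + apply Rmult_le_compat_r; [left; apply Ha|exact IH].
Qed.

(** The finitely many bad factors are repaired one at a time, the largest index first, each at the
    cost of one constant. *)
Lemma pprod_eventually_le (a b : nat -> R) (n0 : nat) :
  (forall i, 0 < a i) -> (forall i, 0 < b i) ->
  (forall i, (n0 <= i)%nat -> a i <= b i) ->
  exists C, 0 < C /\ forall n, pprod a n <= C * pprod b n.
Proof.
  intros Ha Hb. revert a Ha.
  induction n0 as [|n0 IH]; intros a Ha H.
  - exists 1. split; [lra|]. intros n. rewrite Rmult_1_l.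
    apply pprod_le. intros i. split; [left; apply Ha|apply H; lia].
  - set (C1 := Rmax 1 (a n0 / b n0)).
    assert (HC1 : 1 <= C1) by apply Rmax_l.
    destruct (IH (fun i => if Nat.eq_dec i n0 then a i / C1 else a i)) as [C [HC Hn]].
    + intros i. destruct Nat.eq_dec; [|easy]. apply Rdiv_lt_0_compat; [easy|lra].
    + intros i Hi. destruct (Nat.eq_dec i n0) as [->|Hne]; [|apply H; lia].
      apply Rle_div_l; [lra|]. rewrite Rmult_comm. apply Rle_div_l; [apply Hb|apply Rmax_r].
    + exists (C1 * C). split; [nra|]. intros n.
      (* Equality up to the repaired index is carried through the induction, so that [C1] is paid
         only when that index is passed. *)
      assert (pprod a n <= C1 * pprod (fun i => if Nat.eq_dec i n0 then a i / C1 else a i) n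
        /\ ((n <= n0)%nat -> pprod a n =
              pprod (fun i => if Nat.eq_dec i n0 then a i / C1 else a i) n)) as [H1 _].
      { clear Hn. induction n as [|n [IH1 IH2]]; simpl; [split; [lra|easy]|].
        pose proof (pprod_pos a n Ha). pose proof (Ha n).
        destruct (Nat.eq_dec n n0) as [->|Hne].
        - split; [|intros; lia]. rewrite <- IH2 by lia. right. field. lra.
        - split; [nra|]. intros Hlt. rewrite IH2 by lia. reflexivity. }
      specialize (Hn n). nra.
Qed.

Lemma exp_INR (n : nat) : exp (INR n) = exp 1 ^ n.
Proof.
  induction n as [|n IH]; [apply exp_0|]. rewrite S_INR, exp_plus, IH. simpl. ring.
Qed.

Lemma pow_div_fact_le_exp (x : R) (n : nat) : 0 <= x -> x ^ n / INR (fact n) <= exp x.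
Proof.
  intros Hx. apply Rle_trans with (2 := exp_ge_taylor x n Hx).
  destruct n as [|n]; simpl sum_f_R0; [right; reflexivity|].
  match goal with |- _ <= ?s + _ => assert (0 <= s) end; [|simpl in *; lra].
  apply cond_pos_sum. intros k. apply Rmult_le_pos; [now apply pow_le|].
  left. apply Rinv_0_lt_compat, INR_fact_lt_0.
Qed.

(** * Cut-off monomials *)

(** The derivative of order [n] of $x^P/P!$; the test keeps truncated subtraction from producing 1
    for [n > P]. *)
Definition monomial (P n : nat) (x : R) : R :=
  if (n <=? P)%nat then x ^ (P - n) / INR (fact (P - n)) else 0.

Lemma monomial_family (P : nat) (D : R -> Prop) : deriv_family D (monomial P).
Proof.
  intros n x _. unfold monomial.
  destruct (Nat.leb_spec n P) as [H|H].
  - destruct (Nat.leb_spec (S n) P) as [H'|H'].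
    + replace (P - n)%nat with (S (P - S n)) by lia. set (m := (P - S n)%nat).
      apply (is_derive_congr (fun y => / INR (fact (S m)) * y ^ S m) _ _
        (/ INR (fact (S m)) * (INR (S m) * 1 * x ^ m))).
      * intros y. unfold Rdiv. ring.
      * rewrite fact_simpl, mult_INR. field. split; [apply INR_fact_neq_0|now apply not_0_INR].
      * apply is_derive_scal. apply (is_derive_pow (fun y => y) (S m)). apply @is_derive_id.
    + replace (P - n)%nat with 0%nat by lia.
      apply (is_derive_congr (fun _ => 1) _ _ 0); [|reflexivity|apply @is_derive_const].
      intros y. simpl. field.
  - destruct (Nat.leb_spec (S n) P) as [H'|H']; [lia|].
    apply (is_derive_const 0 x).
Qed.

Lemma monomial_0 (P n : nat) : monomial P n 0 = if Nat.eq_dec n P then 1 else 0.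
Proof.
  unfold monomial. destruct (Nat.leb_spec n P) as [H|H]; destruct (Nat.eq_dec n P) as [E|E];
    try lia; try reflexivity.
  - subst. rewrite Nat.sub_diag. simpl. field.
  - replace (P - n)%nat with (S (P - S n)) by lia. simpl pow.
    unfold Rdiv. ring.
Qed.

Lemma monomial_pos (P n : nat) (x : R) : 0 <= x -> 0 <= monomial P n x.
Proof.
  intros Hx. unfold monomial. destruct Nat.leb; [|lra].
  apply Rmult_le_pos; [now apply pow_le|]. left. apply Rinv_0_lt_compat, INR_fact_lt_0.
Qed.

(** Leibniz's rule for derivative families [u] and [v]; the two-parameter recursion
    avoids binomial sums. *)
Fixpoint leibniz (u v : nat -> R -> R) (n a b : nat) (x : R) : R :=
  match n with
  | O => u a x * v b x
  | S m => leibniz u v m (S a) b x + leibniz u v m a (S b) x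
  end.

Lemma leibniz_derive (u v : nat -> R -> R) (D : R -> Prop) (n a b : nat) (x : R) :
  deriv_family D u -> deriv_family D v -> D x ->
  is_derive (leibniz u v n a b) x (leibniz u v (S n) a b x).
Proof.
  intros Hu Hv Hx. revert a b. induction n as [|n IH]; intros a b.
  - simpl. apply (is_derive_mult (u a) (v b) x (u (S a) x) (v (S b) x));
      [now apply Hu|now apply Hv|exact Rmult_comm].
  - apply (is_derive_plus (leibniz u v n (S a) b) (leibniz u v n a (S b)) x); apply IH.
Qed.

Lemma leibniz_bound (u v : nat -> R -> R) (n a b : nat) (x B : R) :
  (forall a' b', (a' + b' = n + a + b)%nat -> Rabs (u a' x * v b' x) <= B) ->
  Rabs (leibniz u v n a b x) <= 2 ^ n * B.
Proof.
  revert a b. induction n as [|n IH]; intros a b H; simpl.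
  - rewrite Rmult_1_l. apply H. lia.
  - apply Rle_trans with (1 := Rabs_triang _ _).
    assert (H1 : Rabs (leibniz u v n (S a) b x) <= 2 ^ n * B).
    { apply IH. intros a' b' E. apply H. lia. }
    assert (H2 : Rabs (leibniz u v n a (S b) x) <= 2 ^ n * B).
    { apply IH. intros a' b' E. apply H. lia. }
    lra.
Qed.

Lemma leibniz_0 (u v : nat -> R -> R) (n b : nat) (x : R) :
  u O x = 1 -> (forall k, u (S k) x = 0) -> leibniz u v n O b x = v (n + b)%nat x.
Proof.
  intros H0 HS.
  assert (HZ : forall m a c, leibniz u v m (S a) c x = 0).
  { induction m as [|m IH]; intros a c; simpl; [rewrite HS; ring|]. rewrite !IH. ring. }
  revert b. induction n as [|n IH]; intros b; simpl; [rewrite H0; ring|].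
  rewrite HZ, IH, Nat.add_succ_r. ring.
Qed.

(** With the tails $t_i=\sum_{k\ge i}a_k$ the weights are $c_i=\sqrt{t_0/t_i}$. They tend to
    infinity, and since $a_i=t_i-t_{i+1}$ the weighted sum telescopes: $a_i/\sqrt{t_i}\le
    2(\sqrt{t_i}-\sqrt{t_{i+1}})$. *)
Lemma slow_weights (a : nat -> R) (T : R) :
  (forall i, 0 < a i) -> (forall n, psum a n <= T) ->
  exists c : nat -> R,
    (forall i, 1 <= c i) /\
    (forall A, exists n0, forall i, (n0 <= i)%nat -> A <= c i) /\
    (forall n, psum (fun i => c i * a i) n <= 2 * T).
Proof.
  intros Ha HT.
  destruct (ex_finite_lim_seq_incr (psum a) T) as [l Hl]; [|exact HT|].
  { intros n. simpl. specialize (Ha n). lra. }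
  assert (Hle : forall n, psum a n < l).
  { intros n. apply Rlt_le_trans with (psum a (S n)).
    - simpl. specialize (Ha n). lra.
    - apply (is_lim_seq_incr_compare (psum a) l Hl). intros m. simpl. specialize (Ha m). lra. }
  assert (HlT : l <= T).
  { apply (is_lim_seq_le (psum a) (fun _ => T) l T); auto. apply is_lim_seq_const. }
  assert (Hl0 : 0 < l) by apply (Hle O).
  set (t := fun i => l - psum a i).
  assert (Ht : forall i, 0 < t i) by (intros i; unfold t; specialize (Hle i); lra).
  assert (Htl : forall i, t i <= l).
  { intros i. unfold t. pose proof (psum_le a 0 i Ha ltac:(lia)). simpl in *. lra. }
  exists (fun i => sqrt l / sqrt (t i)).
  assert (Hs : forall i, 0 < sqrt (t i)) by (intros i; now apply sqrt_lt_R0).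
  assert (Hsl : 0 < sqrt l) by now apply sqrt_lt_R0.
  split; [|split].
  - intros i. apply Rle_div_r; [apply Hs|]. rewrite Rmult_1_l. apply sqrt_le_1_alt, Htl.
  - intros A. pose proof (Rabs_pos A) as HA.
    assert (He : 0 < (sqrt l / (Rabs A + 1)) ^ 2).
    { apply pow_lt, Rdiv_lt_0_compat; lra. }
    destruct (proj2 (is_lim_seq_spec _ _) Hl (mkposreal _ He)) as [n0 Hn0].
    exists n0. intros i Hi. specialize (Hn0 i Hi). simpl pos in Hn0.
    apply Rabs_def2 in Hn0. apply Rle_div_r; [apply Hs|].
    assert (Hst : sqrt (t i) <= sqrt l / (Rabs A + 1)).
    { rewrite <- (sqrt_pow2 (sqrt l / (Rabs A + 1))).
      - apply sqrt_le_1_alt. unfold t. lra.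
      - left. apply Rdiv_lt_0_compat; lra. }
    apply Rle_div_r in Hst; [|lra]. pose proof (Rle_abs A). specialize (Hs i). nra.
  - intros n.
    assert (H : psum (fun i => sqrt l / sqrt (t i) * a i) n <= 2 * sqrt l * (sqrt l - sqrt (t n))).
    { induction n as [|n IH].
      - simpl. unfold t. simpl. rewrite Rminus_0_r. right. ring.
      - simpl psum.
        assert (E : a n = sqrt (t n) * sqrt (t n) - sqrt (t (S n)) * sqrt (t (S n))).
        { rewrite !sqrt_sqrt by (left; apply Ht). unfold t. simpl. ring. }
        assert (sqrt l / sqrt (t n) * a n <= 2 * sqrt l * (sqrt (t n) - sqrt (t (S n)))); [|lra].
        replace (sqrt l / sqrt (t n) * a n) with (sqrt l * a n / sqrt (t n))
          by (field; specialize (Hs n); lra).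
        apply Rle_div_l; [apply Hs|]. rewrite E.
        pose proof (pow2_ge_0 (sqrt (t n) - sqrt (t (S n)))). nra. }
    apply Rle_trans with (1 := H). specialize (Hs n).
    assert (sqrt l * sqrt l = l) by (apply sqrt_sqrt; lra). nra.
Qed.

(* The first [P] convolution widths are [tau * theta], the later ones are
   [tau * c i / e i]; the slowly growing factors [c i] make every single block
   small enough for the Beurling classes. *)
Lemma block_exists (e : nat -> R) (P : nat) (theta tau T : R) :
  (forall i, 1 <= e i) -> 0 < theta -> 0 < tau ->
  (forall i, (P <= i)%nat -> / theta <= e i) ->
  (forall n, psum (fun i => / e (P + i)%nat) n <= T) ->
  2 * T <= INR (S P) * theta ->
  8 * tau * (INR (S P) * theta) <= 1 ->
  exists G : nat -> R -> R,
    deriv_family (fun _ => True) G /\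
    (forall n, G n 0 = if Nat.eq_dec n P then 1 else 0) /\
    (forall n x, 1 < Rabs x -> G n x = 0) /\
    (forall n x, Rabs (G n x) <= 2 ^ n * ((8 * exp 1) ^ S P * (tau ^ P / tau ^ n) *
       (theta ^ P * pprod (fun i => if (i <? P)%nat then / theta else e i) n))) /\
    (forall H, 0 < H -> exists C, forall n x, Rabs (G n x) <= C * (H ^ n * pprod e n)).
Proof.
  intros He Htheta Htau Heth HT Hrho Htr.
  set (rho := INR (S P) * theta) in *.
  assert (HSP : 0 < INR (S P)) by (apply lt_0_INR; lia).
  assert (Hrho0 : 0 < rho) by now apply Rmult_lt_0_compat.
  assert (He0 : forall i, 0 < e i) by (intros i; specialize (He i); lra).
  destruct (slow_weights (fun i => / e (P + i)%nat) T) as [c [Hc1 [Hc2 Hc3]]].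
  { intros i. now apply Rinv_0_lt_compat. }
  { exact HT. }
  assert (Hc0 : forall i, 0 < c i) by (intros i; specialize (Hc1 i); lra).
  set (w := fun i => tau * (if (i <? P)%nat then theta else c (i - P)%nat * / e i)).
  assert (Hw : forall i, 0 < w i).
  { intros i. unfold w. apply Rmult_lt_0_compat; [easy|]. destruct Nat.ltb; [easy|].
    apply Rmult_lt_0_compat; [easy|]. now apply Rinv_0_lt_compat. }
  assert (Hw1 : forall n, (n <= P)%nat -> psum w n = INR n * (tau * theta)).
  { induction n as [|n IH]; intros Hn; simpl psum; [simpl; ring|].
    rewrite IH, S_INR by lia. unfold w. destruct (Nat.ltb_spec n P); [ring|lia]. }
  assert (Hw2 : forall n, psum w (P + n) =
    INR P * (tau * theta) + tau * psum (fun i => c i * / e (P + i)%nat) n).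
  { induction n as [|n IH].
    - rewrite Nat.add_0_r, Hw1 by lia. simpl. ring.
    - rewrite Nat.add_succ_r. simpl psum. rewrite IH. unfold w.
      destruct (Nat.ltb_spec (P + n) P); [lia|].
      replace (P + n - P)%nat with n by lia. ring. }
  (* The first [P] widths contribute at most [tau * rho], and so do the later ones because
     [2 * T <= rho]. The cut-off therefore vanishes beyond [4 * (2 * (tau * rho))], which is at most
     1. *)
  assert (Hsum : forall n, psum w n <= 2 * (tau * rho)).
  { intros n. apply Rle_trans with (psum w (P + n)); [apply psum_le; [easy|lia]|].
    rewrite Hw2. specialize (Hc3 n).
    assert (INR P * (tau * theta) <= tau * rho).
    { unfold rho. rewrite S_INR. nra. }
    assert (tau * psum (fun i => c i * / e (P + i)%nat) n <= tau * rho);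
      [apply Rmult_le_compat_l; lra|lra]. }
  destruct (cutoff_exists w (2 * (tau * rho))) as [u [Hu [Hub [Hu0 [HuS Hus]]]]]; auto.
  { apply Rmult_lt_0_compat; [lra|]. now apply Rmult_lt_0_compat. }
  set (v := monomial P).
  exists (fun n => leibniz u v n 0 0).
  assert (Hsupp : forall n x, 8 * tau * rho < Rabs x -> leibniz u v n 0 0 x = 0).
  { intros n x Hx.
    assert (H : Rabs (leibniz u v n 0 0 x) <= 2 ^ n * 0).
    { apply leibniz_bound. intros a b _. rewrite Hus by lra.
      rewrite Rmult_0_l, Rabs_R0. lra. }
    rewrite Rmult_0_r in H. pose proof (Rabs_pos (leibniz u v n 0 0 x)).
    now apply Rabs_eq_0, Rle_antisym. }
  (* On the support $|x|$ is at most $8\tau\theta(P+1)$; the powers of $P+1$ are absorbed by the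
     factorial through $y^m/m!\le e^y$. *)
  assert (Hv : forall b x, Rabs x <= 8 * tau * rho -> (b <= P)%nat ->
    Rabs (v b x) <= (8 * exp 1) ^ S P * (tau * theta) ^ (P - b)).
  { intros b x Hx Hb. unfold v, monomial. destruct (Nat.leb_spec b P); [|lia].
    set (m := (P - b)%nat). unfold Rdiv.
    rewrite Rabs_mult, <- RPow_abs, Rabs_inv, (Rabs_pos_eq (INR _)) by apply pos_INR.
    apply Rle_trans with ((8 * tau * rho) ^ m * / INR (fact m)).
    { apply Rmult_le_compat_r; [left; apply Rinv_0_lt_compat, INR_fact_lt_0|].
      apply pow_incr. split; [apply Rabs_pos|exact Hx]. }
    replace (8 * tau * rho) with (8 * (tau * theta) * INR (S P)) by (unfold rho; ring).
    rewrite !Rpow_mult_distr.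
    apply Rle_trans with (8 ^ S P * (tau ^ m * theta ^ m) * exp (INR (S P))).
    - rewrite Rmult_assoc. apply Rmult_le_compat.
      + repeat apply Rmult_le_pos; apply pow_le; lra.
      + apply Rmult_le_pos; [apply pow_le; lra|].
        left; apply Rinv_0_lt_compat, INR_fact_lt_0.
      + apply Rmult_le_compat_r; [apply Rmult_le_pos; apply pow_le; lra|].
        apply Rle_pow; [lra|lia].
      + apply pow_div_fact_le_exp. lra.
    - rewrite exp_INR. right. ring. }
  split; [|split; [|split; [|split]]].
  - intros n x _. apply (leibniz_derive u v (fun _ => True)); auto. apply monomial_family.
  - intros n. rewrite leibniz_0 by auto. rewrite Nat.add_0_r. apply monomial_0.
  - intros n x Hx. apply Hsupp. lra.
  - intros n x. set (f := fun i => if (i <? P)%nat then / theta else e i).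
    assert (Hit : 0 < / theta) by now apply Rinv_0_lt_compat.
    assert (Hf : forall i, / theta <= f i).
    { intros i. unfold f. destruct (Nat.ltb_spec i P); [lra|]. now apply Heth. }
    assert (Hf0 : forall i, 0 < f i) by (intros i; specialize (Hf i); lra).
    assert (HK : 0 < (8 * exp 1) ^ S P).
    { apply pow_lt. pose proof (exp_pos 1). lra. }
    assert (Hpos : 0 <= (8 * exp 1) ^ S P * (tau ^ P / tau ^ n) * (theta ^ P * pprod f n)).
    { assert (0 < tau ^ P / tau ^ n) by (apply Rdiv_lt_0_compat; now apply pow_lt).
      assert (0 < theta ^ P) by now apply pow_lt.
      pose proof (pprod_pos f n Hf0). left.
      apply Rmult_lt_0_compat; apply Rmult_lt_0_compat; assumption. }
    destruct (Rle_dec (Rabs x) (8 * tau * rho)) as [Hx|Hx].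
    2: { rewrite Hsupp by lra. rewrite Rabs_R0.
         apply Rmult_le_pos; [apply pow_le; lra|exact Hpos]. }
    apply leibniz_bound. intros a b E. rewrite !Nat.add_0_r in E. subst n.
    rewrite Rabs_mult.
    destruct (le_lt_dec b P) as [Hb|Hb].
    2: { unfold v, monomial. destruct (Nat.leb_spec b P); [lia|].
         rewrite Rabs_R0, Rmult_0_r. exact Hpos. }
    apply Rle_trans with ((/ tau) ^ a * pprod f a *
      ((8 * exp 1) ^ S P * (tau * theta) ^ (P - b))).
    { apply Rmult_le_compat; try apply Rabs_pos; [|now apply Hv].
      apply Rle_trans with (1 := Hub a x). rewrite <- pprod_scal. apply pprod_le.
      intros i. split; [left; now apply Rinv_0_lt_compat|].
      unfold w, f. rewrite Rinv_mult.
      apply Rmult_le_compat_l; [left; now apply Rinv_0_lt_compat|].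
      destruct Nat.ltb; [lra|]. rewrite Rinv_mult, Rinv_inv.
      rewrite <- (Rmult_1_l (e i)) at 2. apply Rmult_le_compat_r; [left; apply He0|].
      rewrite <- Rinv_1. apply Rinv_le_contravar; [lra|apply Hc1]. }
    (* The monomial gains $\theta^{P-b}=\theta^P\theta^{-b}$. As $1/\theta$ is a lower bound for all
       factors of [f], the $b$ missing factors of the product can be filled in. *)
    apply Rle_trans with ((8 * exp 1) ^ S P * (tau ^ P / tau ^ (a + b)) *
      (theta ^ P * (pprod f a * (/ theta) ^ b))).
    + right. rewrite (Rpow_mult_distr tau theta), !pow_inv, (pow_add tau a b).
      generalize ((8 * exp 1) ^ S P). intros K.
      replace (tau ^ P) with (tau ^ (P - b) * tau ^ b) by (rewrite <- pow_add; f_equal; lia).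
      replace (theta ^ P) with (theta ^ (P - b) * theta ^ b) by (rewrite <- pow_add; f_equal; lia).
      field. repeat split; apply pow_nonzero; lra.
    + apply Rmult_le_compat_l.
      { apply Rmult_le_pos; [lra|]. left. apply Rdiv_lt_0_compat; now apply pow_lt. }
      apply Rmult_le_compat_l; [apply pow_le; lra|].
      apply pprod_add_ge; auto. lra.
  - assert (Hsmall : forall H, 0 < H <= 1 -> exists C, 0 <= C /\ forall n x,
      Rabs (leibniz u v n 0 0 x) <= C * (H ^ n * pprod e n)).
    { intros H [HH HH1]. set (H2 := H / 2).
      assert (HH2 : 0 < H2 <= 1) by (unfold H2; lra).
      (* Once $c_i\ge 1/(\tau H_2)$, the reciprocal widths are at most $H_2e_i$; the earlier factors
         only change the constant. *)
      destruct (Hc2 (/ (tau * H2))) as [n0 Hn0].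
      destruct (pprod_eventually_le (fun i => / w i) (fun i => H2 * e i) (P + n0))
        as [C [HC HCn]].
      - intros i. now apply Rinv_0_lt_compat.
      - intros i. apply Rmult_lt_0_compat; [lra|apply He0].
      - intros i Hi. unfold w. destruct (Nat.ltb_spec i P); [lia|].
        specialize (Hn0 (i - P)%nat ltac:(lia)).
        rewrite !Rinv_mult, Rinv_inv.
        rewrite <- Rmult_assoc. apply Rmult_le_compat_r; [left; apply He0|].
        rewrite Rinv_mult in Hn0.
        assert (Hci : 0 < / c (i - P)%nat) by (apply Rinv_0_lt_compat; apply Hc0).
        apply Rmult_le_compat_r with (r := / c (i - P)%nat) in Hn0; [|lra].
        rewrite Rinv_r in Hn0 by (specialize (Hc0 (i - P)%nat); lra).
        apply Rmult_le_compat_r with (r := H2) in Hn0; [|lra].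
        replace (/ tau * / H2 * / c (i - P)%nat * H2) with (/ tau * / c (i - P)%nat) in Hn0
          by (field; repeat split; try lra; specialize (Hc0 (i - P)%nat); lra).
        lra.
      - exists (C * / H2 ^ P * (8 * exp 1 * (1 + tau * theta)) ^ S P).
        assert (HP : 0 < H2 ^ P) by (apply pow_lt; lra).
        assert (Hit : 0 < / H2 ^ P) by (now apply Rinv_0_lt_compat).
        pose proof (exp_pos 1) as Hexp.
        assert (Htt : 0 < tau * theta) by now apply Rmult_lt_0_compat.
        assert (HK : 0 < (8 * exp 1 * (1 + tau * theta)) ^ S P).
        { apply pow_lt. apply Rmult_lt_0_compat; lra. }
        assert (HCC : 0 < C * / H2 ^ P * (8 * exp 1 * (1 + tau * theta)) ^ S P).
        { apply Rmult_lt_0_compat; [|exact HK]. now apply Rmult_lt_0_compat. }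
        split; [lra|]. intros n x.
        assert (HLn : 0 < pprod e n) by now apply pprod_pos.
        destruct (Rle_dec (Rabs x) (8 * tau * rho)) as [Hx|Hx].
        2: { rewrite Hsupp by lra. rewrite Rabs_R0.
             apply Rmult_le_pos; [lra|]. apply Rmult_le_pos; [apply pow_le|]; lra. }
        replace (H ^ n) with (2 ^ n * H2 ^ n)
          by (rewrite <- Rpow_mult_distr; f_equal; unfold H2; field).
        apply Rle_trans with (2 ^ n * ((C * / H2 ^ P * (8 * exp 1 * (1 + tau * theta)) ^ S P)
          * (H2 ^ n * pprod e n))); [|right; ring].
        assert (Hpos : 0 <= (C * / H2 ^ P * (8 * exp 1 * (1 + tau * theta)) ^ S P)
          * (H2 ^ n * pprod e n)).
        { apply Rmult_le_pos; [lra|]. apply Rmult_le_pos; [apply pow_le|]; lra. }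
        apply leibniz_bound. intros a b E. rewrite !Nat.add_0_r in E. subst n.
        rewrite Rabs_mult.
        destruct (le_lt_dec b P) as [Hb|Hb].
        2: { unfold v, monomial. destruct (Nat.leb_spec b P); [lia|].
             rewrite Rabs_R0, Rmult_0_r. exact Hpos. }
        apply Rle_trans with (C * (H2 ^ a * pprod e a) *
          (8 * exp 1 * (1 + tau * theta)) ^ S P).
        + apply Rmult_le_compat; try apply Rabs_pos.
          * apply Rle_trans with (1 := Hub a x). rewrite <- pprod_scal. apply HCn.
          * apply Rle_trans with (1 := Hv b x Hx Hb).
            rewrite (Rpow_mult_distr (8 * exp 1)). apply Rmult_le_compat_l.
            { apply pow_le. lra. }
            apply Rle_trans with ((1 + tau * theta) ^ (P - b)).
            { apply pow_incr. lra. }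
            apply Rle_pow; [lra|lia].
        + assert (Hab : H2 ^ a * pprod e a <= / H2 ^ P * (H2 ^ (a + b) * pprod e (a + b))).
          { rewrite <- Rmult_assoc. apply Rmult_le_compat.
            - apply pow_le; lra.
            - left. now apply pprod_pos.
            - apply Rmult_le_reg_l with (H2 ^ P); [easy|].
              rewrite <- Rmult_assoc, Rinv_r, Rmult_1_l by lra.
              rewrite <- pow_add.
              replace (P + a)%nat with ((a + b) + (P - b))%nat by lia.
              rewrite pow_add. rewrite <- (Rmult_1_r (H2 ^ (a + b))) at 2.
              apply Rmult_le_compat_l; [apply pow_le; lra|].
              rewrite <- (pow1 (P - b)). apply pow_incr. lra.
            - rewrite <- (Rmult_1_r (pprod e a)), <- (pow1 b).
              apply pprod_add_ge; auto. lra. }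
          apply Rle_trans with (C * (/ H2 ^ P * (H2 ^ (a + b) * pprod e (a + b))) *
            (8 * exp 1 * (1 + tau * theta)) ^ S P).
          * apply Rmult_le_compat_r; [lra|]. apply Rmult_le_compat_l; lra.
          * right. ring. }
    intros H HH. destruct (Hsmall (Rmin H 1)) as [C [HC Hn]].
    { split; [apply Rmin_glb_lt; lra|apply Rmin_r]. }
    exists C. intros n x. apply Rle_trans with (1 := Hn n x).
    apply Rmult_le_compat_l; [exact HC|].
    apply Rmult_le_compat_r; [left; now apply pprod_pos|].
    apply pow_incr. split; [apply Rmin_glb; lra|apply Rmin_l].
Qed.

(** * Derivatives on an interval *)

(** This makes the punctured neighbourhoods within [I] a proper filter, for which limits are
    unique. *)
Definition limit_point (I : R -> Prop) (x : R) : Prop :=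
  forall d, 0 < d -> exists y, I y /\ y <> x /\ Rabs (y - x) < d.

Lemma within_proper (I : R -> Prop) (x : R) :
  limit_point I x -> ProperFilter (within I (locally' x)).
Proof.
  intros HI. constructor.
  - intros P [d Hd]. destruct (HI d (cond_pos d)) as [y [Hy [Hne Hlt]]].
    exists y. now apply Hd.
  - constructor.
    + exists (mkposreal 1 Rlt_0_1). easy.
    + intros P Q [d Hd] [d' Hd'].
      assert (Hm : 0 < Rmin d d') by (apply Rmin_glb_lt; apply cond_pos).
      exists (mkposreal _ Hm). intros y Hy Hne Iy. simpl in Hy. split.
      * apply Hd; auto. apply ball_le with (2 := Hy). apply Rmin_l.
      * apply Hd'; auto. apply ball_le with (2 := Hy). apply Rmin_r.
    + intros P Q HPQ [d Hd]. exists d. auto.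
Qed.

Lemma derive_on_correct (I : R -> Prop) (f : R -> C) (x : R) :
  limit_point I x -> ex_derive_on I f x ->
  filterlim (diff_quot f x) (within I (locally' x)) (locally (derive_on I f x)).
Proof.
  intros HI [l Hl]. pose proof (within_proper I x HI) as HF.
  apply filterlim_locally. intros eps.
  apply (complete_cauchy (T := C_R_CompleteNormedModule)
    (filtermap (diff_quot f x) (within I (locally' x)))).
  - now apply filtermap_proper_filter.
  - intros e. exists l. apply (Hl (ball l e)). apply locally_ball.
Qed.

Lemma derive_on_unique (I : R -> Prop) (f : R -> C) (x : R) (l : C) :
  limit_point I x ->
  filterlim (diff_quot f x) (within I (locally' x)) (locally l) ->
  derive_on I f x = l.
Proof.
  intros HI Hl. pose proof (within_proper I x HI) as HF.
  apply (filterlim_locally_unique (V := C_R_NormedModule)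
    (F := within I (locally' x)) (diff_quot f x)); [|exact Hl].
  apply derive_on_correct; [exact HI|now exists l].
Qed.

Lemma fst_diff_quot (f : R -> C) (x y : R) :
  y <> x -> fst (diff_quot f x y) = (fst (f y) - fst (f x)) / (y - x).
Proof.
  intros Hne. unfold diff_quot. destruct (f y) as [a b], (f x) as [c d]. simpl. field. lra.
Qed.

Lemma snd_diff_quot (f : R -> C) (x y : R) :
  y <> x -> snd (diff_quot f x y) = (snd (f y) - snd (f x)) / (y - x).
Proof.
  intros Hne. unfold diff_quot. destruct (f y) as [a b], (f x) as [c d]. simpl. field. lra.
Qed.

Lemma is_derive_quotient (f : R -> R) (x l : R) (eps : posreal) :
  is_derive f x l ->
  locally' x (fun y => Rabs ((f y - f x) / (y - x) - l) < eps).
Proof.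
  intros Hf. apply is_derive_Reals in Hf. destruct (Hf eps (cond_pos eps)) as [d Hd].
  exists d. intros y Hy Hne. change (Rabs (y - x) < d) in Hy.
  specialize (Hd (y - x) (Rminus_eq_contra _ _ Hne) Hy). now rewrite Rplus_minus in Hd.
Qed.

Lemma diff_quot_family (I : R -> Prop) (f : R -> C) (x a b : R) :
  is_derive (fun y => fst (f y)) x a -> is_derive (fun y => snd (f y)) x b ->
  filterlim (diff_quot f x) (within I (locally' x)) (locally ((a, b) : C)).
Proof.
  intros Ha Hb. apply filterlim_locally. intros eps.
  pose proof (is_derive_quotient _ _ _ eps Ha) as H1.
  pose proof (is_derive_quotient _ _ _ eps Hb) as H2.
  unfold locally', within in H1, H2 |- *.
  generalize (filter_and _ _ H1 H2). apply filter_imp. clear H1 H2. intros y [H1 H2] Hne _.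
  specialize (H1 Hne). specialize (H2 Hne). split.
  - change (Rabs (fst (diff_quot f x y) - a) < eps). now rewrite (fst_diff_quot f x y Hne).
  - change (Rabs (snd (diff_quot f x y) - b) < eps). now rewrite (snd_diff_quot f x y Hne).
Qed.

Lemma diff_quot_ext (I : R -> Prop) (f g : R -> C) (x : R) (l : C) :
  I x -> (forall y, I y -> f y = g y) ->
  filterlim (diff_quot f x) (within I (locally' x)) (locally l) ->
  filterlim (diff_quot g x) (within I (locally' x)) (locally l).
Proof.
  intros Hx Hfg Hf P HP. specialize (Hf P HP). revert Hf.
  unfold filtermap, within, locally', within. apply filter_imp. intros y H Hne Hy.
  unfold diff_quot in *. rewrite <- !Hfg by easy. now apply H.
Qed.

Lemma derive_n_on_family (I : R -> Prop) (F1 F2 : nat -> R -> R) :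
  (forall x, I x -> limit_point I x) ->
  deriv_family (fun _ => True) F1 -> deriv_family (fun _ => True) F2 ->
  forall n x, I x ->
    derive_n_on I n (fun y => (F1 O y, F2 O y)) x = (F1 n x, F2 n x) /\
    ex_derive_on I (derive_n_on I n (fun y => (F1 O y, F2 O y))) x.
Proof.
  intros HI H1 H2.
  assert (Hlim : forall n x, I x ->
    (forall y, I y -> derive_n_on I n (fun y => (F1 O y, F2 O y)) y = (F1 n y, F2 n y)) ->
    filterlim (diff_quot (derive_n_on I n (fun y => (F1 O y, F2 O y))) x)
      (within I (locally' x)) (locally ((F1 (S n) x, F2 (S n) x) : C))).
  { intros n x Hx Hn.
    apply diff_quot_ext with (fun y => (F1 n y, F2 n y)); [exact Hx| |].
    - intros y Hy. now rewrite Hn.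
    - apply diff_quot_family; [now apply H1|now apply H2]. }
  assert (Hn : forall n x, I x ->
    derive_n_on I n (fun y => (F1 O y, F2 O y)) x = (F1 n x, F2 n x)).
  { induction n as [|n IH]; intros x Hx; [reflexivity|].
    apply derive_on_unique; [now apply HI|]. now apply Hlim. }
  intros n x Hx. split; [now apply Hn|].
  exists (F1 (S n) x, F2 (S n) x). apply Hlim; auto.
Qed.

Lemma class_dom_limit_point (A : fun_class) (x : R) :
  class_dom A x -> limit_point (class_dom A) x.
Proof.
  intros Hx d Hd.
  assert (H : exists y, 0 < Rabs (y - x) < d /\ (0 <= x -> 0 <= y) /\ (x <= 1 -> y <= 1)).
  { set (e := Rmin (d / 2) (1 / 2)).
    assert (He : 0 < e) by (unfold e, Rmin; destruct Rle_dec; lra).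
    assert (e <= 1 / 2) by apply Rmin_r. assert (e <= d / 2) by apply Rmin_l.
    destruct (Rle_dec x (1 / 2)).
    - exists (x + e). replace (x + e - x) with e by ring. rewrite Rabs_pos_eq; lra.
    - exists (x - e). replace (x - e - x) with (- e) by ring.
      rewrite Rabs_Ropp, Rabs_pos_eq; lra. }
  destruct H as [y [Hy [H0 H1]]]. exists y. split; [|split; [|lra]].
  - destruct A; simpl in *; tauto.
  - intros ->. rewrite Rminus_diag, Rabs_R0 in Hy. lra.
Qed.

Lemma class_dom_unit (A : fun_class) (x : R) : 0 <= x <= 1 -> class_dom A x.
Proof. intros Hx. destruct A; simpl; tauto || lra. Qed.

Lemma support_within (I : R -> Prop) (f : R -> C) (a b : R) :
  (forall x, I x -> x < a \/ b < x -> f x = RtoC 0) ->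
  included (support_on I f) (fun x => a <= x <= b).
Proof.
  intros H x Hx.
  destruct (Rlt_dec x a) as [Ha|Ha]; [|destruct (Rlt_dec b x) as [Hb|Hb]; [|lra]]; exfalso.
  - destruct (Hx (fun y => y < a)) as [y [Hy [Iy Fy]]]; [|now apply Fy, H; auto].
    exists (mkposreal (a - x) ltac:(lra)). intros y Hy. apply Rabs_def2 in Hy. simpl in Hy. lra.
  - destruct (Hx (fun y => b < y)) as [y [Hy [Iy Fy]]]; [|now apply Fy, H; auto].
    exists (mkposreal (x - b) ltac:(lra)). intros y Hy. apply Rabs_def2 in Hy. simpl in Hy. lra.
Qed.

(** * Superposition of blocks *)

Lemma is_derive_quadratic (f : R -> R) (x l K : R) :
  (forall y, Rabs (f y - f x - l * (y - x)) <= K * (y - x) ^ 2) -> is_derive f x l.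
Proof.
  intros H. apply is_derive_Reals. intros eps Heps.
  assert (HK : 0 <= K).
  { specialize (H (x + 1)). pose proof (Rabs_pos (f (x + 1) - f x - l * (x + 1 - x))).
    replace (x + 1 - x) with 1 in * by ring. lra. }
  assert (Hd : 0 < eps / (K + 1)) by (apply Rdiv_lt_0_compat; lra).
  exists (mkposreal _ Hd). intros h Hh0 Hh. simpl in Hh.
  specialize (H (x + h)). replace (x + h - x) with h in H by ring.
  replace ((f (x + h) - f x) / h - l) with ((f (x + h) - f x - l * h) / h) by (field; easy).
  unfold Rdiv. rewrite Rabs_mult, Rabs_inv.
  assert (Hp : 0 < Rabs h) by now apply Rabs_pos_lt.
  apply Rmult_lt_reg_r with (Rabs h); [exact Hp|].
  rewrite Rmult_assoc, Rinv_l, Rmult_1_r by lra.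
  apply Rle_lt_trans with (1 := H). rewrite <- (pow2_abs h).
  assert (Rabs h * (K + 1) < eps).
  { apply Rmult_lt_compat_r with (r := K + 1) in Hh; [|lra].
    replace (eps / (K + 1) * (K + 1)) with eps in Hh by (field; lra). exact Hh. }
  nra.
Qed.

Lemma ex_series_abs_le (a b : nat -> R) :
  (forall p, Rabs (a p) <= b p) -> ex_series b -> ex_series a.
Proof. intros H Hb. now apply (ex_series_le a b). Qed.

Lemma Series_abs_le (a b : nat -> R) :
  (forall p, Rabs (a p) <= b p) -> ex_series b -> Rabs (Series a) <= Series b.
Proof.
  intros H Hb.
  assert (Ha : ex_series (fun p => Rabs (a p))).
  { apply ex_series_abs_le with b; [|exact Hb]. intros p. now rewrite Rabs_Rabsolu. }
  apply Rle_trans with (1 := Series_Rabs a Ha).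
  apply Series_le; [|exact Hb]. intros p. split; [apply Rabs_pos|apply H].
Qed.

Lemma Series_single (a : nat -> R) (p0 : nat) :
  (forall p, p <> p0 -> a p = 0) -> Series a = a p0.
Proof.
  intros H.
  assert (E : forall n, sum_n a n = if le_dec p0 n then a p0 else 0).
  { induction n as [|n IH].
    - rewrite sum_O. destruct (le_dec p0 0) as [Hp|Hp].
      + now replace p0 with O by lia.
      + apply H. lia.
    - rewrite sum_Sn, IH. unfold plus. simpl.
      destruct (le_dec p0 n) as [H1|H1], (le_dec p0 (S n)) as [H2|H2]; try lia.
      + rewrite (H (S n)) by lia. ring.
      + replace p0 with (S n) by lia. ring.
      + rewrite (H (S n)) by lia. ring. }
  unfold Series. rewrite (Lim_seq_ext_loc _ (fun _ => a p0)).
  - now rewrite Lim_seq_const.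
  - exists p0. intros n Hn. rewrite E. now destruct (le_dec p0 n).
Qed.

(** The summable bound on order [n + 2] controls the first order Taylor remainder of each term by a
    multiple of $(y-x)^2$, and these remainders can be summed. This is termwise differentiation
    without an exchange of limits. *)
Lemma series_family (g : nat -> nat -> R -> R) (b : nat -> nat -> R) :
  (forall p, deriv_family (fun _ => True) (g p)) ->
  (forall n p x, Rabs (g p n x) <= b n p) -> (forall n, ex_series (b n)) ->
  deriv_family (fun _ => True) (fun n x => Series (fun p => g p n x)).
Proof.
  intros Hg Hb Hs n x _. apply is_derive_quadratic with (Series (b (S (S n)))). intros y.
  assert (Hex : forall m z, ex_series (fun p => g p m z)).
  { intros m z. apply ex_series_abs_le with (b m); auto. }
  rewrite (Rmult_comm (Series (fun p => g p (S n) x))).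
  rewrite <- Series_minus by auto. rewrite <- Series_scal_l.
  rewrite <- Series_minus; [| |].
  2: { now apply (ex_series_minus (fun p => g p n y) (fun p => g p n x)). }
  2: { now apply (ex_series_scal_l (y - x) (fun p => g p (S n) x)). }
  rewrite Rmult_comm, <- Series_scal_l. apply Series_abs_le.
  2: { now apply (ex_series_scal_l ((y - x) ^ 2) (b (S (S n)))). }
  intros p.
  (* Later [z] is one of the two endpoints, where one of the absolute values vanishes; a free [z]
     covers both orders of [x] and [y]. *)
  assert (H : forall a c, a <= c -> forall z,
    Rabs (g p n c - g p n a - g p (S n) z * (c - a)) <=
      (c - a) * (b (S (S n)) p * (Rabs (c - z) + Rabs (a - z)))).
  { intros a c Hac z.
    destruct (mvt (g p n) (g p (S n)) a c Hac) as [d [Hd ->]]; [intros; now apply Hg|].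
    replace (g p (S n) d * (c - a) - g p (S n) z * (c - a))
      with ((c - a) * (g p (S n) d - g p (S n) z)) by ring.
    rewrite Rabs_mult, Rabs_pos_eq by lra. apply Rmult_le_compat_l; [lra|].
    assert (Hl : forall s t, s <= t ->
      Rabs (g p (S n) t - g p (S n) s) <= b (S (S n)) p * (t - s)).
    { intros s t Hst.
      destruct (mvt (g p (S n)) (g p (S (S n))) s t Hst) as [q [_ ->]]; [intros; now apply Hg|].
      rewrite Rabs_mult, (Rabs_pos_eq (t - s)) by lra.
      apply Rmult_le_compat_r; [lra|apply Hb]. }
    assert (Hb0 : 0 <= b (S (S n)) p).
    { apply Rle_trans with (2 := Hb (S (S n)) p x). apply Rabs_pos. }
    assert (Hdz : Rabs (d - z) <= Rabs (c - z) + Rabs (a - z)).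
    { unfold Rabs; repeat destruct Rcase_abs; lra. }
    apply Rle_trans with (b (S (S n)) p * Rabs (d - z)).
    - destruct (Rle_dec z d).
      + rewrite (Rabs_pos_eq (d - z)) by lra. now apply Hl.
      + rewrite (Rabs_minus_sym d z), (Rabs_pos_eq (z - d)), Rabs_minus_sym by lra.
        apply Hl. lra.
    - now apply Rmult_le_compat_l. }
  destruct (Rle_dec x y) as [Hxy|Hxy].
  - specialize (H x y Hxy x). rewrite Rminus_diag, Rabs_R0, (Rabs_pos_eq (y - x)) in H by lra.
    rewrite (Rmult_comm (y - x)). apply Rle_trans with (1 := H). right. ring.
  - specialize (H y x ltac:(lra) x). rewrite Rminus_diag, Rabs_R0, (Rabs_left (y - x)) in H by lra.
    rewrite <- Rabs_Ropp.
    replace (- (g p n y - g p n x - (y - x) * g p (S n) x))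
      with (g p n x - g p n y - g p (S n) x * (x - y)) by ring.
    apply Rle_trans with (1 := H). right. ring.
Qed.

(** Integrating from the point 2, where everything vanishes, over a length of at most 3 lowers the
    order by one. This bounds the orders between multiples of [r]. *)
Lemma support_bound (G : nat -> R -> R) (d n : nat) (B : R) :
  deriv_family (fun _ => True) G -> (forall m x, 1 < Rabs x -> G m x = 0) ->
  (forall x, Rabs (G (n + d)%nat x) <= B) -> forall x, Rabs (G n x) <= 3 ^ d * B.
Proof.
  intros HG Hs. revert n. induction d as [|d IH]; intros n HB x.
  - rewrite Nat.add_0_r in HB. rewrite Rmult_1_l. apply HB.
  - rewrite Nat.add_succ_r in HB. specialize (IH (S n) HB).
    assert (HB0 : 0 <= 3 ^ d * B).
    { apply Rle_trans with (2 := IH 0). apply Rabs_pos. }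
    simpl. destruct (Rlt_dec 1 (Rabs x)) as [Hx|Hx].
    { rewrite Hs, Rabs_R0 by easy. lra. }
    assert (Hx1 : -1 <= x <= 1) by (apply Rabs_le_between; lra).
    destruct (mvt (G n) (G (S n)) x 2) as [c [_ E]]; [lra|intros; now apply HG|].
    rewrite (Hs n 2) in E by (rewrite Rabs_pos_eq; lra).
    replace (G n x) with (- (G (S n) c * (2 - x))) by lra.
    rewrite Rabs_Ropp, Rabs_mult, (Rabs_pos_eq (2 - x)) by lra.
    specialize (IH c). pose proof (Rabs_pos (G (S n) c)). nra.
Qed.

Lemma jets_of_blocks (A : fun_class) (t : ultra_type) (r : nat) (N : nat -> R)
    (a : nat -> C) (G : nat -> nat -> R -> R) :
  (1 <= r)%nat -> (forall n, 0 < N n) ->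
  (forall p, deriv_family (fun _ => True) (G p)) ->
  (forall p n, G p n 0 = if Nat.eq_dec n (r * p) then 1 else 0) ->
  (forall p n x, 1 < Rabs x -> G p n x = 0) ->
  quantify_h t (fun h => exists b, ex_series b /\
    forall p m x, Cmod (a p) * Rabs (G p (r * m)%nat x) <= b p * (h ^ m * N m)) ->
  jets A t r N a.
Proof.
  intros Hr HN HG HG0 Hsupp Hq.
  assert (Hex : exists h b, 0 < h /\ ex_series b /\
    forall p m x, Cmod (a p) * Rabs (G p (r * m)%nat x) <= b p * (h ^ m * N m)).
  { destruct t; simpl in Hq.
    - destruct Hq as [h [Hh [b Hb]]]. now exists h, b.
    - destruct (Hq 1 Rlt_0_1) as [b Hb]. exists 1, b. split; [lra|exact Hb]. }
  destruct Hex as [h0 [b0 [Hh0 [Hb0 Hb]]]].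
  (* Order [n] is estimated from the next multiple [r * S (n / r)] of [r] by [support_bound]. Any
     single [h0] is enough here, where only smoothness of the sum is at stake. *)
  set (bb := fun n p => 3 ^ (r * S (n / r) - n) * (b0 p * (h0 ^ S (n / r) * N (S (n / r))))).
  assert (Hbb : forall n, ex_series (bb n)).
  { intros n. unfold bb.
    apply (ex_series_scal_l (3 ^ (r * S (n / r) - n))
      (fun p => b0 p * (h0 ^ S (n / r) * N (S (n / r))))).
    now apply (ex_series_scal_r (h0 ^ S (n / r) * N (S (n / r))) b0). }
  assert (Hterm : forall (c : nat -> R), (forall p, Rabs (c p) <= Cmod (a p)) ->
    deriv_family (fun _ => True) (fun n x => Series (fun p => c p * G p n x)) /\
    (forall n p x, Rabs (c p * G p n x) <= bb n p)).
  { intros c Hc.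
    assert (Hcb : forall n p x, Rabs (c p * G p n x) <= bb n p).
    { intros n p x.
      assert (Hn : (n <= r * S (n / r))%nat).
      { pose proof (Nat.div_mod_eq n r). pose proof (Nat.mod_upper_bound n r). nia. }
      apply (support_bound (fun n x => c p * G p n x) (r * S (n / r) - n) n).
      - intros m y _. apply is_derive_scal. now apply HG.
      - intros m y Hy. rewrite Hsupp by easy. ring.
      - intros y. replace (n + (r * S (n / r) - n))%nat with (r * S (n / r))%nat by lia.
        rewrite Rabs_mult. apply Rle_trans with (2 := Hb p (S (n / r)) y).
        apply Rmult_le_compat_r; [apply Rabs_pos|apply Hc]. }
    split; [|exact Hcb].
    apply (series_family (fun p n x => c p * G p n x) bb); auto.
    intros p n x _. apply is_derive_scal. now apply HG. }
  assert (Hf : forall p, Rabs (fst (a p)) <= Cmod (a p)) by (intros p; apply re_le_Cmod).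
  assert (Hs : forall p, Rabs (snd (a p)) <= Cmod (a p)).
  { intros p. apply Rle_trans with (2 := Rmax_Cmod (a p)). apply Rmax_r. }
  destruct (Hterm (fun p => fst (a p)) Hf) as [HF1 Hb1].
  destruct (Hterm (fun p => snd (a p)) Hs) as [HF2 Hb2].
  set (F1 := fun n x => Series (fun p => fst (a p) * G p n x)).
  set (F2 := fun n x => Series (fun p => snd (a p) * G p n x)).
  fold F1 in HF1. fold F2 in HF2.
  assert (Hsum1 : forall (c : nat -> R) n p0,
    (forall p, p <> p0 -> c p * G p n 0 = 0) -> Series (fun p => c p * G p n 0) = c p0 * G p0 n 0).
  { intros c n p0 H. now apply (Series_single (fun p => c p * G p n 0)). }
  assert (H0r : forall (c : nat -> R) n j, (1 <= j)%nat -> (j < r)%nat ->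
    Series (fun p => c p * G p (r * n + j)%nat 0) = 0).
  { intros c n j H1 H2. rewrite (Hsum1 c _ 0%nat).
    - rewrite HG0. destruct Nat.eq_dec; [|ring]. lia.
    - intros p _. rewrite HG0. destruct Nat.eq_dec as [E|]; [|ring].
      assert (n < p \/ p <= n)%nat by lia. nia. }
  assert (H0j : forall (c : nat -> R) j, Series (fun p => c p * G p (r * j)%nat 0) = c j).
  { intros c j. rewrite (Hsum1 c _ j).
    - rewrite HG0. destruct Nat.eq_dec; [ring|lia].
    - intros p Hp. rewrite HG0. destruct Nat.eq_dec as [E|]; [|ring].
      apply Nat.mul_cancel_l in E; lia. }
  set (f := fun y => (F1 O y, F2 O y) : C).
  pose proof (derive_n_on_family (class_dom A) F1 F2 (class_dom_limit_point A) HF1 HF2) as HD.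
  fold f in HD.
  assert (Hd0 : class_dom A 0) by (apply class_dom_unit; lra).
  exists f. split; [split; [split; [|split]|]|].
  - intros n x Hx. now apply HD.
  - intros n j H1 H2. rewrite (proj1 (HD _ _ Hd0)). unfold F1, F2.
    now rewrite !H0r.
  - assert (Hfin : forall h b, 0 < h -> ex_series b ->
      (forall p m x, Cmod (a p) * Rabs (G p (r * m)%nat x) <= b p * (h ^ m * N m)) ->
      exists B : R, forall n x, class_dom A x ->
        Cmod (derive_n_on (class_dom A) (r * n) f x) / (h ^ n * N n) <= B).
    { intros h b Hh Hsb Hhb. exists (sqrt 2 * Series b). intros n x Hx.
      rewrite (proj1 (HD _ _ Hx)).
      assert (Hp : 0 < h ^ n * N n) by (apply Rmult_lt_0_compat; [now apply pow_lt|apply HN]).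
      apply Rle_div_l; [exact Hp|].
      apply Rle_trans with (1 := Cmod_2Rmax _). rewrite Rmult_assoc.
      apply Rmult_le_compat_l; [apply sqrt_pos|].
      assert (Hc : forall c : nat -> R, (forall p, Rabs (c p) <= Cmod (a p)) ->
        Rabs (Series (fun p => c p * G p (r * n)%nat x)) <= Series b * (h ^ n * N n)).
      { intros c Hc. rewrite <- Series_scal_r. apply Series_abs_le.
        - intros p. rewrite Rabs_mult. apply Rle_trans with (2 := Hhb p n x).
          apply Rmult_le_compat_r; [apply Rabs_pos|apply Hc].
        - now apply (ex_series_scal_r (h ^ n * N n) b). }
      apply Rmax_lub; simpl; now apply Hc. }
    destruct t; simpl in *.
    + destruct Hq as [h [Hh [b [H1 H2]]]]. exists h. split; [exact Hh|]. now apply Hfin with b.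
    + intros h Hh. destruct (Hq h Hh) as [b [H1 H2]]. now apply Hfin with b.
  - assert (Hz : forall x, 1 < Rabs x -> f x = RtoC 0).
    { intros x Hx. unfold f, F1, F2, RtoC.
      assert (Hz : forall c : nat -> R, Series (fun p => c p * G p O x) = 0).
      { intros c. rewrite (Series_ext _ (fun p => 0 * c p)).
        - rewrite Series_scal_l. ring.
        - intros p. rewrite Hsupp by easy. ring. }
      now rewrite !Hz. }
    destruct A; simpl; trivial; apply support_within; intros x Hx H; apply Hz.
    + destruct H; [rewrite Rabs_left|rewrite Rabs_pos_eq]; lra.
    + simpl in Hx. destruct H; [lra|]. rewrite Rabs_pos_eq; lra.
  - intros j. rewrite (proj1 (HD _ _ Hd0)). unfold F1, F2. rewrite !H0j.
    now destruct (a j).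
Qed.

(** * Partial sums, blocks of length [r], and roots *)

Lemma psum_sum_n (a : nat -> R) (n : nat) : sum_n a n = psum a (S n).
Proof.
  induction n as [|n IH]; [rewrite sum_O; simpl; ring|].
  rewrite sum_Sn, IH. reflexivity.
Qed.

Lemma psum_le_Series (a : nat -> R) (n : nat) :
  (forall i, 0 <= a i) -> ex_series a -> psum a n <= Series a.
Proof.
  intros Ha Hex. apply Series_correct in Hex.
  destruct n as [|n].
  - apply (is_lim_seq_le (fun _ => 0) (sum_n a) 0 (Series a)); [|apply is_lim_seq_const|exact Hex].
    intros m. rewrite psum_sum_n. induction m as [|m IH]; simpl in *; [|specialize (Ha (S m))];
      try specialize (Ha O); lra.
  - rewrite <- psum_sum_n. apply (is_lim_seq_incr_compare (sum_n a) (Series a) Hex).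
    intros m. rewrite sum_Sn. unfold plus; simpl. specialize (Ha (S m)). lra.
Qed.

Lemma Series_of_psum_le (a : nat -> R) (B : R) :
  (forall i, 0 <= a i) -> (forall n, psum a n <= B) -> ex_series a /\ Series a <= B.
Proof.
  intros Ha HB.
  destruct (ex_finite_lim_seq_incr (sum_n a) B) as [l Hl].
  - intros n. rewrite sum_Sn. unfold plus; simpl. specialize (Ha (S n)). lra.
  - intros n. rewrite psum_sum_n. apply HB.
  - split; [now exists l|]. rewrite (is_series_unique a l Hl).
    apply (is_lim_seq_le (sum_n a) (fun _ => B) l B); [|exact Hl|apply is_lim_seq_const].
    intros n. rewrite psum_sum_n. apply HB.
Qed.

Lemma psum_blocks (r : nat) (a b : nat -> R) (m : nat) :
  (forall m j, (j < r)%nat -> a (r * m + j)%nat = b m) ->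
  psum a (r * m) = INR r * psum b m.
Proof.
  intros H. induction m as [|m IH]; [rewrite Nat.mul_0_r; simpl; ring|].
  assert (Hj : forall j, (j <= r)%nat -> psum a (r * m + j) = psum a (r * m) + INR j * b m).
  { induction j as [|j IHj]; intros Hj; [rewrite Nat.add_0_r; simpl; ring|].
    rewrite Nat.add_succ_r. simpl psum. rewrite IHj, H, S_INR by lia. ring. }
  rewrite Nat.mul_succ_r, Hj, IH by lia. simpl. ring.
Qed.

Lemma pprod_blocks (r : nat) (a b : nat -> R) (m : nat) :
  (forall m j, (j < r)%nat -> a (r * m + j)%nat = b m) ->
  pprod a (r * m) = pprod (fun i => b i ^ r) m.
Proof.
  intros H. induction m as [|m IH]; [now rewrite Nat.mul_0_r|].
  assert (Hj : forall j, (j <= r)%nat -> pprod a (r * m + j) = pprod a (r * m) * b m ^ j).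
  { induction j as [|j IHj]; intros Hj; [rewrite Nat.add_0_r; simpl; ring|].
    rewrite Nat.add_succ_r. simpl pprod. rewrite IHj, H by lia. simpl. ring. }
  rewrite Nat.mul_succ_r, Hj, IH by lia. reflexivity.
Qed.

Lemma Rpower_root_pow (x : R) (r : nat) : (1 <= r)%nat -> 0 < x -> Rpower x (/ INR r) ^ r = x.
Proof.
  intros Hr Hx. rewrite <- Rpower_pow by apply exp_pos. rewrite Rpower_mult, Rinv_l.
  - now apply Rpower_1.
  - apply not_0_INR. lia.
Qed.

Lemma Rpower_root_le (x y : R) (r : nat) :
  (1 <= r)%nat -> 0 < x -> 0 <= y -> x <= y ^ r -> Rpower x (/ INR r) <= y.
Proof.
  intros Hr Hx Hy H.
  destruct (Req_dec y 0) as [->|Hy0].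
  { rewrite pow_i in H by lia. lra. }
  replace y with (Rpower (y ^ r) (/ INR r)).
  - apply Rle_Rpower_l; [|lra]. left. apply Rinv_0_lt_compat, lt_0_INR. lia.
  - rewrite <- Rpower_pow, Rpower_mult, Rinv_r, Rpower_1; [easy|lra| |lra].
    apply not_0_INR. lia.
Qed.

Lemma Rpower_Rinv (x y : R) : 0 < x -> Rpower (/ x) y = / Rpower x y.
Proof.
  intros Hx. unfold Rpower. rewrite <- exp_Ropp, ln_Rinv by easy. f_equal. ring.
Qed.

(** * Weight sequences *)

(** The factor paid in passing from order [k] to [k + 1], constant on blocks of [r] orders. The
    successor makes block 0 carry $\nu_1$, so that the first [r * n] factors multiply to $N_n$. *)
Definition root_quot (r : nat) (N : nat -> R) (k : nat) : R :=
  Rpower (quotients N (S (k / r))) (/ INR r).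

Section Weights.

Variable N : nat -> R.
Hypothesis N_LC : class_LC N.

Lemma LC_pos (n : nat) : 0 < N n.
Proof. apply N_LC. Qed.

Lemma quotients_step (n : nat) : quotients N (S n) <= quotients N (S (S n)).
Proof.
  simpl. pose proof (LC_pos n). pose proof (LC_pos (S n)).
  destruct N_LC as [_ [_ [H2 _]]]. specialize (H2 n).
  apply Rle_div_l; [easy|].
  replace (N (S (S n)) / N (S n) * N n) with (N n * N (S (S n)) / N (S n)) by (field; lra).
  apply Rle_div_r; [easy|]. lra.
Qed.

Lemma quotients_mono (m n : nat) : (m <= n)%nat -> quotients N (S m) <= quotients N (S n).
Proof.
  induction 1 as [|n _ IH]; [lra|]. pose proof (quotients_step n). lra.
Qed.

Lemma quotients_ge_1 (n : nat) : 1 <= quotients N (S n).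
Proof.
  apply Rle_trans with (quotients N 1); [|apply quotients_mono; lia].
  simpl. destruct N_LC as [_ [[H0 H1] _]]. rewrite H0. lra.
Qed.

Lemma quotients_mult (n : nat) : N (S n) = N n * quotients N (S n).
Proof. simpl. pose proof (LC_pos n). field. lra. Qed.

Lemma LC_le_quotient_pow (n i p : nat) :
  (n + i <= p)%nat -> N (n + i) <= N n * quotients N p ^ i.
Proof.
  induction i as [|i IH]; intros H; [rewrite Nat.add_0_r; simpl; lra|].
  rewrite Nat.add_succ_r, quotients_mult. specialize (IH ltac:(lia)).
  destruct p as [|p]; [lia|].
  pose proof (quotients_mono (n + i) p ltac:(lia)).
  pose proof (LC_pos (n + i)). pose proof (quotients_ge_1 (n + i)).
  replace (N n * quotients N (S p) ^ S i) with (N n * quotients N (S p) ^ i * quotients N (S p))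
    by (rewrite <- tech_pow_Rmult; ring).
  apply Rmult_le_compat; lra.
Qed.

Variable r : nat.
Hypothesis r_pos : (1 <= r)%nat.

Lemma root_quot_ge_1 (k : nat) : 1 <= root_quot r N k.
Proof.
  unfold root_quot. rewrite <- (Rpower_O (quotients N (S (k / r)))).
  2: { pose proof (quotients_ge_1 (k / r)). lra. }
  apply Rle_Rpower; [apply quotients_ge_1|].
  left. apply Rinv_0_lt_compat, lt_0_INR. lia.
Qed.

Lemma root_quot_mono (j k : nat) : (j <= k)%nat -> root_quot r N j <= root_quot r N k.
Proof.
  intros H. apply Rle_Rpower_l.
  - left. apply Rinv_0_lt_compat, lt_0_INR. lia.
  - split; [pose proof (quotients_ge_1 (j / r)); lra|].
    apply quotients_mono. now apply Nat.Div0.div_le_mono.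
Qed.

Lemma root_quot_block (m j : nat) :
  (j < r)%nat -> root_quot r N (r * m + j) = Rpower (quotients N (S m)) (/ INR r).
Proof.
  intros Hj. unfold root_quot. do 3 f_equal.
  rewrite Nat.mul_comm, Nat.div_add_l, Nat.div_small by lia. lia.
Qed.

Lemma pprod_root_quot (n : nat) : pprod (root_quot r N) (r * n) = N n.
Proof.
  rewrite (pprod_blocks r _ _ n (root_quot_block)).
  induction n as [|n IH]; [symmetry; apply N_LC|].
  change (pprod (fun i => Rpower (quotients N (S i)) (/ INR r) ^ r) n *
    Rpower (quotients N (S n)) (/ INR r) ^ r = N (S n)).
  rewrite IH, quotients_mult, Rpower_root_pow; [reflexivity|easy|].
  pose proof (quotients_ge_1 n). lra.
Qed.

End Weights.

(** * The quantity [lambda] *)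

Section Lambda.

Variables (M N : nat -> R) (p s : nat).
Hypothesis M_pos : forall n, 0 < M n.
Hypothesis N_pos : forall n, 0 < N n.
Hypothesis p_pos : (1 <= p)%nat.
Hypothesis s_pos : (1 <= s)%nat.

Let value (j : nat) : R := Rpower (M p / (INR s ^ p * N j)) (/ INR (p - j)).

Lemma value_base_pos (j : nat) : 0 < M p / (INR s ^ p * N j).
Proof.
  apply Rdiv_lt_0_compat; [easy|]. apply Rmult_lt_0_compat; [|easy].
  apply pow_lt, lt_0_INR. lia.
Qed.

Lemma lambda_is_lub :
  is_lub_Rbar (fun x => exists j : nat, (j < p)%nat /\ x = value j) (lambda M N p s).
Proof.
  assert (H : forall q, exists B, forall j, (j < q)%nat -> value j <= B).
  { induction q as [|q [B HB]]; [now exists 0|].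
    exists (Rmax B (value q)). intros j Hj. destruct (Nat.eq_dec j q) as [->|Hne].
    - apply Rmax_r.
    - apply Rle_trans with (2 := Rmax_l _ _). apply HB. lia. }
  destruct (H p) as [B HB].
  unfold lambda.
  set (E := fun x => exists j : nat, (j < p)%nat /\
    x = Rpower (M p / (INR s ^ p * N j)) (/ INR (p - j))).
  pose proof (Lub_Rbar_correct E) as HL.
  destruct (Lub_Rbar E) as [l| |] eqn:El; [exact HL| |]; exfalso; destruct HL as [H1 H2].
  - apply (H2 (Finite B)). intros x [j [Hj ->]]. now apply HB.
  - apply (H1 (value 0)). exists O. split; [lia|reflexivity].
Qed.

Lemma lambda_pos : 0 < lambda M N p s.
Proof.
  apply Rlt_le_trans with (value 0); [apply exp_pos|].
  apply (proj1 lambda_is_lub). exists O. split; [lia|reflexivity].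
Qed.

Lemma lambda_pow_ge (j : nat) :
  (j < p)%nat -> M p / (INR s ^ p * N j) <= lambda M N p s ^ (p - j).
Proof.
  intros Hj. rewrite <- (Rpower_root_pow (M p / (INR s ^ p * N j)) (p - j));
    [|lia|apply value_base_pos].
  apply pow_incr. split; [left; apply exp_pos|].
  apply (proj1 lambda_is_lub). now exists j.
Qed.

Lemma lambda_le (X : R) :
  0 <= X -> (forall j, (j < p)%nat -> M p / (INR s ^ p * N j) <= X ^ (p - j)) ->
  lambda M N p s <= X.
Proof.
  intros HX H.
  apply (proj2 lambda_is_lub (Finite X)). intros x [j [Hj ->]].
  apply Rpower_root_le; [lia|apply value_base_pos|exact HX|now apply H].
Qed.

End Lambda.

(** $N_p/N_j$ is a product of $p-j$ quotients, none above $\nu_p$, and $s^p$ absorbs $K^p$. This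
    controls the single term $\nu_p^{-1/r}$, which both directions treat apart from the tail. *)
Lemma lambda_le_quotient (M N : nat -> R) (K : R) (p s : nat) :
  (forall n, 0 < M n) -> class_LC N -> (forall p, M p <= K ^ p * N p) -> 0 <= K ->
  (1 <= p)%nat -> (1 <= s)%nat -> K <= INR s -> lambda M N p s <= quotients N p.
Proof.
  intros HM HN HK HK0 Hp Hs HKs. pose proof (LC_pos N HN) as HN0.
  assert (Hq : 1 <= quotients N p).
  { destruct p as [|p]; [lia|]. now apply quotients_ge_1. }
  apply lambda_le; auto; [lra|]. intros j Hj.
  assert (Hsp : 0 < INR s ^ p) by (apply pow_lt, lt_0_INR; lia).
  apply Rle_div_l; [now apply Rmult_lt_0_compat|].
  apply Rle_trans with (1 := HK p).
  replace (quotients N p ^ (p - j) * (INR s ^ p * N j))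
    with (INR s ^ p * (N j * quotients N p ^ (p - j))) by ring.
  apply Rmult_le_compat; [now apply pow_le|left; apply HN0|apply pow_incr; lra|].
  replace p with (j + (p - j))%nat at 1 by lia. apply LC_le_quotient_pow; [easy|lia].
Qed.

(** Allows the witness [s] of the condition to be raised above [K]. *)
Lemma lambda_antitone (M N : nat -> R) (p s s' : nat) :
  (forall n, 0 < M n) -> (forall n, 0 < N n) -> (1 <= p)%nat -> (1 <= s <= s')%nat ->
  lambda M N p s' <= lambda M N p s.
Proof.
  intros HM HN Hp Hs.
  apply lambda_le; auto; [lia|left; apply lambda_pos; auto; lia|]. intros j Hj.
  apply Rle_trans with (2 := lambda_pow_ge M N p s HM HN Hp (proj1 Hs) j Hj).
  assert (0 < INR s) by (apply lt_0_INR; lia).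
  apply Rmult_le_compat_l; [left; apply HM|]. apply Rinv_le_contravar.
  - apply Rmult_lt_0_compat; [now apply pow_lt|easy].
  - apply Rmult_le_compat_r; [left; apply HN|]. apply pow_incr. split; [lra|]. apply le_INR. lia.
Qed.

(** * The condition is sufficient *)

Lemma Series_tail_lim (t : nat -> R) :
  ex_series t -> is_lim_seq (fun p => Series (fun k => t (p + k)%nat)) 0.
Proof.
  intros Hex. apply is_lim_seq_incr_1.
  apply (is_lim_seq_ext (fun p => Series t - sum_n t p)).
  - intros p. rewrite (Series_incr_n t (S p)) by (auto; lia). simpl pred.
    rewrite <- sum_n_Reals. ring.
  - replace 0 with (Series t - Series t) by ring.
    apply is_lim_seq_minus'; [apply is_lim_seq_const|]. now apply Series_correct.
Qed.

(** Olivier's theorem: at least half of the indices up to [p] lie in the tail from $p/2$, and each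
    of their terms is at least [t p]. *)
Lemma mul_terms_lim (t : nat -> R) :
  (forall k, 0 <= t k) -> (forall j k, (j <= k)%nat -> t k <= t j) -> ex_series t ->
  is_lim_seq (fun p => INR (S p) * t p) 0.
Proof.
  intros H0 Hdec Hex.
  apply is_lim_seq_spec. intros eps.
  assert (He : 0 < eps / 2) by (pose proof (cond_pos eps); lra).
  destruct (proj2 (is_lim_seq_spec _ _) (Series_tail_lim t Hex) (mkposreal _ He)) as [n0 Hn0].
  exists (2 * n0)%nat. intros p Hp. rewrite Rminus_0_r, Rabs_pos_eq.
  2: { apply Rmult_le_pos; [apply pos_INR|apply H0]. }
  set (q := (p / 2)%nat).
  assert (Hq : (2 * q <= p < 2 * q + 2)%nat).
  { pose proof (Nat.div_mod_eq p 2). pose proof (Nat.mod_upper_bound p 2). unfold q. lia. }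
  specialize (Hn0 q ltac:(lia)). simpl pos in Hn0. rewrite Rminus_0_r in Hn0.
  apply Rabs_def2 in Hn0.
  assert (Hps : forall n, (n <= S p - q)%nat -> INR n * t p <= psum (fun k => t (q + k)%nat) n).
  { induction n as [|n IH]; intros Hn; [simpl; lra|]. simpl psum. rewrite S_INR.
    specialize (IH ltac:(lia)). pose proof (Hdec (q + n)%nat p ltac:(lia)). lra. }
  specialize (Hps (S p - q)%nat (le_n _)).
  pose proof (psum_le_Series (fun k => t (q + k)%nat) (S p - q)) as Hs.
  assert (Hex' : ex_series (fun k => t (q + k)%nat)) by now apply ex_series_incr_n.
  specialize (Hs (fun i => H0 _) Hex').
  assert (INR (S p) <= 2 * INR (S p - q)).
  { replace 2 with (INR 2) by (simpl; ring). rewrite <- mult_INR. apply le_INR. lia. }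
  specialize (H0 p). nra.
Qed.

(** * Construction of the blocks and choice of the scales *)

Lemma choice_fun (A B : Type) (P : A -> B -> Prop) :
  (forall x, exists y, P x y) -> exists f, forall x, P x (f x).
Proof.
  intros H. exists (fun x => proj1_sig (constructive_indefinite_description _ (H x))).
  intros x. exact (proj2_sig (constructive_indefinite_description _ (H x))).
Qed.

(** [rho p] bounds the support of the unscaled block; that it tends to 0 leaves room for scales
    [tau] tending to infinity. The quantitative bound starts at [p = 1], where [lambda] is a
    supremum over a nonempty set; the last clause also covers [p = 0]. *)
Lemma blocks_exist (r : nat) (M N : nat -> R) (K : R) :
  (1 <= r)%nat -> class_LC M -> class_LC N ->
  1 <= K -> (forall p, M p <= K ^ p * N p) -> cond_SV r M N ->
  exists (C0 : R) (rho : nat -> R),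
    0 < C0 /\ (forall p, 0 < rho p) /\ is_lim_seq rho 0 /\
    forall p tau, 0 < tau -> tau * rho p <= 1 ->
    exists G : nat -> R -> R,
      deriv_family (fun _ => True) G /\
      (forall n, G n 0 = if Nat.eq_dec n (r * p) then 1 else 0) /\
      (forall n x, 1 < Rabs x -> G n x = 0) /\
      ((1 <= p)%nat -> forall m x, Rabs (G (r * m)%nat x) <=
         8 * exp 1 * (C0 * tau ^ r) ^ p * (2 ^ r / tau ^ r) ^ m * (N m / M p)) /\
      (forall h, 0 < h -> exists C, forall m x, Rabs (G (r * m)%nat x) <= C * (h ^ m * N m)).
Proof.
  intros Hr HM HN HK HMN [s0 [Hs0 [Hex [B0 HB0]]]].
  pose proof (LC_pos M HM) as HM0. pose proof (LC_pos N HN) as HN0.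
  set (t := fun k => Rpower (/ quotients N k) (/ INR r)) in *.
  assert (HrR : 0 < INR r) by (apply lt_0_INR; lia).
  assert (Hir : 0 < / INR r) by now apply Rinv_0_lt_compat.
  set (e := root_quot r N).
  assert (He1 : forall i, 1 <= e i) by (intros i; now apply root_quot_ge_1).
  assert (Hq1 : forall p, 1 <= quotients N p).
  { intros [|p]; [simpl; lra|now apply quotients_ge_1]. }
  assert (Hqm : forall j k, (j <= k)%nat -> quotients N j <= quotients N k).
  { intros [|j] [|k] H; try lia; [apply Rle_refl|apply Hq1|]. apply quotients_mono; [easy|lia]. }
  assert (Ht0 : forall k, 0 < t k) by (intros k; apply exp_pos).
  assert (Htinv : forall k, t k = / Rpower (quotients N k) (/ INR r)).
  { intros k. apply Rpower_Rinv. specialize (Hq1 k). lra. }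
  assert (Htdec : forall j k, (j <= k)%nat -> t k <= t j).
  { intros j k H. rewrite !Htinv. apply Rinv_le_contravar; [apply exp_pos|].
    apply Rle_Rpower_l; [lra|]. specialize (Hqm j k H). specialize (Hq1 j). lra. }
  assert (Hext : ex_series t) by (apply ex_series_incr_1; apply (Hex 1%nat); lia).
  assert (Hexp : forall p, ex_series (fun k => t (p + k)%nat)).
  { intros p. now apply ex_series_incr_n. }
  set (R_ := fun p => Series (fun k => t (p + k)%nat)).
  assert (HR0 : forall p, 0 <= R_ p).
  { intros p. apply (psum_le_Series (fun k => t (p + k)%nat) 0); auto. intros i. left. apply Ht0. }
  (* The first summand makes [INR (S (r * p)) * theta p] at least twice the bound [INR r * R_ p] for
     the later widths; the second makes [/ theta p] at most every later factor [e i], as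
     [block_exists] demands. *)
  set (theta := fun p => 2 * INR r * R_ p / INR (S (r * p)) + t p).
  assert (HSp : forall p, 0 < INR (S (r * p))) by (intros p; apply lt_0_INR; lia).
  assert (Hth0 : forall p, t p <= theta p).
  { intros p. unfold theta.
    assert (0 <= 2 * INR r * R_ p / INR (S (r * p))); [|lra].
    apply Rmult_le_pos; [|left; now apply Rinv_0_lt_compat].
    specialize (HR0 p). apply Rmult_le_pos; lra. }
  assert (Hthp : forall p, 0 < theta p).
  { intros p. specialize (Ht0 p). specialize (Hth0 p). lra. }
  assert (Hs : exists s, (s0 <= s)%nat /\ K <= INR s).
  { destruct (INR_unbounded K) as [n Hn]. exists (s0 + n)%nat. split; [lia|].
    rewrite plus_INR. pose proof (pos_INR s0). lra. }
  destruct Hs as [s [Hs HKs]].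
  assert (Hs1 : 1 <= INR s) by (change 1 with (INR 1); apply le_INR; lia).
  (* The two parts of the constant belong to the two summands of [theta]: the condition bounds the
     tail, [lambda_le_quotient] the single term. *)
  set (B1 := 2 * Rabs B0 + 1).
  assert (HB1 : 1 <= B1) by (unfold B1; pose proof (Rabs_pos B0); lra).
  set (lam := fun p => lambda M N p s).
  assert (Hlam0 : forall p, (1 <= p)%nat -> 0 < lam p).
  { intros p Hp. apply lambda_pos; lia. }
  assert (Hlam : forall p, (1 <= p)%nat -> theta p * Rpower (lam p) (/ INR r) <= B1).
  { intros p Hp. unfold theta. rewrite Rmult_plus_distr_r.
    assert (Hp0 : 0 < INR p) by (apply lt_0_INR; lia).
    assert (H1 : t p * Rpower (lam p) (/ INR r) <= 1).
    { rewrite Htinv. apply Rmult_le_reg_l with (Rpower (quotients N p) (/ INR r));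
        [apply exp_pos|].
      rewrite <- Rmult_assoc, Rinv_r, Rmult_1_l, Rmult_1_r by (apply Rgt_not_eq, exp_pos).
      apply Rle_Rpower_l; [lra|]. split; [now apply Hlam0|].
      apply lambda_le_quotient with K; auto; lra || lia. }
    assert (H2 : Rpower (lam p) (/ INR r) * R_ p <= Rabs B0 * INR p).
    { apply Rle_trans with (Rpower (lambda M N p s0) (/ INR r) * R_ p).
      - apply Rmult_le_compat_r; [apply HR0|]. apply Rle_Rpower_l; [lra|].
        split; [now apply Hlam0|]. apply lambda_antitone; auto.
      - specialize (HB0 p Hp). fold (R_ p) in HB0.
        apply Rle_trans with (B0 * INR p).
        + replace (Rpower (lambda M N p s0) (/ INR r) * R_ p) with
            (Rpower (lambda M N p s0) (/ INR r) / INR p * R_ p * INR p) by (field; lra).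
          now apply Rmult_le_compat_r; [lra|].
        + apply Rmult_le_compat_r; [lra|apply Rle_abs]. }
    assert (H3 : 2 * INR r * R_ p / INR (S (r * p)) * Rpower (lam p) (/ INR r) <= 2 * Rabs B0).
    { replace (2 * INR r * R_ p / INR (S (r * p)) * Rpower (lam p) (/ INR r))
        with (2 * INR r * (Rpower (lam p) (/ INR r) * R_ p) / INR (S (r * p)))
        by (field; specialize (HSp p); lra).
      apply Rle_div_l; [apply HSp|]. rewrite S_INR, mult_INR.
      pose proof (Rabs_pos B0). nra. }
    unfold B1. lra. }
  set (D := B1 ^ r * INR s).
  assert (HB1r : 1 <= B1 ^ r) by now apply pow_R1_Rle.
  assert (HD1 : 1 <= D) by (unfold D; nra).
  assert (HDs : INR s <= D) by (unfold D; nra).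
  (* For [m < p] the lower bound on $\lambda^{p-m}$ turns $\theta\lambda^{1/r}\le B_1$ into the
     claim. The index [m = p] is outside the supremum and is covered by $M_p\le K^pN_p$. *)
  assert (Htheta : forall p m, (1 <= p)%nat -> (m <= p)%nat ->
    theta p ^ (r * (p - m)) <= D ^ p * (N m / M p)).
  { intros p m Hp Hm. pose proof (HM0 p) as HMp. pose proof (HN0 m) as HNm.
    destruct (Nat.eq_dec m p) as [->|Hne].
    - rewrite Nat.sub_diag, Nat.mul_0_r. simpl pow.
      replace (D ^ p * (N p / M p)) with (D ^ p * N p / M p) by (unfold Rdiv; ring).
      apply Rle_div_r; [easy|]. rewrite Rmult_1_l. apply Rle_trans with (1 := HMN p).
      apply Rmult_le_compat_r; [lra|]. apply pow_incr. lra.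
    - assert (Hl : theta p ^ (r * (p - m)) * lam p ^ (p - m) <= B1 ^ (r * p)).
      { rewrite <- (Rpower_root_pow (lam p) r) by auto.
        rewrite <- pow_mult, <- Rpow_mult_distr.
        apply Rle_trans with (B1 ^ (r * (p - m))).
        - apply pow_incr. split; [|now apply Hlam].
          apply Rmult_le_pos; [left; apply Hthp|left; apply exp_pos].
        - apply Rle_pow; [easy|]. apply Nat.mul_le_mono_l. lia. }
      pose proof (lambda_pow_ge M N p s HM0 HN0 Hp ltac:(lia) m ltac:(lia)) as Hg.
      fold (lam p) in Hg.
      assert (Hsp : 0 < INR s ^ p) by (apply pow_lt; lra).
      assert (Ht : 0 < theta p ^ (r * (p - m))) by now apply pow_lt.
      assert (Hc : theta p ^ (r * (p - m)) * (M p / (INR s ^ p * N m)) <= B1 ^ (r * p)).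
      { apply Rle_trans with (2 := Hl). apply Rmult_le_compat_l; lra. }
      unfold D. rewrite Rpow_mult_distr, <- pow_mult.
      replace (theta p ^ (r * (p - m))) with
        (theta p ^ (r * (p - m)) * (M p / (INR s ^ p * N m)) * (INR s ^ p * (N m / M p)))
        by (field; repeat split; lra).
      rewrite (Rmult_assoc (B1 ^ (r * p))). apply Rmult_le_compat_r; [|exact Hc].
      apply Rmult_le_pos; [lra|]. left. now apply Rdiv_lt_0_compat. }
  pose proof (exp_pos 1) as He.
  exists ((8 * exp 1) ^ r * D), (fun p => 8 * (INR (S (r * p)) * theta p)).
  split; [|split; [|split]].
  - apply Rmult_lt_0_compat; [apply pow_lt|]; lra.
  - intros p. specialize (HSp p). specialize (Hthp p). nra.
  - apply is_lim_seq_le_le with (fun _ => 0)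
      (fun p => 8 * (2 * INR r * R_ p + INR r * (INR (S p) * t p))).
    + intros p. specialize (HSp p). specialize (Hthp p). split; [nra|].
      apply Rmult_le_compat_l; [lra|]. unfold theta.
      replace (INR (S (r * p)) * (2 * INR r * R_ p / INR (S (r * p)) + t p))
        with (2 * INR r * R_ p + INR (S (r * p)) * t p) by (field; lra).
      apply Rplus_le_compat_l. rewrite <- Rmult_assoc.
      apply Rmult_le_compat_r; [left; apply Ht0|]. rewrite <- mult_INR. apply le_INR. nia.
    + apply is_lim_seq_const.
    + replace 0 with (8 * (2 * INR r * 0 + INR r * 0)) by ring.
      apply (is_lim_seq_scal_l _ 8 (Finite (2 * INR r * 0 + INR r * 0))).
      apply is_lim_seq_plus'.
      * apply (is_lim_seq_scal_l _ (2 * INR r) (Finite 0)). now apply Series_tail_lim.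
      * apply (is_lim_seq_scal_l _ (INR r) (Finite 0)). apply mul_terms_lim; auto.
        intros k. left. apply Ht0.
  - intros p tau Htau Htr.
    destruct (block_exists e (r * p) (theta p) tau (INR r * R_ p)) as
      [G [HG [HG0 [HGs [HGb HGB]]]]]; auto.
    + intros i Hi. apply Rle_trans with (/ t p).
      * apply Rinv_le_contravar; auto.
      * rewrite Htinv, Rinv_inv. unfold e, root_quot. apply Rle_Rpower_l; [lra|].
        split; [specialize (Hq1 p); lra|]. apply Hqm.
        apply Nat.le_trans with (i / r)%nat; [|lia]. apply Nat.div_le_lower_bound; lia.
    + intros n. apply Rle_trans with (psum (fun i => / e (r * p + i)%nat) (r * n)).
      { apply psum_le; [|nia]. intros i. apply Rinv_0_lt_compat. specialize (He1 (r * p + i)%nat). lra. }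
      rewrite (psum_blocks r _ (fun m => t (S p + m)%nat)).
      * apply Rmult_le_compat_l; [lra|].
        apply Rle_trans with (psum (fun k => t (p + k)%nat) (S n)).
        -- assert (Hsh : forall q, psum (fun k => t (p + k)%nat) (S q)
             = t p + psum (fun m => t (S p + m)%nat) q).
           { induction q as [|q IH]; [simpl; rewrite Nat.add_0_r; ring|].
             change (psum (fun k => t (p + k)%nat) (S q) + t (p + S q)%nat =
               t p + (psum (fun m => t (S p + m)%nat) q + t (S p + q)%nat)).
             rewrite IH, Nat.add_succ_r. simpl. ring. }
           rewrite Hsh. specialize (Ht0 p). lra.
        -- apply psum_le_Series; auto. intros i. left. apply Ht0.
      * intros m j Hj. rewrite Htinv. f_equal. unfold e.
        replace (r * p + (r * m + j))%nat with (r * (p + m) + j)%nat by ring.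
        now rewrite root_quot_block.
    + unfold theta. specialize (HSp p). specialize (Ht0 p).
      replace (INR (S (r * p)) * (2 * INR r * R_ p / INR (S (r * p)) + t p))
        with (2 * (INR r * R_ p) + INR (S (r * p)) * t p) by (field; lra). nra.
    + rewrite <- Htr. right. ring.
    + exists G. split; [exact HG|]. split; [exact HG0|]. split; [exact HGs|]. split.
      * intros Hp m x. apply Rle_trans with (1 := HGb (r * m)%nat x).
        set (f := fun i => if (i <? r * p)%nat then / theta p else e i).
        assert (Hf0 : forall i, 0 < f i).
        { intros i. unfold f. destruct Nat.ltb; [now apply Rinv_0_lt_compat|].
          specialize (He1 i). lra. }
        (* For [m <= p] all factors are [/ theta p], leaving the power of [theta] just estimated.
           For [m > p] the powers of [theta] cancel and $N_m/N_p$ remains. *)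
        assert (HZ : theta p ^ (r * p) * pprod f (r * m) <= D ^ p * (N m / M p)).
        { assert (Hlow : forall n, (n <= r * p)%nat -> pprod f n = (/ theta p) ^ n).
          { induction n as [|n IH]; intros Hn; [reflexivity|].
            simpl pprod. rewrite IH by lia. unfold f. destruct (Nat.ltb_spec n (r * p)); [|lia].
            simpl. ring. }
          destruct (le_lt_dec m p) as [Hm|Hm].
          - rewrite Hlow by nia. apply Rle_trans with (2 := Htheta p m Hp Hm). right.
            rewrite pow_inv.
            replace (r * p)%nat with (r * m + r * (p - m))%nat by nia.
            rewrite pow_add. field. apply pow_nonzero. specialize (Hthp p). lra.
          - assert (Hhigh : forall n, pprod f (r * p + n) * N p =
              (/ theta p) ^ (r * p) * pprod e (r * p + n)).
            { induction n as [|n IH].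
              - rewrite Nat.add_0_r, Hlow by lia. unfold e. rewrite pprod_root_quot by auto.
                ring.
              - rewrite Nat.add_succ_r. simpl pprod.
                replace (f (r * p + n)%nat) with (e (r * p + n)%nat).
                + rewrite <- Rmult_assoc, <- IH. ring.
                + unfold f. destruct (Nat.ltb_spec (r * p + n) (r * p)); [lia|reflexivity]. }
            specialize (Hhigh (r * (m - p))%nat).
            replace (r * p + r * (m - p))%nat with (r * m)%nat in Hhigh by nia.
            unfold e in Hhigh. rewrite pprod_root_quot in Hhigh by auto.
            pose proof (HN0 p) as HNp. pose proof (HN0 m) as HNm. pose proof (HM0 p) as HMp.
            apply Rmult_le_reg_r with (N p); [easy|]. rewrite Rmult_assoc, Hhigh.
            rewrite pow_inv.
            replace (theta p ^ (r * p) * (/ theta p ^ (r * p) * N m)) with (N m)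
              by (field; apply pow_nonzero; specialize (Hthp p); lra).
            replace (D ^ p * (N m / M p) * N p) with (N m * (D ^ p * N p / M p))
              by (field; lra).
            rewrite <- (Rmult_1_r (N m)) at 1. apply Rmult_le_compat_l; [lra|].
            apply Rle_div_r; [easy|]. rewrite Rmult_1_l. apply Rle_trans with (1 := HMN p).
            apply Rmult_le_compat_r; [lra|]. apply pow_incr. lra. }
        apply Rle_trans with (2 ^ (r * m) * ((8 * exp 1) ^ S (r * p) *
          (tau ^ (r * p) / tau ^ (r * m)) * (D ^ p * (N m / M p)))).
        -- apply Rmult_le_compat_l; [apply pow_le; lra|]. apply Rmult_le_compat_l; [|exact HZ].
           apply Rmult_le_pos; [apply pow_le; lra|].
           left. apply Rdiv_lt_0_compat; now apply pow_lt.
        -- right. rewrite <- tech_pow_Rmult, !pow_mult. generalize (8 * exp 1). intros k.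
           unfold Rdiv. rewrite (Rpow_mult_distr (k ^ r * D)), (Rpow_mult_distr (k ^ r)).
           rewrite (Rpow_mult_distr (2 ^ r)), (pow_inv (tau ^ r)). ring.
      * intros h Hh. set (H := Rpower h (/ INR r)).
        destruct (HGB H) as [C HC]; [apply exp_pos|]. exists C. intros m x.
        rewrite <- (Rpower_root_pow h r) by auto. fold H. rewrite <- pow_mult.
        rewrite <- (pprod_root_quot N HN r Hr m). apply HC.
Qed.

(** Reduces the superposition to choosing [tau]: small enough that $(C_0\tau_p^r)^p$ leaves the
    coefficients summable, large enough that $2^r/\tau_p^r$ is eventually below the admissible
    [h]. *)
Lemma jets_of_scales (A : fun_class) (t : ultra_type) (r : nat) (M N : nat -> R)
    (a : nat -> C) (C0 B : R) (rho tau : nat -> R) :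
  (1 <= r)%nat -> (forall n, 0 < M n) -> (forall n, 0 < N n) ->
  (forall p tau, 0 < tau -> tau * rho p <= 1 ->
    exists G : nat -> R -> R,
      deriv_family (fun _ => True) G /\
      (forall n, G n 0 = if Nat.eq_dec n (r * p) then 1 else 0) /\
      (forall n x, 1 < Rabs x -> G n x = 0) /\
      ((1 <= p)%nat -> forall m x, Rabs (G (r * m)%nat x) <=
         8 * exp 1 * (C0 * tau ^ r) ^ p * (2 ^ r / tau ^ r) ^ m * (N m / M p)) /\
      (forall h, 0 < h -> exists C, forall m x, Rabs (G (r * m)%nat x) <= C * (h ^ m * N m))) ->
  0 < C0 -> (forall p, 0 < tau p) -> (forall p, tau p * rho p <= 1) ->
  (forall p, (1 <= p)%nat -> Cmod (a p) * (C0 * tau p ^ r) ^ p <= B * (/ 2) ^ p * M p) ->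
  quantify_h t (fun h => exists p0, forall p, (p0 <= p)%nat -> 2 ^ r / tau p ^ r <= h) ->
  jets A t r N a.
Proof.
  intros Hr HM0 HN0 HG HC0 Htau Htr Ha Hq.
  destruct (choice_fun _ _ _ (fun p => HG p (tau p) (Htau p) (Htr p))) as [G HG'].
  apply jets_of_blocks with G; auto; try apply HG'.
  assert (Hfin : forall h, 0 < h ->
    (exists p0, forall p, (p0 <= p)%nat -> 2 ^ r / tau p ^ r <= h) ->
    exists b, ex_series b /\ forall p m x,
      Cmod (a p) * Rabs (G p (r * m)%nat x) <= b p * (h ^ m * N m)).
  { intros h Hh [p0 Hp0].
    assert (HC : forall p, exists C, forall m x, Rabs (G p (r * m)%nat x) <= C * (h ^ m * N m)).
    { intros p. destruct (HG' p) as [_ [_ [_ [_ H]]]]. now apply H. }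
    destruct (choice_fun _ _ _ HC) as [C HC']. clear HC.
    pose proof (exp_pos 1) as He.
    (* Finitely many blocks, among them [p = 0], may have an unsuitable scale; each of them
       satisfies the bound for [h] with a constant of its own. *)
    exists (fun p => if le_lt_dec (S p0) p then 8 * exp 1 * B * (/ 2) ^ p else Cmod (a p) * C p).
    split.
    - apply (ex_series_incr_n _ (S p0)).
      apply (ex_series_ext (fun k => 8 * exp 1 * B * (/ 2) ^ (S p0) * (/ 2) ^ k)).
      + intros k. destruct le_lt_dec; [|lia]. rewrite pow_add.
        match goal with |- ?x = ?y => change (x = y :> R) end. ring.
      + apply (ex_series_scal_l (8 * exp 1 * B * (/ 2) ^ (S p0)) (fun k => (/ 2) ^ k)).
        apply ex_series_geom. rewrite Rabs_pos_eq; lra.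
    - intros p m x. destruct le_lt_dec as [Hp|Hp].
      + destruct (HG' p) as [_ [_ [_ [H _]]]]. specialize (H ltac:(lia) m x).
        specialize (Hp0 p ltac:(lia)). specialize (Ha p ltac:(lia)).
        assert (Hm : (2 ^ r / tau p ^ r) ^ m <= h ^ m).
        { apply pow_incr. split; [|exact Hp0].
          left. apply Rdiv_lt_0_compat; apply pow_lt; [lra|apply Htau]. }
        assert (HN : 0 < N m / M p) by (apply Rdiv_lt_0_compat; auto).
        apply Rle_trans with (Cmod (a p) * (8 * exp 1 * (C0 * tau p ^ r) ^ p *
          (2 ^ r / tau p ^ r) ^ m * (N m / M p))).
        { apply Rmult_le_compat_l; [apply Cmod_ge_0|exact H]. }
        assert (Hpos : 0 <= (C0 * tau p ^ r) ^ p).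
        { apply pow_le. apply Rmult_le_pos; [lra|]. apply pow_le. left. apply Htau. }
        replace (Cmod (a p) * (8 * exp 1 * (C0 * tau p ^ r) ^ p *
          (2 ^ r / tau p ^ r) ^ m * (N m / M p))) with
          (8 * exp 1 * (N m / M p) * ((Cmod (a p) * (C0 * tau p ^ r) ^ p) *
             (2 ^ r / tau p ^ r) ^ m)) by ring.
        apply Rle_trans with (8 * exp 1 * (N m / M p) * ((B * (/ 2) ^ p * M p) * h ^ m)).
        * apply Rmult_le_compat_l; [apply Rmult_le_pos; lra|].
          apply Rmult_le_compat; auto.
          -- apply Rmult_le_pos; [apply Cmod_ge_0|exact Hpos].
          -- apply pow_le. left. apply Rdiv_lt_0_compat; apply pow_lt; [lra|apply Htau].
        * right. field. specialize (HM0 p). lra.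
      + rewrite Rmult_assoc. apply Rmult_le_compat_l; [apply Cmod_ge_0|apply HC']. }
  destruct t; simpl in *.
  - destruct Hq as [h [Hh H]]. exists h. auto.
  - intros h Hh. auto.
Qed.

Lemma weights_root_lim (r : nat) (M : nat -> R) (a : nat -> C) :
  (1 <= r)%nat -> (forall n, 0 < M n) -> Lambda Beurling M a ->
  exists sigma : nat -> R, (forall p, 0 < sigma p) /\ is_lim_seq sigma 0 /\
    forall p, (1 <= p)%nat -> Cmod (a p) <= sigma p ^ (r * p) * M p.
Proof.
  intros Hr HM0 Ha.
  (* The summand $1/p!$ keeps the roots positive even where [a p] vanishes, and is itself below
     every geometric rate. *)
  set (b := fun p => Cmod (a p) / M p + / INR (fact p)).
  assert (Hb0 : forall p, 0 < b p).
  { intros p. unfold b. pose proof (INR_fact_lt_0 p). pose proof (Cmod_ge_0 (a p)).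
    specialize (HM0 p).
    assert (0 < / INR (fact p)) by now apply Rinv_0_lt_compat.
    assert (0 <= Cmod (a p) / M p); [|lra].
    apply Rmult_le_pos; [easy|left; now apply Rinv_0_lt_compat]. }
  exists (fun p => Rpower (b p) (/ INR (r * p))).
  split; [intros p; apply exp_pos|]. split.
  - apply is_lim_seq_spec. intros eps. pose proof (cond_pos eps) as Heps.
    set (e2 := eps / 2). assert (He2 : 0 < e2) by (unfold e2; lra).
    set (h := e2 ^ r / 2).
    assert (Her : 0 < e2 ^ r) by now apply pow_lt.
    assert (Hh : 0 < h) by (unfold h; lra).
    destruct (Ha h Hh) as [B HB].
    assert (Hbh : forall p, b p <= (Rabs B + exp (/ h)) * h ^ p).
    { intros p. unfold b. rewrite Rmult_plus_distr_r.
      assert (Hhp : 0 < h ^ p) by now apply pow_lt.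
      apply Rplus_le_compat.
      - specialize (HB p). apply Rle_div_l; [apply HM0|].
        apply Rle_div_l in HB; [|apply Rmult_lt_0_compat; auto].
        apply Rle_trans with (1 := HB). rewrite <- Rmult_assoc.
        apply Rmult_le_compat_r; [left; apply HM0|].
        apply Rmult_le_compat_r; [lra|apply Rle_abs].
      - pose proof (pow_div_fact_le_exp (/ h) p) as H.
        rewrite pow_inv in H.
        assert (Hih : 0 <= / h) by (left; now apply Rinv_0_lt_compat). specialize (H Hih).
        apply Rmult_le_compat_r with (r := h ^ p) in H; [|lra].
        replace (/ h ^ p / INR (fact p) * h ^ p) with (/ INR (fact p)) in H; [exact H|].
        field. split; [lra|apply INR_fact_neq_0]. }
    set (B2 := Rabs B + exp (/ h)) in *.
    destruct (Pow_x_infinity 2 ltac:(rewrite Rabs_pos_eq; lra) B2) as [n0 Hn0].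
    exists (S n0). intros p Hp. rewrite Rminus_0_r, Rabs_pos_eq by (left; apply exp_pos).
    apply Rle_lt_trans with e2; [|unfold e2; lra].
    apply Rpower_root_le; [nia|apply Hb0|lra|].
    apply Rle_trans with (1 := Hbh p).
    specialize (Hn0 p ltac:(lia)). rewrite Rabs_pos_eq in Hn0 by (apply pow_le; lra).
    unfold h. rewrite pow_mult. unfold Rdiv. rewrite Rpow_mult_distr, pow_inv.
    assert (H2p : 0 < 2 ^ p) by (apply pow_lt; lra).
    assert (Hep : 0 < (e2 ^ r) ^ p) by now apply pow_lt.
    rewrite <- (Rmult_1_r ((e2 ^ r) ^ p)) at 2.
    rewrite (Rmult_comm B2), Rmult_assoc. apply Rmult_le_compat_l; [lra|].
    apply Rmult_le_reg_l with (2 ^ p); [easy|].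
    rewrite <- Rmult_assoc, Rinv_r by lra. lra.
  - intros p Hp. rewrite Rpower_root_pow; [|nia|apply Hb0].
    unfold b. apply Rle_trans with (Cmod (a p) / M p * M p).
    + right. field. specialize (HM0 p). lra.
    + apply Rmult_le_compat_r; [left; apply HM0|].
      pose proof (Rinv_0_lt_compat _ (INR_fact_lt_0 p)). lra.
Qed.

Lemma cond_SV_sufficient (r : nat) (M N : nat -> R) (K : R) (t : ultra_type) (A : fun_class)
    (a : nat -> C) :
  (1 <= r)%nat -> class_LC M -> class_LC N ->
  1 <= K -> (forall p, M p <= K ^ p * N p) -> cond_SV r M N ->
  Lambda t M a -> jets A t r N a.
Proof.
  intros Hr HM HN HK HMN HSV Ha.
  pose proof (LC_pos M HM) as HM0. pose proof (LC_pos N HN) as HN0.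
  destruct (blocks_exist r M N K) as [C0 [rho [HC0 [Hrho [Hlim Hblock]]]]]; auto.
  destruct t.
  - destruct Ha as [h [Hh [B HB]]].
    assert (Hmax : exists R1, 1 <= R1 /\ forall p, rho p <= R1).
    { destruct (filterlim_bounded rho) as [R1 HR1]; [now exists 0|].
      exists (Rmax 1 R1). split; [apply Rmax_l|]. intros p.
      apply Rle_trans with (2 := Rmax_r _ _). apply Rle_trans with (2 := HR1 p). apply Rle_abs. }
    destruct Hmax as [R1 [HR1 HR]].
    (* [R1] makes every block fit into $[-1,1]$; the other factor gives $C_0\tau^rh\le 1/2$, using
       $\tau\le 1$. *)
    set (tau := / (R1 * (1 + 2 * (C0 * h)))).
    assert (HCh : 0 < C0 * h) by now apply Rmult_lt_0_compat.
    assert (Hd : 0 < R1 * (1 + 2 * (C0 * h))) by (apply Rmult_lt_0_compat; lra).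
    assert (Htau : 0 < tau) by now apply Rinv_0_lt_compat.
    assert (Htd : tau * (R1 * (1 + 2 * (C0 * h))) = 1) by (unfold tau; field; lra).
    assert (HtR : tau * R1 <= 1) by nra.
    assert (Ht1 : tau <= 1) by nra.
    assert (Htr : tau ^ r <= tau).
    { destruct r as [|r']; [lia|]. simpl. rewrite <- (Rmult_1_r tau) at 3.
      apply Rmult_le_compat_l; [lra|]. rewrite <- (pow1 r'). apply pow_incr. lra. }
    assert (HCt : C0 * tau ^ r * h <= / 2).
    { apply Rle_trans with (C0 * tau * h).
      - apply Rmult_le_compat_r; [lra|]. apply Rmult_le_compat_l; lra.
      - nra. }
    apply jets_of_scales with M C0 (Rabs B) rho (fun _ => tau); auto.
    + intros p. apply Rle_trans with (2 := HtR). apply Rmult_le_compat_l; [lra|apply HR].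
    + intros p Hp. specialize (HB p).
      apply Rle_div_l in HB; [|apply Rmult_lt_0_compat; [now apply pow_lt|easy]].
      assert (H0 : 0 <= C0 * tau ^ r) by (apply Rmult_le_pos; [lra|apply pow_le; lra]).
      apply Rle_trans with (Rabs B * (h ^ p * M p) * (C0 * tau ^ r) ^ p).
      * apply Rmult_le_compat_r; [now apply pow_le|].
        apply Rle_trans with (1 := HB). apply Rmult_le_compat_r; [|apply Rle_abs].
        apply Rmult_le_pos; [apply pow_le; lra|left; apply HM0].
      * replace (Rabs B * (h ^ p * M p) * (C0 * tau ^ r) ^ p) with
          (Rabs B * (C0 * tau ^ r * h) ^ p * M p) by (rewrite (Rpow_mult_distr _ h); ring).
        apply Rmult_le_compat_r; [left; apply HM0|].
        apply Rmult_le_compat_l; [apply Rabs_pos|]. apply pow_incr.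
        split; [apply Rmult_le_pos; lra|exact HCt].
    + exists (2 ^ r / tau ^ r). split.
      * apply Rdiv_lt_0_compat; apply pow_lt; lra.
      * exists O. intros p _. lra.
  - destruct (weights_root_lim r M a Hr HM0 Ha) as [sigma [Hs0 [Hslim Hs]]].
    set (k := 1 + 2 * C0).
    (* The summand [rho p] keeps the supports in $[-1,1]$, and $\sigma_p\tau_p\le 1/k$ gives
       $C_0(\sigma_p\tau_p)^r\le 1/2$. Both summands tend to 0, hence [tau] tends to infinity. *)
    set (tau := fun p => / (rho p + k * sigma p)).
    assert (Hk : 1 <= k) by (unfold k; lra).
    assert (Hd : forall p, 0 < rho p + k * sigma p).
    { intros p. specialize (Hs0 p). specialize (Hrho p). nra. }
    assert (Htau : forall p, 0 < tau p) by (intros p; now apply Rinv_0_lt_compat).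
    apply jets_of_scales with M C0 1 rho tau; auto.
    + intros p. unfold tau. rewrite Rmult_comm. apply Rle_div_l; [apply Hd|].
      specialize (Hs0 p). nra.
    + intros p Hp.
      apply Rle_trans with (sigma p ^ (r * p) * M p * (C0 * tau p ^ r) ^ p).
      { apply Rmult_le_compat_r; [|now apply Hs].
        apply pow_le. apply Rmult_le_pos; [lra|]. apply pow_le. left. apply Htau. }
      replace (sigma p ^ (r * p) * M p * (C0 * tau p ^ r) ^ p) with
        ((C0 * (sigma p * tau p) ^ r) ^ p * M p).
      2: { rewrite pow_mult, !Rpow_mult_distr. ring. }
      rewrite Rmult_1_l. apply Rmult_le_compat_r; [left; apply HM0|].
      assert (Hst : 0 < sigma p * tau p) by (apply Rmult_lt_0_compat; auto).
      assert (Hst1 : sigma p * tau p <= / k).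
      { unfold tau. apply Rle_div_l; [apply Hd|].
        apply Rmult_le_reg_l with k; [lra|].
        rewrite <- Rmult_assoc, Rinv_r by lra. specialize (Hrho p). lra. }
      assert (Hik : 0 < / k <= 1).
      { split; [apply Rinv_0_lt_compat; lra|]. rewrite <- Rinv_1. apply Rinv_le_contravar; lra. }
      apply pow_incr. split; [apply Rmult_le_pos; [lra|apply pow_le; lra]|].
      apply Rle_trans with (C0 * / k).
      * apply Rmult_le_compat_l; [lra|]. apply Rle_trans with ((/ k) ^ r).
        -- apply pow_incr. lra.
        -- destruct r as [|r']; [lia|]. simpl. rewrite <- (Rmult_1_r (/ k)) at 3.
           apply Rmult_le_compat_l; [lra|]. rewrite <- (pow1 r'). apply pow_incr. lra.
      * apply Rle_div_l; [lra|]. unfold k. lra.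
    + intros h Hh.
      assert (Hl : is_lim_seq (fun p => 2 ^ r * (rho p + k * sigma p) ^ r) 0).
      { assert (Hl1 : is_lim_seq (fun p => rho p + k * sigma p) 0).
        { replace 0 with (0 + k * 0) by ring. apply is_lim_seq_plus'; [easy|].
          now apply (is_lim_seq_scal_l sigma k 0). }
        assert (Hl2 : forall q, is_lim_seq (fun p => (rho p + k * sigma p) ^ S q) 0).
        { induction q as [|q IH].
          - apply (is_lim_seq_ext (fun p => rho p + k * sigma p)); [intros n; simpl; ring|easy].
          - replace 0 with (0 * 0) by ring.
            apply (is_lim_seq_mult' (fun p => rho p + k * sigma p)); easy. }
        replace 0 with (2 ^ r * 0) by ring.
        apply (is_lim_seq_scal_l _ (2 ^ r) 0). destruct r as [|r']; [lia|apply Hl2]. }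
      destruct (proj2 (is_lim_seq_spec _ _) Hl (mkposreal h Hh)) as [p0 Hp0].
      exists p0. intros p Hp. specialize (Hp0 p Hp). simpl pos in Hp0.
      rewrite Rminus_0_r in Hp0. apply Rabs_def2 in Hp0.
      unfold tau, Rdiv. rewrite pow_inv, Rinv_inv. lra.
Qed.

(** * The condition is necessary *)

Definition unit_open (x : R) : Prop := 0 < x < 1.

(** A $j$-fold difference with step [d] is at most $2^jB$, and by iterated mean values it equals
    $d^j$ times the derivative of order [j] at some point. *)
Lemma small_derivative (j : nat) (F : nat -> R -> R) (a b d B : R) :
  0 < d -> a + INR j * d < b ->
  deriv_family (fun x => a < x < b) F -> (forall x, a < x < b -> Rabs (F O x) <= B) ->
  exists c, a < c < b /\ Rabs (F j c) <= 2 ^ j * B / d ^ j.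
Proof.
  intros Hd. revert F b B. induction j as [|j IH]; intros F b B Hab HF HB.
  - simpl in *. exists ((a + b) / 2). split; [lra|].
    replace (1 * B / 1) with B by field. apply HB. lra.
  - rewrite S_INR in Hab. pose proof (pos_INR j) as Hj.
    assert (Hjd : 0 <= INR j * d) by (apply Rmult_le_pos; lra).
    destruct (IH (fun n x => F n (x + d) - F n x) (b - d) (2 * B)) as [c [Hc E]].
    + lra.
    + intros n x Hx. apply @is_derive_minus.
      * apply is_derive_shift. apply HF. lra.
      * apply HF. lra.
    + intros x Hx. apply Rle_trans with (1 := Rabs_triang _ _). rewrite Rabs_Ropp.
      pose proof (HB (x + d) ltac:(lra)). pose proof (HB x ltac:(lra)). lra.
    + destruct (mvt (F j) (F (S j)) c (c + d)) as [z [Hz E2]]; [lra| |].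
      { intros x Hx. apply HF. lra. }
      exists z. split; [lra|]. rewrite E2 in E.
      replace (c + d - c) with d in E by ring.
      rewrite Rabs_mult, (Rabs_pos_eq d) in E by lra.
      apply (Rle_div_r _ _ d) in E; [|easy]. apply Rle_trans with (1 := E). right. simpl. field.
      split; [apply pow_nonzero|]; lra.
Qed.

(* Landau-Kolmogorov on a bounded interval: descend from the order [r], comparing
   [F j x] with a nearby point where [F j] is small by [small_derivative]. *)
Lemma landau (r i : nat) : (i <= r)%nat ->
  exists C, 0 <= C /\ forall (F : nat -> R -> R) (a b d : R),
    deriv_family unit_open F -> 0 < d -> 2 * INR (S r) * d <= 1 ->
    (forall x, unit_open x -> Rabs (F O x) <= a) ->
    (forall x, unit_open x -> Rabs (F r x) <= b) ->
    forall x, unit_open x -> Rabs (F (r - i)%nat x) <= C * (a / d ^ (r - i) + d ^ i * b).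
Proof.
  assert (Hab : forall (F : nat -> R -> R) k a, (forall x, unit_open x -> Rabs (F k x) <= a) -> 0 <= a).
  { intros F k a H. apply Rle_trans with (2 := H (/ 2) ltac:(unfold unit_open; lra)).
    apply Rabs_pos. }
  induction i as [|i IH]; intros Hi.
  - exists 1. split; [lra|]. intros F a b d HF Hd Hrd Ha Hb x Hx.
    rewrite Nat.sub_0_r. simpl. pose proof (Hb x Hx).
    assert (0 <= a / d ^ r); [|lra].
    apply Rmult_le_pos; [now apply (Hab F O)|]. left. now apply Rinv_0_lt_compat, pow_lt.
  - destruct (IH ltac:(lia)) as [C [HC HIH]]. exists (2 ^ r + INR (S r) * C).
    assert (H2r : 0 < 2 ^ r) by (apply pow_lt; lra).
    pose proof (pos_INR (S r)) as HSr.
    split; [pose proof (Rmult_le_pos _ _ HSr HC); lra|].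
    intros F a b d HF Hd Hrd Ha Hb x Hx.
    specialize (HIH F a b d HF Hd Hrd Ha Hb).
    pose proof (Hab F O a Ha) as Ha0. pose proof (Hab F r b Hb) as Hb0.
    set (j := (r - S i)%nat) in *.
    replace (r - i)%nat with (S j) in HIH by lia.
    set (len := INR (S r) * d).
    assert (Hlen : 0 < len) by (apply Rmult_lt_0_compat; [apply lt_0_INR; lia|easy]).
    assert (Hlen2 : 2 * len <= 1) by (unfold len; lra).
    assert (Hj : INR j * d < len).
    { apply Rmult_lt_compat_r; [easy|]. apply lt_INR. lia. }
    assert (Hsub : exists u, 0 <= u /\ u + len <= 1 /\ u <= x <= u + len).
    { unfold unit_open in Hx. destruct (Rle_dec x (1 / 2)); [exists x|exists (x - len)]; lra. }
    destruct Hsub as [u [Hu0 [Hu1 Hux]]].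
    destruct (small_derivative j F u (u + len) d a) as [c [Hc E]]; [easy|lra| | |].
    { intros n y Hy. apply HF. unfold unit_open. lra. }
    { intros y Hy. apply Ha. unfold unit_open. lra. }
    assert (Hstep : Rabs (F j x - F j c) <= len * (C * (a / d ^ S j + d ^ i * b))).
    { assert (Hl : forall s t, s <= t -> unit_open s -> unit_open t -> t - s <= len ->
        Rabs (F j t - F j s) <= len * (C * (a / d ^ S j + d ^ i * b))).
      { intros s t Hst Hs Ht Hl. unfold unit_open in *.
        destruct (mvt (F j) (F (S j)) s t Hst) as [z [Hz ->]].
        { intros y Hy. apply HF. unfold unit_open. lra. }
        rewrite Rabs_mult, (Rabs_pos_eq (t - s)), Rmult_comm by lra.
        apply Rmult_le_compat; [lra|apply Rabs_pos|easy|]. apply HIH. lra. }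
      destruct (Rle_dec c x).
      - apply Hl; unfold unit_open in *; lra.
      - rewrite Rabs_minus_sym. apply Hl; unfold unit_open in *; lra. }
    replace (F j x) with (F j c + (F j x - F j c)) by ring.
    apply Rle_trans with (1 := Rabs_triang _ _).
    assert (Hdj : 0 < d ^ j) by now apply pow_lt.
    assert (Haj : 0 <= a / d ^ j) by (apply Rmult_le_pos; [easy|left; now apply Rinv_0_lt_compat]).
    assert (Hbi : 0 <= d ^ S i * b) by (apply Rmult_le_pos; [apply pow_le; lra|easy]).
    replace (len * (C * (a / d ^ S j + d ^ i * b))) with
      (INR (S r) * C * (a / d ^ j + d ^ S i * b)) in Hstep
      by (unfold len; simpl pow; field; lra).
    assert (H2j : 2 ^ j <= 2 ^ r) by (apply Rle_pow; [lra|lia]).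
    replace (2 ^ j * a / d ^ j) with (2 ^ j * (a / d ^ j)) in E by (unfold Rdiv; ring).
    assert (2 ^ j * (a / d ^ j) <= 2 ^ r * (a / d ^ j)) by (apply Rmult_le_compat_r; easy).
    assert (0 <= 2 ^ r * (d ^ S i * b)) by (apply Rmult_le_pos; lra).
    lra.
Qed.

(** Interpolates between the orders [r * n] and [r * S n]. The constant depends on [r] and [H]
    alone, since it is applied to preimages whose bounds [D] vary with [p]. *)
Lemma intermediate_derivatives (r : nat) (H : R) : (1 <= r)%nat -> 1 <= H ->
  exists A', 0 < A' /\ forall (N : nat -> R) (F : nat -> R -> R) (D : R),
    class_LC N -> deriv_family unit_open F -> 0 <= D ->
    (forall n x, unit_open x -> Rabs (F (r * n)%nat x) <= D * (H ^ n * N n)) ->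
    forall k x, unit_open x -> Rabs (F k x) <= A' * D * (H ^ k * pprod (root_quot r N) k).
Proof.
  intros Hr HH.
  assert (HC : exists C, 0 <= C /\ forall j, (j <= r)%nat ->
    forall (F : nat -> R -> R) (a b d : R),
    deriv_family unit_open F -> 0 < d -> 2 * INR (S r) * d <= 1 ->
    (forall x, unit_open x -> Rabs (F O x) <= a) ->
    (forall x, unit_open x -> Rabs (F r x) <= b) ->
    forall x, unit_open x -> Rabs (F j x) <= C * (a / d ^ j + d ^ (r - j) * b)).
  (* [landau] has one constant per order; this collects them into a common one. *)
  { assert (Hq : forall q, (q <= S r)%nat -> exists C, 0 <= C /\ forall i, (i < q)%nat ->
      forall (F : nat -> R -> R) (a b d : R),
      deriv_family unit_open F -> 0 < d -> 2 * INR (S r) * d <= 1 ->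
      (forall x, unit_open x -> Rabs (F O x) <= a) ->
      (forall x, unit_open x -> Rabs (F r x) <= b) ->
      forall x, unit_open x -> Rabs (F (r - i)%nat x) <= C * (a / d ^ (r - i) + d ^ i * b)).
    { induction q as [|q IH]; intros Hq.
      - exists 0. split; [lra|]. intros; lia.
      - destruct (IH ltac:(lia)) as [C1 [HC1 H1]]. destruct (landau r q ltac:(lia)) as [C2 [HC2 H2]].
        exists (C1 + C2). split; [lra|]. intros i Hi F a b d HF Hd Hrd Ha Hb x Hx.
        assert (Hpos : 0 <= a / d ^ (r - i) + d ^ i * b).
        { assert (Hhalf : unit_open (/ 2)) by (unfold unit_open; lra).
          pose proof (Rle_trans _ _ _ (Rabs_pos _) (Ha _ Hhalf)).
          pose proof (Rle_trans _ _ _ (Rabs_pos _) (Hb _ Hhalf)).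
          apply Rplus_le_le_0_compat; apply Rmult_le_pos; try easy.
          - left. now apply Rinv_0_lt_compat, pow_lt.
          - apply pow_le. lra. }
        rewrite Rmult_plus_distr_r.
        destruct (Nat.eq_dec i q) as [->|Hne].
        + specialize (H2 F a b d HF Hd Hrd Ha Hb x Hx). pose proof (Rmult_le_pos _ _ HC1 Hpos). lra.
        + specialize (H1 i ltac:(lia) F a b d HF Hd Hrd Ha Hb x Hx).
          pose proof (Rmult_le_pos _ _ HC2 Hpos). lra. }
    destruct (Hq (S r) (le_n _)) as [C [HC0 HC]]. exists C. split; [exact HC0|].
    intros j Hj. specialize (HC (r - j)%nat ltac:(lia)).
    now replace (r - (r - j))%nat with j in HC by lia. }
  destruct HC as [C [HC0 HC]].
  set (k0 := 2 * INR (S r)).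
  assert (Hk0 : 1 <= k0).
  { unfold k0. rewrite S_INR. pose proof (pos_INR r). lra. }
  assert (Hk0r : 1 <= k0 ^ r) by now apply pow_R1_Rle.
  exists (C * k0 ^ r * (1 + H) + 1).
  assert (HCk : 0 <= C * k0 ^ r * (1 + H)).
  { apply Rmult_le_pos; [apply Rmult_le_pos|]; lra. }
  split; [lra|].
  intros N F D HN HF HD HB k x Hx.
  pose proof (LC_pos N HN) as HN0.
  set (n := (k / r)%nat). set (j := (k mod r)%nat).
  assert (Hk : k = (r * n + j)%nat) by apply Nat.div_mod_eq.
  assert (Hj : (j < r)%nat) by (apply Nat.mod_upper_bound; lia).
  set (e := Rpower (quotients N (S n)) (/ INR r)).
  assert (He1 : 1 <= e).
  { unfold e. rewrite <- (root_quot_block N r Hr n 0) by lia. now apply root_quot_ge_1. }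
  assert (Her : e ^ r = quotients N (S n)).
  { apply Rpower_root_pow; [easy|]. pose proof (quotients_ge_1 N HN n). lra. }
  assert (HL : pprod (root_quot r N) k = N n * e ^ j).
  { rewrite Hk. clear Hk. clearbody j. induction j as [|j IH].
    - rewrite Nat.add_0_r, pprod_root_quot by auto. simpl. ring.
    - rewrite Nat.add_succ_r. simpl pprod. rewrite IH, root_quot_block by lia.
      fold e. simpl. ring. }
  (* As $e^r=N_{n+1}/N_n$, a step proportional to $1/e$ balances the two terms of the interpolation:
     both have order $N_ne^j$. The factor [k0] makes the step admissible. *)
  specialize (HC j ltac:(lia) (fun i => F (r * n + i)%nat) (D * (H ^ n * N n))
    (D * (H ^ S n * N (S n))) (/ (k0 * e))).
  assert (Hke : 0 < k0 * e) by nra.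
  assert (HC' : Rabs (F k x) <= C * (D * (H ^ n * N n) / (/ (k0 * e)) ^ j +
    (/ (k0 * e)) ^ (r - j) * (D * (H ^ S n * N (S n))))).
  { rewrite Hk at 1. apply HC; [| | | | |exact Hx].
    - intros i y Hy. rewrite Nat.add_succ_r. now apply HF.
    - now apply Rinv_0_lt_compat.
    - fold k0. apply Rmult_le_reg_r with (k0 * e); [easy|].
      rewrite Rmult_assoc, Rinv_l by lra. nra.
    - intros y Hy. rewrite Nat.add_0_r. now apply HB.
    - intros y Hy. replace (r * n + r)%nat with (r * S n)%nat by ring. now apply HB. }
  apply Rle_trans with (1 := HC'). clear HC HC'. rewrite HL.
  assert (Hej : 0 < e ^ j) by (apply pow_lt; lra).
  assert (HHn : 0 < H ^ n) by (apply pow_lt; lra).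
  assert (HDN : 0 <= D * (H ^ n * N n)).
  { apply Rmult_le_pos; [easy|]. apply Rmult_le_pos; [lra|left; apply HN0]. }
  assert (H1 : D * (H ^ n * N n) / (/ (k0 * e)) ^ j <= k0 ^ r * (D * (H ^ n * N n) * e ^ j)).
  { rewrite pow_inv. unfold Rdiv. rewrite Rinv_inv, Rpow_mult_distr.
    assert (k0 ^ j <= k0 ^ r) by (apply Rle_pow; [easy|lia]).
    assert (0 <= D * (H ^ n * N n) * e ^ j) by (apply Rmult_le_pos; lra).
    replace (D * (H ^ n * N n) * (k0 ^ j * e ^ j)) with (k0 ^ j * (D * (H ^ n * N n) * e ^ j)) by ring.
    now apply Rmult_le_compat_r. }
  assert (H2 : (/ (k0 * e)) ^ (r - j) * (D * (H ^ S n * N (S n))) <=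
    k0 ^ r * (H * (D * (H ^ n * N n) * e ^ j))).
  { rewrite (quotients_mult N HN), <- Her.
    replace r with (j + (r - j))%nat at 2 by lia. rewrite pow_add, pow_inv, Rpow_mult_distr.
    assert (Hk1 : 1 <= k0 ^ (r - j)) by now apply pow_R1_Rle.
    assert (Hepos : 0 < e ^ (r - j)) by (apply pow_lt; lra).
    replace (/ (k0 ^ (r - j) * e ^ (r - j)) * (D * (H ^ S n * (N n * (e ^ j * e ^ (r - j))))))
      with (/ k0 ^ (r - j) * (H * (D * (H ^ n * N n) * e ^ j))) by (simpl; field; lra).
    apply Rmult_le_compat_r.
    { apply Rmult_le_pos; [lra|]. apply Rmult_le_pos; lra. }
    apply Rle_trans with 1; [|easy]. rewrite <- Rinv_1. apply Rinv_le_contravar; lra. }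
  assert (HHk : H ^ n <= H ^ k) by (apply Rle_pow; [easy|nia]).
  apply Rle_trans with (C * k0 ^ r * (1 + H) * D * (H ^ n * (N n * e ^ j))).
  - apply Rle_trans with (C * (k0 ^ r * (D * (H ^ n * N n) * e ^ j) +
      k0 ^ r * (H * (D * (H ^ n * N n) * e ^ j)))).
    + apply Rmult_le_compat_l; lra.
    + right. ring.
  - assert (0 < N n * e ^ j) by (apply Rmult_lt_0_compat; auto).
    apply Rmult_le_compat.
    + apply Rmult_le_pos; lra.
    + apply Rmult_le_pos; lra.
    + apply Rmult_le_compat_r; lra.
    + apply Rmult_le_compat_r; lra.
Qed.

(** * Bang's argument *)

Lemma compare_derivative (f f1 g g1 : R -> R) (a b : R) :
  (forall x, a <= x <= b -> is_derive f x (f1 x)) ->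
  (forall x, a <= x <= b -> is_derive g x (g1 x)) ->
  (forall x, a <= x <= b -> Rabs (f1 x) <= g1 x) -> Rabs (f a) <= g a ->
  forall x, a <= x <= b -> Rabs (f x) <= g x.
Proof.
  intros Hf Hg H1 Ha x Hx. apply Rabs_le_between in Ha. apply Rabs_le.
  destruct (mvt (fun y => g y - f y) (fun y => g1 y - f1 y) a x) as [c [Hc E]]; [lra| |].
  { intros y Hy. apply @is_derive_minus; [apply Hg|apply Hf]; lra. }
  destruct (mvt (fun y => g y + f y) (fun y => g1 y + f1 y) a x) as [d [Hd E2]]; [lra| |].
  { intros y Hy. apply @is_derive_plus; [apply Hg|apply Hf]; lra. }
  pose proof (H1 c ltac:(lra)) as Hc1. apply Rabs_le_between in Hc1.
  pose proof (H1 d ltac:(lra)) as Hd1. apply Rabs_le_between in Hd1.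
  assert (0 <= (g1 c - f1 c) * (x - a)) by (apply Rmult_le_pos; lra).
  assert (0 <= (g1 d + f1 d) * (x - a)) by (apply Rmult_le_pos; lra).
  lra.
Qed.

(* Bang's argument: at the point [y] the first [S K] derivatives are at most
   [2^(n-K-1) T n]; the majorants [2^(n-K-1) T n exp(2 q (z-y))] propagate this to the
   right, at the price of one factor 2 as long as [z - y <= 1/(4q)]. *)
Lemma bang_step (F : nat -> R -> R) (T : nat -> R) (q : R) (K : nat) (x y : R) :
  deriv_family unit_open F -> 0 < q -> 0 < y -> y <= x < 1 -> (x - y) * (4 * q) <= 1 ->
  (forall n z, y <= z <= x -> Rabs (F n z) <= T n) -> (forall n, 0 <= T n) ->
  (forall n, (n <= K)%nat -> T (S n) <= q * T n) ->
  (forall n, (n < S K)%nat -> Rabs (F n y) <= 2 ^ n / 2 ^ S K * T n) ->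
  forall n, (n < S K)%nat -> Rabs (F n x) <= 2 ^ n / 2 ^ K * T n.
Proof.
  intros HF Hq Hy Hyx Hxy HT HT0 Hratio Hlev.
  assert (H2 : forall n, 0 < 2 ^ n / 2 ^ S K) by (intros n; apply Rdiv_lt_0_compat; apply pow_lt; lra).
  assert (H : forall i, (i <= S K)%nat -> forall z, y <= z <= x ->
    Rabs (F (S K - i)%nat z) <= 2 ^ (S K - i) / 2 ^ S K * T (S K - i)%nat * exp (2 * q * (z - y))).
  { induction i as [|i IH]; intros Hi z Hz.
    - rewrite Nat.sub_0_r. replace (2 ^ S K / 2 ^ S K) with 1 by (field; apply pow_nonzero; lra).
      rewrite Rmult_1_l. apply Rle_trans with (1 := HT (S K) z Hz).
      rewrite <- (Rmult_1_r (T (S K))) at 1. apply Rmult_le_compat_l; [apply HT0|].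
      rewrite <- exp_0. destruct (Req_dec z y) as [->|Hne].
      + right. f_equal. ring.
      + left. apply exp_increasing. apply Rmult_lt_0_compat; lra.
    - specialize (IH ltac:(lia)).
      set (n := (S K - S i)%nat) in *. replace (S K - i)%nat with (S n) in IH by lia.
      apply (compare_derivative (F n) (F (S n))
        (fun z => 2 ^ n / 2 ^ S K * T n * exp (2 * q * (z - y)))
        (fun z => 2 ^ n / 2 ^ S K * T n * (2 * q * exp (2 * q * (z - y)))) y x); [| | | |exact Hz].
      + intros w Hw. apply HF. unfold unit_open. lra.
      + intros w Hw. apply is_derive_scal. auto_derive; [easy|]. unfold Rminus. ring.
      + intros w Hw. apply Rle_trans with (1 := IH w Hw).
        pose proof (exp_pos (2 * q * (w - y))).
        replace (2 ^ n / 2 ^ S K * T n * (2 * q * exp (2 * q * (w - y)))) with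
          (2 ^ S n / 2 ^ S K * (q * T n) * exp (2 * q * (w - y)))
          by (simpl; field; apply pow_nonzero; lra).
        apply Rmult_le_compat_r; [lra|]. apply Rmult_le_compat_l; [left; apply H2|].
        apply Hratio. lia.
      + rewrite Rminus_diag, Rmult_0_r, exp_0, Rmult_1_r. apply Hlev. lia. }
  intros n Hn. specialize (H (S K - n)%nat ltac:(lia) x ltac:(lra)).
  replace (S K - (S K - n))%nat with n in H by lia.
  apply Rle_trans with (1 := H).
  assert (He : exp (2 * q * (x - y)) <= 2).
  { apply Rle_trans with (exp (/ 2)).
    - destruct (Req_dec (2 * q * (x - y)) (/ 2)) as [->|Hne]; [lra|].
      left. apply exp_increasing. lra.
    - assert (E : exp (/ 2) * exp (/ 2) = exp 1) by (rewrite <- exp_plus; f_equal; lra).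
      pose proof exp_le_3. pose proof (exp_pos (/ 2)). nra. }
  replace (2 ^ n / 2 ^ K * T n) with (2 ^ n / 2 ^ S K * T n * 2)
    by (simpl; field; apply pow_nonzero; lra).
  apply Rmult_le_compat_l; [|exact He].
  apply Rmult_le_pos; [left; apply H2|apply HT0].
Qed.

(** The initial flatness $2^{-(P+m)}$ is spent one factor 2 at a time. Lowering the level from $k+1$
    to $k$ buys a distance $1/(4q_k)$, so [m] levels cover the sum of these distances. *)
Lemma bang (F : nat -> R -> R) (T q : nat -> R) (P m : nat) (x y : R) :
  deriv_family unit_open F -> (forall k, 0 < q k) -> 0 < y -> y <= x < 1 ->
  (forall n z, y <= z <= x -> Rabs (F n z) <= T n) -> (forall n, 0 <= T n) ->
  (forall n k, (n <= k)%nat -> (P <= k)%nat -> T (S n) <= q k * T n) ->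
  (forall n, (n < P + m)%nat -> Rabs (F n y) <= 2 ^ n / 2 ^ (P + m) * T n) ->
  x - y <= psum (fun i => / (4 * q (P + i)%nat)) m ->
  forall n, (n < P)%nat -> Rabs (F n x) <= 2 ^ n / 2 ^ P * T n.
Proof.
  intros HF Hq. revert y. induction m as [|m IH]; intros y Hy Hyx HT HT0 Hratio Hlev Hxy.
  - simpl in Hxy. replace x with y by lra. now rewrite Nat.add_0_r in Hlev.
  - simpl psum in Hxy. specialize (Hq (P + m)%nat) as Hqm.
    assert (Hi : 0 < / (4 * q (P + m)%nat)) by (apply Rinv_0_lt_compat; lra).
    set (y' := Rmin x (y + / (4 * q (P + m)%nat))).
    assert (Hy' : y <= y' <= x) by (unfold y'; split; [apply Rmin_glb; lra|apply Rmin_l]).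
    assert (Hy2 : y' - y <= / (4 * q (P + m)%nat)).
    { pose proof (Rmin_r x (y + / (4 * q (P + m)%nat))). unfold y'. lra. }
    apply (IH y'); auto; try lra.
    + intros n z Hz. apply HT. lra.
    + rewrite Nat.add_succ_r in Hlev.
      intros n Hn. apply (bang_step F T (q (P + m)%nat) (P + m) y' y); auto; try lra.
      * apply Rle_trans with (/ (4 * q (P + m)%nat) * (4 * q (P + m)%nat)).
        -- apply Rmult_le_compat_r; lra.
        -- right. apply Rinv_l. lra.
      * intros k z Hz. apply HT. lra.
      * intros k Hk. apply Hratio; lia.
    + assert (Hps : 0 <= psum (fun i => / (4 * q (P + i)%nat)) m).
      { apply (psum_le (fun i => / (4 * q (P + i)%nat)) 0 m); [|lia].
        intros i. apply Rinv_0_lt_compat. specialize (Hq (P + i)%nat). lra. }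
      unfold y', Rmin. destruct Rle_dec; lra.
Qed.

(** Bang's argument for $F-x^P/P!$ leaves an error of at most half the majorant at [x0]. The
    monomial's own share is moved to the left side, which produces the factor 3. *)
Lemma monomial_lower_bound (e : nat -> R) (P m : nat) (D H Q x0 : R) :
  (forall k, 1 <= e k) -> (forall j k, (j <= k)%nat -> e j <= e k) ->
  0 < D -> 1 <= H -> H <= Q -> 0 < x0 <= / 2 ->
  INR P <= Q * e P * x0 -> x0 <= psum (fun i => / (4 * (Q * e (P + i)%nat))) m ->
  (forall eta J, 0 < eta -> exists F, deriv_family unit_open F /\
    (forall k x, unit_open x -> Rabs (F k x) <= D * (H ^ k * pprod e k)) /\
    exists d, 0 < d /\ forall x n, 0 < x < d -> (n <= J)%nat ->
      Rabs (F n x - (if Nat.eq_dec n P then 1 else 0)) <= eta) ->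
  forall n, (n < P)%nat -> monomial P n x0 <= 3 * (D * (H ^ n * pprod e n)).
Proof.
  intros He1 Hem HD HH HQ Hx0 HP Hsum Happ.
  assert (He0 : forall k, 0 < e k) by (intros k; specialize (He1 k); lra).
  assert (HL1 : forall k, 1 <= pprod e k).
  { intros k. pose proof (pprod_add_ge e 1 0 k ltac:(lra) He0 He1) as Hk.
    rewrite pow1 in Hk. simpl in Hk. lra. }
  assert (HHk : forall k, 1 <= H ^ k) by (intros k; now apply pow_R1_Rle).
  assert (HDk : forall k, D <= D * (H ^ k * pprod e k)).
  { intros k. rewrite <- (Rmult_1_r D) at 1. apply Rmult_le_compat_l; [lra|].
    specialize (HHk k). specialize (HL1 k). nra. }
  (* The sum of the bounds for [F] and for the monomial on $(0,x_0]$. The second summand grows from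
     order $i$ to $i+1$ by the ratio $(P-i)/x_0$, which is why [INR P <= Q * e P * x0] is
     assumed. *)
  set (T := fun k => D * (H ^ k * pprod e k) + monomial P k x0).
  assert (Hmp : forall k, 0 <= monomial P k x0) by (intros k; apply monomial_pos; lra).
  assert (HT : forall k, D <= T k) by (intros k; unfold T; specialize (HDk k); specialize (Hmp k); lra).
  (* Half of the flatness [bang] requires at the start: at [y] both [F] and the monomial deviate
     from the unit jet by at most [eta]. *)
  set (eta := D / 2 ^ (P + m) / 2).
  assert (H2pm : 0 < 2 ^ (P + m)) by (apply pow_lt; lra).
  assert (Heta0 : 0 < D / 2 ^ (P + m)) by now apply Rdiv_lt_0_compat.
  assert (Heta : 0 < eta) by (unfold eta; lra).
  destruct (Happ eta (P + m)%nat Heta) as [F [HF [HFb [d [Hd HFd]]]]].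
  set (y := Rmin (d / 2) (Rmin x0 eta)).
  assert (Hyd : y <= d / 2) by apply Rmin_l.
  assert (Hyx : y <= x0) by (apply Rle_trans with (1 := Rmin_r _ _); apply Rmin_l).
  assert (Hye : y <= eta) by (apply Rle_trans with (1 := Rmin_r _ _); apply Rmin_r).
  assert (Hy0 : 0 < y) by (repeat apply Rmin_glb_lt; lra).
  assert (Hmono : forall k z, 0 <= z <= x0 -> 0 <= monomial P k z <= monomial P k x0).
  { intros k z Hz. split; [apply monomial_pos; lra|]. unfold monomial.
    destruct Nat.leb; [|lra].
    apply Rmult_le_compat_r; [left; apply Rinv_0_lt_compat, INR_fact_lt_0|].
    apply pow_incr. lra. }
  assert (Hsmall : forall k, Rabs (monomial P k y - (if Nat.eq_dec k P then 1 else 0)) <= eta).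
  { intros k. unfold monomial. destruct (Nat.leb_spec k P) as [Hk|Hk]; destruct Nat.eq_dec as [E|E].
    - subst. rewrite Nat.sub_diag. simpl. rewrite Rdiv_1_r, Rminus_diag, Rabs_R0. lra.
    - replace (P - k)%nat with (S (P - S k)) by lia. set (j := (P - S k)%nat).
      rewrite Rminus_0_r, Rabs_pos_eq.
      + apply Rle_trans with (2 := Hye). apply Rle_div_l; [apply INR_fact_lt_0|].
        simpl pow. apply Rmult_le_compat_l; [lra|]. apply Rle_trans with 1.
        * rewrite <- (pow1 j). apply pow_incr. lra.
        * change 1 with (INR 1). apply le_INR. apply lt_O_fact.
      + apply Rmult_le_pos; [apply pow_le; lra|].
        left. apply Rinv_0_lt_compat, INR_fact_lt_0.
    - lia.
    - rewrite Rminus_0_r, Rabs_R0. lra. }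
  intros n Hn.
  assert (Hb : Rabs (F n x0 - monomial P n x0) <= 2 ^ n / 2 ^ P * T n).
  { apply (bang (fun k x => F k x - monomial P k x) T (fun k => Q * e k) P m x0 y); auto.
    - intros k x Hx. apply @is_derive_minus; [now apply HF|]. now apply (monomial_family P unit_open).
    - intros k. specialize (He0 k). apply Rmult_lt_0_compat; lra.
    - lra.
    - intros k z Hz. unfold T. apply Rle_trans with (1 := Rabs_triang _ _). rewrite Rabs_Ropp.
      apply Rplus_le_compat; [apply HFb; unfold unit_open; lra|].
      pose proof (Hmono k z ltac:(lra)). rewrite Rabs_pos_eq; lra.
    - intros k. specialize (HT k). lra.
    - intros i k Hik HPk. unfold T. rewrite Rmult_plus_distr_l.
      pose proof (Hem i k Hik) as Hei. pose proof (He0 i). pose proof (He0 k).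
      apply Rplus_le_compat.
      + simpl. specialize (HDk i).
        replace (D * (H * H ^ i * (pprod e i * e i))) with
          (H * e i * (D * (H ^ i * pprod e i))) by ring.
        apply Rmult_le_compat_r; [lra|]. apply Rmult_le_compat; lra.
      + unfold monomial. destruct (Nat.leb_spec (S i) P) as [HSi|HSi].
        * destruct (Nat.leb_spec i P); [|lia].
          replace (P - i)%nat with (S (P - S i)) by lia. set (j := (P - S i)%nat).
          assert (Hj : INR (S j) <= Q * e k * x0).
          { apply Rle_trans with (INR P); [apply le_INR; lia|].
            apply Rle_trans with (1 := HP). apply Rmult_le_compat_r; [lra|].
            apply Rmult_le_compat_l; [lra|]. now apply Hem. }
          rewrite fact_simpl, mult_INR. simpl pow.
          assert (HSj : 0 < INR (S j)) by (apply lt_0_INR; lia).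
          pose proof (INR_fact_lt_0 j).
          replace (Q * e k * (x0 * x0 ^ j / (INR (S j) * INR (fact j)))) with
            (Q * e k * x0 / INR (S j) * (x0 ^ j / INR (fact j))) by (field; lra).
          rewrite <- (Rmult_1_l (x0 ^ j / INR (fact j))) at 1.
          apply Rmult_le_compat_r.
          -- apply Rmult_le_pos; [apply pow_le; lra|left; now apply Rinv_0_lt_compat].
          -- apply Rle_div_r; lra.
        * apply Rmult_le_pos; [apply Rmult_le_pos; lra|]. apply (Hmp i).
    - intros k Hk. apply Rle_trans with (D / 2 ^ (P + m)).
      + replace (F k y - monomial P k y) with
          ((F k y - (if Nat.eq_dec k P then 1 else 0))
           + - (monomial P k y - (if Nat.eq_dec k P then 1 else 0))) by ring.
        apply Rle_trans with (1 := Rabs_triang _ _). rewrite Rabs_Ropp.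
        pose proof (HFd y k ltac:(lra) ltac:(lia)). specialize (Hsmall k).
        unfold eta in *. lra.
      + replace (2 ^ k / 2 ^ (P + m) * T k) with (2 ^ k * T k / 2 ^ (P + m)) by (unfold Rdiv; ring).
        apply Rmult_le_compat_r; [left; now apply Rinv_0_lt_compat|].
        specialize (HT k). assert (1 <= 2 ^ k) by (apply pow_R1_Rle; lra). nra.
    - lra. }
  assert (Hhalf : 2 ^ n / 2 ^ P <= / 2).
  { replace P with (S n + (P - S n))%nat by lia. rewrite pow_add. simpl pow.
    assert (Hp1 : 1 <= 2 ^ (P - S n)) by (apply pow_R1_Rle; lra).
    assert (Hp2 : 0 < 2 ^ n) by (apply pow_lt; lra).
    apply Rle_div_l; [apply Rmult_lt_0_compat; lra|]. nra. }
  assert (Hb2 : Rabs (F n x0 - monomial P n x0) <= / 2 * T n).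
  { apply Rle_trans with (1 := Hb). apply Rmult_le_compat_r; [specialize (HT n); lra|exact Hhalf]. }
  pose proof (HFb n x0 ltac:(unfold unit_open; lra)) as HFn.
  apply Rabs_le_between in Hb2. apply Rabs_le_between in HFn. unfold T in Hb2. lra.
Qed.

(** * Baire's theorem in weighted sequence spaces *)

Lemma finite_bound (g : nat -> R) (n : nat) : exists B, forall k, (k < n)%nat -> g k <= B.
Proof.
  induction n as [|n [B HB]]; [exists 0; lia|].
  exists (Rmax B (g n)). intros k Hk. destruct (Nat.eq_dec k n) as [->|Hne]; [apply Rmax_r|].
  apply Rle_trans with (2 := Rmax_l _ _). apply HB. lia.
Qed.

(** The Fréchet space with the norms $\sup_p|a_p|/w_i(p)$; weights constant in [i] give a Banach
    space, so both types are covered. *)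
Definition weighted_space (w : nat -> nat -> R) (a : nat -> R) : Prop :=
  forall i, exists B, forall p, Rabs (a p) <= B * w i p.

(* Baire's theorem in the weighted sequence space, with the closures taken for
   coordinatewise convergence, which suffices and keeps the sets [S m] arbitrary. *)
Lemma weighted_space_baire (w : nat -> nat -> R) (S_ : nat -> (nat -> R) -> Prop) :
  (forall i p, 0 < w i p) -> (forall i p, w (S i) p <= w i p) ->
  (forall a, weighted_space w a -> exists m, S_ m a) ->
  exists m i eps a0, 0 < eps /\ weighted_space w a0 /\
    forall b, weighted_space w b -> (forall p, Rabs (b p - a0 p) <= eps * w i p) ->
    forall eta J, 0 < eta -> exists c, S_ m c /\ forall p, (p <= J)%nat -> Rabs (c p - b p) <= eta.
Proof.
  intros Hw Hdec Hcov. apply NNPP. intros Hno.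
  (* A state is a center with a radius. If the claim fails, half of the ball, measured by [w m],
     contains a center [b] from which every member of [S_ m] differs by more than [eta] in one of
     the first coordinates. *)
  assert (Hstep : forall (ms : nat * ((nat -> R) * R)), exists st : (nat -> R) * R,
    let '(m, (a, eps)) := ms in
    weighted_space w a -> 0 < eps ->
    weighted_space w (fst st) /\ 0 < snd st <= eps / 2 /\
    (forall p, Rabs (fst st p - a p) <= eps / 2 * w m p) /\
    (forall c, (forall p, Rabs (c p - fst st p) <= snd st * w (S m) p) -> ~ S_ m c)).
  { intros [m [a eps]].
    destruct (classic (weighted_space w a /\ 0 < eps)) as [[Ha Heps]|Hn].
    2: { exists (a, eps). intros Ha Heps. now destruct Hn. }
    assert (Hb : exists b, weighted_space w b /\
      (forall p, Rabs (b p - a p) <= eps / 2 * w m p) /\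
      exists eta J, 0 < eta /\ forall c, S_ m c ->
        exists p, (p <= J)%nat /\ eta < Rabs (c p - b p)).
    { apply NNPP. intros Hn. apply Hno. exists m, m, (eps / 2), a.
      split; [lra|]. split; [exact Ha|]. intros b Hb Hba eta J Heta.
      apply NNPP. intros Hc. apply Hn. exists b. split; [exact Hb|]. split; [exact Hba|].
      exists eta, J. split; [exact Heta|]. intros c HSc. apply NNPP. intros Hp.
      apply Hc. exists c. split; [exact HSc|]. intros p HpJ.
      destruct (Rle_lt_dec (Rabs (c p - b p)) eta) as [|Hlt]; [easy|].
      exfalso. apply Hp. now exists p. }
    destruct Hb as [b [Hb [Hba [eta [J [Heta HJ]]]]]].
    (* A radius of at most [eta / W] keeps these coordinates within [eta] of [b], so the new ball
       misses [S_ m]. *)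
    assert (HW : exists W, 0 < W /\ forall p, (p <= J)%nat -> w (S m) p <= W).
    { destruct (finite_bound (w (S m)) (S J)) as [W HW]. exists (Rmax 1 W).
      split; [apply Rlt_le_trans with (2 := Rmax_l _ _); lra|].
      intros p Hp. apply Rle_trans with (2 := Rmax_r _ _). apply HW. lia. }
    destruct HW as [W [HW0 HW]].
    assert (HeW : 0 < eta / W) by now apply Rdiv_lt_0_compat.
    exists (b, Rmin (eps / 2) (eta / W)). intros _ _. simpl fst. simpl snd.
    split; [exact Hb|]. split; [split; [apply Rmin_glb_lt; lra|apply Rmin_l]|].
    split; [exact Hba|]. intros c Hc HSc. destruct (HJ c HSc) as [p [Hp Hlt]].
    specialize (Hc p).
    assert (Rmin (eps / 2) (eta / W) * w (S m) p <= eta / W * W).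
    { apply Rmult_le_compat; [apply Rmin_glb; lra|left; apply Hw|apply Rmin_r|now apply HW]. }
    replace (eta / W * W) with eta in * by (field; lra). lra. }
  destruct (choice_fun _ _ _ Hstep) as [f Hf]. clear Hstep Hno.
  set (st := fix st (m : nat) : (nat -> R) * R :=
    match m with O => (fun _ => 0, 1) | S k => f (k, st k) end).
  assert (Hinv : forall m, weighted_space w (fst (st m)) /\ 0 < snd (st m)).
  { induction m as [|m [IH1 IH2]].
    - split; [|simpl; lra]. intros i. exists 0. intros p. simpl. rewrite Rabs_R0. lra.
    - specialize (Hf (m, st m)). simpl. destruct (st m) as [a eps]. simpl in *.
      destruct (Hf IH1 IH2) as [H1 [H2 _]]. split; [exact H1|lra]. }
  assert (Hnext : forall m, 0 < snd (st (S m)) <= snd (st m) / 2 /\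
    (forall p, Rabs (fst (st (S m)) p - fst (st m) p) <= snd (st m) / 2 * w m p) /\
    (forall c, (forall p, Rabs (c p - fst (st (S m)) p) <= snd (st (S m)) * w (S m) p) -> ~ S_ m c)).
  { intros m. specialize (Hf (m, st m)). destruct (Hinv m) as [H1 H2].
    simpl. destruct (st m) as [a eps]. simpl in *. now destruct (Hf H1 H2) as [_ H]. }
  assert (Hwdec : forall m k p, w (m + k)%nat p <= w m p).
  { intros m k p. induction k as [|k IH]; [rewrite Nat.add_0_r; lra|].
    rewrite Nat.add_succ_r. specialize (Hdec (m + k)%nat p). lra. }
  assert (Hnest : forall m k p, Rabs (fst (st (m + k)%nat) p - fst (st m) p) <=
    (snd (st m) - snd (st (m + k)%nat)) * w m p).
  { intros m k p. induction k as [|k IH].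
    - rewrite Nat.add_0_r, !Rminus_diag, Rabs_R0. lra.
    - rewrite Nat.add_succ_r.
      destruct (Hnext (m + k)%nat) as [H1 [H2 _]]. specialize (H2 p).
      replace (fst (st (S (m + k))) p - fst (st m) p) with
        ((fst (st (S (m + k))) p - fst (st (m + k)%nat) p)
         + (fst (st (m + k)%nat) p - fst (st m) p)) by ring.
      apply Rle_trans with (1 := Rabs_triang _ _).
      pose proof (Hwdec m k p). pose proof (Hw m p).
      assert (snd (st (m + k)%nat) / 2 * w (m + k)%nat p <=
        (snd (st (m + k)%nat) - snd (st (S (m + k)))) * w m p).
      { apply Rmult_le_compat; [lra|left; apply Hw|lra|easy]. }
      lra. }
  assert (Hsmall : forall m, snd (st m) <= (/ 2) ^ m).
  { induction m as [|m IH]; [simpl; lra|].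
    destruct (Hnext m) as [H1 _]. simpl pow. lra. }
  assert (Hlim : forall p, exists l, is_lim_seq (fun m => fst (st m) p) (Finite l)).
  { intros p. apply ex_lim_seq_cauchy_corr. intros eps.
    assert (Hg : is_lim_seq (fun m => (/ 2) ^ m * w O p) 0).
    { replace (Finite 0) with (Rbar_mult 0 (w O p)) by (simpl; f_equal; ring).
      apply is_lim_seq_scal_r. apply is_lim_seq_geom. rewrite Rabs_pos_eq; lra. }
    destruct (proj2 (is_lim_seq_spec _ _) Hg (pos_div_2 eps)) as [n0 Hn0].
    specialize (Hn0 n0 (le_n _)). simpl in Hn0. rewrite Rminus_0_r in Hn0.
    pose proof (Rle_abs ((/ 2) ^ n0 * w O p)) as Habs.
    assert (H : forall n, (n0 <= n)%nat -> Rabs (fst (st n) p - fst (st n0) p) < eps / 2).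
    { intros n Hn. replace n with (n0 + (n - n0))%nat by lia.
      apply Rle_lt_trans with (1 := Hnest _ _ _).
      apply Rle_lt_trans with ((/ 2) ^ n0 * w O p); [|lra].
      apply Rle_trans with (snd (st n0) * w n0 p).
      - apply Rmult_le_compat_r; [left; apply Hw|].
        destruct (Hinv (n0 + (n - n0))%nat). lra.
      - destruct (Hinv n0). apply Rmult_le_compat; [lra|left; apply Hw|apply Hsmall|].
        apply (Hwdec O n0 p). }
    exists n0. intros n m Hn Hm.
    replace (fst (st n) p - fst (st m) p) with
      ((fst (st n) p - fst (st n0) p) + - (fst (st m) p - fst (st n0) p)) by ring.
    apply Rle_lt_trans with (1 := Rabs_triang _ _). rewrite Rabs_Ropp.
    pose proof (H n Hn). pose proof (H m Hm). lra. }
  destruct (choice_fun _ _ _ Hlim) as [a Ha].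
  assert (Hclose : forall m p, Rabs (a p - fst (st m) p) <= snd (st m) * w m p).
  { intros m p.
    apply (is_lim_seq_le_loc (fun n => Rabs (fst (st n) p - fst (st m) p))
      (fun _ => snd (st m) * w m p) (Rabs (a p - fst (st m) p)) (snd (st m) * w m p)).
    - exists m. intros n Hn. replace n with (m + (n - m))%nat by lia.
      apply Rle_trans with (1 := Hnest _ _ _).
      apply Rmult_le_compat_r; [left; apply Hw|]. destruct (Hinv (m + (n - m))%nat). lra.
    - apply (is_lim_seq_abs _ (a p - fst (st m) p)).
      apply is_lim_seq_minus'; [apply Ha|apply is_lim_seq_const].
    - apply is_lim_seq_const. }
  (* The limit of the centers lies in every ball, hence in none of the sets [S_ m]. *)
  destruct (Hcov a) as [m Hm].
  - intros i. destruct (Hinv i) as [H1 H2]. destruct (H1 i) as [B HB].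
    exists (snd (st i) + B). intros p. specialize (Hclose i p). specialize (HB p).
    replace (a p) with ((a p - fst (st i) p) + fst (st i) p) by ring.
    apply Rle_trans with (1 := Rabs_triang _ _). lra.
  - destruct (Hnext m) as [_ [_ H]]. apply (H a); [|exact Hm]. intros p. apply Hclose.
Qed.

(** * Approximate preimages of unit vectors with uniform bounds *)

Definition limit_at_0 (f : R -> R) (l : R) : Prop :=
  forall eta, 0 < eta -> exists d, 0 < d /\ forall x, 0 < x < d -> Rabs (f x - l) <= eta.

Lemma limit_at_0_scal_minus (f g : R -> R) (k l l' : R) :
  limit_at_0 f l -> limit_at_0 g l' -> limit_at_0 (fun x => k * (f x - g x)) (k * (l - l')).
Proof.
  intros Hf Hg eta Heta.
  set (e := eta / (2 * (Rabs k + 1))). pose proof (Rabs_pos k) as Hk.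
  assert (He : 0 < e) by (apply Rdiv_lt_0_compat; lra).
  destruct (Hf e He) as [d [Hd H]]. destruct (Hg e He) as [d' [Hd' H']].
  exists (Rmin d d'). split; [now apply Rmin_glb_lt|]. intros x Hx.
  pose proof (Rmin_l d d'). pose proof (Rmin_r d d').
  specialize (H x ltac:(lra)). specialize (H' x ltac:(lra)).
  replace (k * (f x - g x) - k * (l - l')) with (k * ((f x - l) + - (g x - l'))) by ring.
  rewrite Rabs_mult. apply Rle_trans with (Rabs k * (2 * e)).
  - apply Rmult_le_compat_l; [easy|].
    apply Rle_trans with (1 := Rabs_triang _ _). rewrite Rabs_Ropp. lra.
  - replace eta with ((Rabs k + 1) * (2 * e)) by (unfold e; field; lra).
    apply Rmult_le_compat_r; lra.
Qed.

Lemma filterlim_diff_quot_fst (I : R -> Prop) (f : R -> C) (x : R) (l : C) :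
  filterlim (diff_quot f x) (within I (locally' x)) (locally l) ->
  forall eta, 0 < eta -> exists d, 0 < d /\ forall y, I y -> y <> x -> Rabs (y - x) < d ->
    Rabs ((fst (f y) - fst (f x)) / (y - x) - fst l) < eta.
Proof.
  intros Hf eta Heta.
  destruct (proj1 (filterlim_locally _ _) Hf (mkposreal eta Heta)) as [d Hd].
  exists d. split; [apply cond_pos|]. intros y Iy Hne Hy.
  destruct (Hd y Hy Hne Iy) as [H _].
  change (Rabs (fst (diff_quot f x y) - fst l) < eta) in H.
  now rewrite fst_diff_quot in H.
Qed.

Definition unit_jet (r : nat) (N : nat -> R) (B H : R) (F : nat -> R -> R) (a : nat -> R) : Prop :=
  deriv_family unit_open F /\
  (forall n x, unit_open x -> Rabs (F (r * n)%nat x) <= B * (H ^ n * N n)) /\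
  (forall n, limit_at_0 (F (r * n)%nat) (a n)) /\
  (forall n j, (1 <= j)%nat -> (j < r)%nat -> limit_at_0 (F (r * n + j)%nat) 0).

(** Real parts suffice for real jets. The family is fixed before [h0]; in the Beurling case the same
    function satisfies the bound for each prescribed [h0]. *)
Lemma unit_jet_of_class (A : fun_class) (t : ultra_type) (r : nat) (N : nat -> R) (a : nat -> R) :
  (1 <= r)%nat -> (forall n, 0 < N n) -> jets A t r N (fun p => RtoC (a p)) ->
  exists F, (forall h0, 0 < h0 -> exists h B, 0 < h /\ (t = Beurling -> h = h0) /\
    unit_jet r N B h F a).
Proof.
  intros Hr HN [f [[[Hsm [Hz Hq]] _] Hj]].
  set (I := class_dom A) in *.
  set (F := fun n x => fst (derive_n_on I n f x)).
  assert (Hlp : forall x, I x -> limit_point I x) by apply class_dom_limit_point.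
  assert (Hlim : forall n x, I x -> filterlim (diff_quot (derive_n_on I n f) x)
    (within I (locally' x)) (locally (derive_n_on I (S n) f x))).
  { intros n x Hx. apply derive_on_correct; [now apply Hlp|now apply Hsm]. }
  assert (HF : deriv_family unit_open F).
  { intros n x Hx. apply is_derive_Reals. intros eps Heps.
    destruct (filterlim_diff_quot_fst I _ x _
      (Hlim n x (class_dom_unit A x ltac:(unfold unit_open in Hx; lra))) eps Heps) as [d [Hd H]].
    unfold unit_open in Hx.
    assert (Hm : 0 < Rmin d (Rmin x (1 - x))) by (repeat apply Rmin_glb_lt; lra).
    exists (mkposreal _ Hm). intros h Hh0 Hh. simpl in Hh.
    pose proof (Rmin_l d (Rmin x (1 - x))). pose proof (Rmin_r d (Rmin x (1 - x))).
    pose proof (Rmin_l x (1 - x)). pose proof (Rmin_r x (1 - x)).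
    assert (Hhb : - h <= Rabs h /\ h <= Rabs h).
    { split; [rewrite <- Rabs_Ropp|]; apply Rle_abs. }
    specialize (H (x + h)). replace (x + h - x) with h in H by ring.
    apply H; [apply class_dom_unit; lra|lra|lra]. }
  assert (I0 : I 0) by (apply class_dom_unit; lra).
  assert (H0 : forall n, limit_at_0 (F n) (fst (derive_n_on I n f 0))).
  { intros n eta Heta.
    destruct (filterlim_diff_quot_fst I _ 0 _ (Hlim n 0 I0) 1 Rlt_0_1) as [d [Hd H]].
    set (l := fst (derive_n_on I (S n) f 0)) in *.
    set (e := eta / (Rabs l + 1)). pose proof (Rabs_pos l) as Hl.
    assert (He : 0 < e) by (apply Rdiv_lt_0_compat; lra).
    exists (Rmin d (Rmin e 1)). split; [repeat apply Rmin_glb_lt; lra|]. intros x Hx.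
    pose proof (Rmin_l d (Rmin e 1)). pose proof (Rmin_r d (Rmin e 1)).
    pose proof (Rmin_l e 1). pose proof (Rmin_r e 1).
    specialize (H x (class_dom_unit A x ltac:(lra)) ltac:(lra)).
    rewrite Rminus_0_r in H. specialize (H ltac:(rewrite Rabs_pos_eq; lra)).
    unfold F. set (v := fst (derive_n_on I n f x) - fst (derive_n_on I n f 0)) in *.
    assert (Hv : Rabs (v / x) <= Rabs l + 1).
    { replace (v / x) with ((v / x - l) + l) by ring.
      apply Rle_trans with (1 := Rabs_triang _ _). lra. }
    replace v with (v / x * x) by (field; lra).
    rewrite Rabs_mult, (Rabs_pos_eq x) by lra.
    apply Rle_trans with ((Rabs l + 1) * e).
    - apply Rmult_le_compat; [apply Rabs_pos|lra|easy|lra].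
    - right. unfold e. field. lra. }
  exists F. intros h0 Hh0.
  assert (Hhb : exists h B, 0 < h /\ (t = Beurling -> h = h0) /\
    forall n x, I x -> Cmod (derive_n_on I (r * n) f x) / (h ^ n * N n) <= B).
  { destruct t; simpl in Hq.
    - destruct Hq as [h [Hh [B HB]]]. now exists h, B.
    - destruct (Hq h0 Hh0) as [B HB]. now exists h0, B. }
  destruct Hhb as [h [B [Hh [Ht HB]]]].
  exists h, B. split; [exact Hh|]. split; [exact Ht|].
  split; [exact HF|]. split; [|split].
  - intros n x Hx. unfold unit_open in Hx.
    specialize (HB n x (class_dom_unit A x ltac:(lra))).
    apply Rle_div_l in HB; [|apply Rmult_lt_0_compat; [now apply pow_lt|apply HN]].
    apply Rle_trans with (2 := HB). apply re_le_Cmod.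
  - intros n. replace (a n) with (fst (derive_n_on I (r * n) f 0)); [apply H0|].
    rewrite <- Hj. reflexivity.
  - intros n j H1 H2. replace 0 with (fst (derive_n_on I (r * n + j) f 0)) at 1; [apply H0|].
    rewrite Hz by easy. reflexivity.
Qed.

Lemma Lambda_of_weights (t : ultra_type) (M : nat -> R) (h : R) (a : nat -> R) :
  (forall n, 0 < M n) -> 0 < h ->
  weighted_space (fun i p => (match t with Roumieu => h | Beurling => / INR (S i) end) ^ p * M p) a ->
  Lambda t M (fun p => RtoC (a p)).
Proof.
  intros HM Hh Ha. unfold Lambda. destruct t; simpl in *.
  - exists h. split; [exact Hh|]. destruct (Ha O) as [B HB]. exists B. intros p.
    rewrite Cmod_R. apply Rle_div_l; [|apply HB].
    apply Rmult_lt_0_compat; [now apply pow_lt|easy].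
  - intros k Hk. destruct (INR_unbounded (/ k)) as [i Hi]. destruct (Ha i) as [B HB].
    exists (Rabs B). intros p. rewrite Cmod_R.
    apply Rle_div_l; [apply Rmult_lt_0_compat; [now apply pow_lt|easy]|].
    apply Rle_trans with (1 := HB p).
    assert (HSi : 0 < INR (S i)) by (apply lt_0_INR; lia).
    assert (Hki : / INR (S i) <= k).
    { rewrite <- (Rinv_inv k). apply Rinv_le_contravar; [now apply Rinv_0_lt_compat|].
      rewrite S_INR. lra. }
    assert (Hi0 : 0 < / INR (S i)) by now apply Rinv_0_lt_compat.
    apply Rle_trans with (Rabs B * ((/ INR (S i)) ^ p * M p)).
    + apply Rmult_le_compat_r; [|apply Rle_abs].
      apply Rmult_le_pos; [apply pow_le; lra|left; apply HM].
    + apply Rmult_le_compat_l; [apply Rabs_pos|]. apply Rmult_le_compat_r; [left; apply HM|].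
      apply pow_incr. lra.
Qed.

(** In the Roumieu case the Banach space of scale [h0] is already contained in the sequence class,
    so [h] is free; in the Beurling case [h] is the scale of the ball found by Baire's theorem. *)
Lemma uniform_preimages (A : fun_class) (t : ultra_type) (r : nat) (M N : nat -> R) (h0 : R) :
  (1 <= r)%nat -> (forall n, 0 < M n) -> (forall n, 0 < N n) -> 0 < h0 ->
  (forall a : nat -> C, Lambda t M a -> jets A t r N a) ->
  exists h A1 H, 0 < h /\ 0 < A1 /\ 1 <= H /\ (t = Roumieu -> h = h0) /\
    forall p eta J, 0 < eta -> exists F, deriv_family unit_open F /\
      (forall n x, unit_open x -> Rabs (F (r * n)%nat x) <= A1 / (h ^ p * M p) * (H ^ n * N n)) /\
      exists d, 0 < d /\ forall x n, 0 < x < d -> (n <= J)%nat ->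
        Rabs (F n x - (if Nat.eq_dec n (r * p) then 1 else 0)) <= eta.
Proof.
  intros Hr HM HN Hh0 Hsurj.
  set (g := fun i => match t with Roumieu => h0 | Beurling => / INR (S i) end).
  set (w := fun i p => g i ^ p * M p).
  (* Countably many sets must exhaust all preimages: in the Roumieu case both the constant and the
     scale grow with [m], in the Beurling case the scale is fixed at 1. *)
  set (Hm := fun m => match t with Roumieu => INR (S m) | Beurling => 1 end).
  assert (HS1 : forall m, 1 <= INR (S m)).
  { intros m. rewrite S_INR. pose proof (pos_INR m). lra. }
  assert (HHm : forall m, 1 <= Hm m) by (intros m; unfold Hm; destruct t; [apply HS1|lra]).
  assert (Hg : forall i, 0 < g i).
  { intros i. unfold g. destruct t; [easy|]. apply Rinv_0_lt_compat. specialize (HS1 i). lra. }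
  assert (Hw : forall i p, 0 < w i p).
  { intros i p. apply Rmult_lt_0_compat; [now apply pow_lt|easy]. }
  destruct (weighted_space_baire w (fun m a => exists F, unit_jet r N (INR (S m)) (Hm m) F a))
    as [m [i [eps [a0 [Heps [Ha0 Hdense]]]]]].
  - exact Hw.
  - intros i p. apply Rmult_le_compat_r; [left; apply HM|]. apply pow_incr.
    split; [left; apply Hg|]. unfold g. destruct t; [lra|].
    apply Rinv_le_contravar; [specialize (HS1 i); lra|]. apply le_INR. lia.
  - intros a Ha.
    assert (HL : Lambda t M (fun p => RtoC (a p))) by now apply Lambda_of_weights with h0.
    destruct (unit_jet_of_class A t r N a Hr HN (Hsurj _ HL)) as [F HF].
    destruct (HF 1 Rlt_0_1) as [h [B [Hh [Ht [H1 [H2 [H3 H4]]]]]]].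
    destruct (INR_unbounded (Rmax B h)) as [m Hmm].
    pose proof (Rmax_l B h). pose proof (Rmax_r B h).
    exists m, F. split; [exact H1|]. split; [|split; assumption].
    intros n x Hx. apply Rle_trans with (1 := H2 n x Hx).
    assert (Hhm : h <= Hm m).
    { unfold Hm. destruct t; [rewrite S_INR; lra|]. rewrite Ht by easy. lra. }
    assert (Hp : 0 <= h ^ n * N n <= Hm m ^ n * N n).
    { split; [apply Rmult_le_pos; [apply pow_le; lra|left; apply HN]|].
      apply Rmult_le_compat_r; [left; apply HN|]. apply pow_incr. lra. }
    specialize (HS1 m). rewrite S_INR in *.
    apply Rle_trans with ((INR m + 1) * (h ^ n * N n)).
    + apply Rmult_le_compat_r; lra.
    + apply Rmult_le_compat_l; lra.
  - exists (g i), (2 * INR (S m) / eps), (Hm m).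
    split; [apply Hg|]. split; [apply Rdiv_lt_0_compat; [specialize (HS1 m); lra|easy]|].
    split; [apply HHm|]. split; [intros ->; reflexivity|].
    intros p eta J Heta.
    (* The coordinate [p] of the center is moved as far as the ball permits. The difference of
       preimages near both points, divided by [k], has nearly the unit jet and the factor
       $1/(h^pM_p)$ in its bound. *)
    set (k := eps * w i p). assert (Hk : 0 < k) by now apply Rmult_lt_0_compat.
    set (b := fun q => a0 q + (if Nat.eq_dec q p then k else 0)).
    assert (Hb : weighted_space w b).
    { intros i'. destruct (Ha0 i') as [B HB]. exists (B + k / w i' p). intros q. unfold b.
      apply Rle_trans with (1 := Rabs_triang _ _). rewrite Rmult_plus_distr_r.
      apply Rplus_le_compat; [apply HB|].
      destruct Nat.eq_dec as [->|Hne].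
      - rewrite Rabs_pos_eq by lra. right. field. specialize (Hw i' p). lra.
      - rewrite Rabs_R0. apply Rmult_le_pos; [|left; apply Hw].
        left. now apply Rdiv_lt_0_compat. }
    (* After division by [k] the two approximations cost [eta / 2]; the other half is left for the
       limit at 0. *)
    assert (He2 : 0 < k * eta / 4) by nra.
    destruct (Hdense a0 Ha0) with (eta := k * eta / 4) (J := J) as [c1 [[F1 HF1] Hc1]];
      [intros q; rewrite Rminus_diag, Rabs_R0; apply Rmult_le_pos; [lra|left; apply Hw]|easy|].
    destruct (Hdense b Hb) with (eta := k * eta / 4) (J := J) as [c2 [[F2 HF2] Hc2]].
    { intros q. unfold b. replace (a0 q + (if Nat.eq_dec q p then k else 0) - a0 q)
        with (if Nat.eq_dec q p then k else 0) by ring.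
      destruct Nat.eq_dec as [->|Hne]; [rewrite Rabs_pos_eq by lra; apply Rle_refl|].
      rewrite Rabs_R0. apply Rmult_le_pos; [lra|left; apply Hw]. }
    { easy. }
    destruct HF1 as [D1 [B1 [L1 Z1]]]. destruct HF2 as [D2 [B2 [L2 Z2]]].
    exists (fun n x => / k * (F2 n x - F1 n x)).
    assert (Hik : 0 < / k) by now apply Rinv_0_lt_compat.
    split; [|split].
    + intros n x Hx. apply is_derive_scal. apply @is_derive_minus; [now apply D2|now apply D1].
    + intros n x Hx. rewrite Rabs_mult, Rabs_pos_eq by lra.
      apply Rle_trans with (/ k * (2 * (INR (S m) * (Hm m ^ n * N n)))).
      * apply Rmult_le_compat_l; [lra|]. apply Rle_trans with (1 := Rabs_triang _ _).
        rewrite Rabs_Ropp. specialize (B1 n x Hx). specialize (B2 n x Hx). lra.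
      * right. unfold k, w. field. pose proof (HM p).
        repeat split; try lra. apply pow_nonzero. specialize (Hg i). lra.
    + assert (Hone : forall n, (n <= J)%nat -> exists d, 0 < d /\ forall x, 0 < x < d ->
        Rabs (/ k * (F2 n x - F1 n x) - (if Nat.eq_dec n (r * p) then 1 else 0)) <= eta).
      { intros n Hn.
        assert (Hlim : exists l, limit_at_0 (fun x => / k * (F2 n x - F1 n x)) l /\
          Rabs (l - (if Nat.eq_dec n (r * p) then 1 else 0)) <= eta / 2).
        { set (q := (n / r)%nat). set (j := (n mod r)%nat).
          assert (En : n = (r * q + j)%nat) by apply Nat.div_mod_eq.
          assert (Hj : (j < r)%nat) by (apply Nat.mod_upper_bound; lia).
          destruct (Nat.eq_dec j 0) as [Hj0|Hj0].
          - rewrite Hj0, Nat.add_0_r in En. rewrite En.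
            exists (/ k * (c2 q - c1 q)). split; [now apply limit_at_0_scal_minus|].
            specialize (Hc1 q ltac:(nia)). specialize (Hc2 q ltac:(nia)).
            replace (if Nat.eq_dec (r * q) (r * p) then 1 else 0) with (/ k * (b q - a0 q)).
            + replace (/ k * (c2 q - c1 q) - / k * (b q - a0 q)) with
                (/ k * ((c2 q - b q) + - (c1 q - a0 q))) by ring.
              rewrite Rabs_mult, Rabs_pos_eq by lra.
              apply Rle_trans with (/ k * (k * eta / 4 + k * eta / 4)).
              * apply Rmult_le_compat_l; [lra|]. apply Rle_trans with (1 := Rabs_triang _ _).
                rewrite Rabs_Ropp. lra.
              * right. field. lra.
            + unfold b. destruct (Nat.eq_dec q p) as [->|Hne].
              * destruct Nat.eq_dec; [field; lra|lia].
              * destruct Nat.eq_dec as [E|_]; [apply Nat.mul_cancel_l in E; lia|ring].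
          - exists (/ k * (0 - 0)). split.
            + rewrite En. apply limit_at_0_scal_minus; [apply Z2|apply Z1]; lia.
            + destruct Nat.eq_dec as [E|_].
              * assert (q < p \/ p <= q)%nat by lia. nia.
              * replace (/ k * (0 - 0) - 0) with 0 by ring. rewrite Rabs_R0. lra. }
        destruct Hlim as [l [Hl Hle]]. destruct (Hl (eta / 2)) as [d [Hd H]]; [lra|].
        exists d. split; [easy|]. intros x Hx. specialize (H x Hx).
        match goal with |- Rabs (?u - ?v) <= _ => replace (u - v) with ((u - l) + (l - v)) by ring end.
        apply Rle_trans with (1 := Rabs_triang _ _). lra. }
      clear -Hone.
      induction J as [|J' IH].
      * destruct (Hone O (le_n _)) as [d [Hd H]]. exists d. split; [easy|].
        intros x n Hx Hn. replace n with O by lia. now apply H.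
      * destruct IH as [d [Hd H]]; [intros n Hn; apply Hone; lia|].
        destruct (Hone (S J') (le_n _)) as [d' [Hd' H']].
        exists (Rmin d d'). split; [now apply Rmin_glb_lt|]. intros x n Hx Hn.
        pose proof (Rmin_l d d'). pose proof (Rmin_r d d').
        destruct (Nat.eq_dec n (S J')) as [->|Hne]; [apply H'|apply H; [|lia]]; lra.
Qed.

(** * Consequences of the growth assumption *)

Lemma fact_add_le (n k : nat) : (fact (n + k) <= fact n * (n + k) ^ k)%nat.
Proof.
  induction k as [|k IH]; [rewrite Nat.add_0_r; simpl; lia|].
  rewrite Nat.add_succ_r, fact_simpl.
  assert (H : ((n + k) ^ k <= S (n + k) ^ k)%nat) by (apply Nat.pow_le_mono_l; lia).
  rewrite Nat.pow_succ_r', (Nat.mul_comm (fact n)), <- Nat.mul_assoc.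
  apply Nat.mul_le_mono_l. rewrite Nat.mul_comm.
  apply Nat.le_trans with (1 := IH). now apply Nat.mul_le_mono_l.
Qed.

Lemma fact_mul_le (r p : nat) : (fact (r * p) <= r ^ (r * p) * fact p ^ r)%nat.
Proof.
  induction p as [|p IH]; [rewrite Nat.mul_0_r; simpl; now rewrite Nat.pow_1_l|].
  replace (r * S p)%nat with (r * p + r)%nat by ring.
  apply Nat.le_trans with (1 := fact_add_le (r * p) r).
  replace (r * p + r)%nat with (r * S p)%nat at 1 by ring.
  rewrite fact_simpl, !Nat.pow_mul_l, Nat.pow_add_r.
  apply Nat.le_trans with ((r ^ (r * p) * fact p ^ r) * (r ^ r * S p ^ r))%nat.
  - now apply Nat.mul_le_mono_r.
  - apply Nat.eq_le_incl. ring.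
Qed.

(** Turns the assumption on $M_p^{1/r}/p!$ into a comparison with $(rp)!$, the factorial that occurs
    in the monomial of order [r * p]. *)
Lemma fact_growth (r p : nat) (c m : R) :
  (1 <= r)%nat -> (1 <= p)%nat -> 0 < c -> 0 < m ->
  c <= Rpower (Rpower m (/ INR r) / INR (fact p)) (/ INR p) ->
  ((c / INR r) ^ r) ^ p * INR (fact (r * p)) <= m.
Proof.
  intros Hr Hp Hc Hm H.
  assert (HrR : 0 < INR r) by (apply lt_0_INR; lia).
  pose proof (INR_fact_lt_0 p) as Hf.
  assert (H1 : c ^ p * INR (fact p) <= Rpower m (/ INR r)).
  { apply Rle_div_r; [easy|].
    rewrite <- (Rpower_root_pow (Rpower m (/ INR r) / INR (fact p)) p Hp)
      by (apply Rdiv_lt_0_compat; [apply exp_pos|easy]).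
    apply pow_incr. lra. }
  assert (Hcp : 0 < c ^ p) by now apply pow_lt.
  rewrite <- (Rpower_root_pow m r) by auto.
  apply Rle_trans with ((c ^ p * INR (fact p)) ^ r).
  - pose proof (le_INR _ _ (fact_mul_le r p)) as Hfm. rewrite mult_INR, !pow_INR in Hfm.
    rewrite <- pow_mult. unfold Rdiv. rewrite !Rpow_mult_distr, pow_inv, <- pow_mult.
    rewrite (Nat.mul_comm p r), Rmult_assoc.
    apply Rmult_le_compat_l; [apply pow_le; lra|].
    assert (Hrp : 0 < INR r ^ (r * p)) by now apply pow_lt.
    apply Rmult_le_reg_l with (INR r ^ (r * p)); [easy|].
    rewrite <- Rmult_assoc, Rinv_r, Rmult_1_l by lra. exact Hfm.
  - apply pow_incr. split; [|exact H1]. apply Rmult_le_pos; lra.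
Qed.

Lemma fact_le_pow_mono (n m : nat) : (n <= m)%nat -> INR (fact n) <= INR m ^ n.
Proof.
  intros H. rewrite <- pow_INR. apply le_INR.
  induction n as [|n IH]; [simpl; lia|].
  rewrite fact_simpl, Nat.pow_succ_r'. specialize (IH ltac:(lia)). nia.
Qed.

(** From $(c/K)^p(rp)!\le N_p\le\nu_p^p$ and $(rp)!\ge(rp/e)^{rp}$ it follows that $\nu_p^{1/r}$
    grows at least linearly; the indices below [p1] are covered by [c1], since all roots are at
    least 1. *)
Lemma root_quot_growth (r : nat) (M N : nat -> R) (K c : R) (p1 : nat) :
  (1 <= r)%nat -> (forall n, 0 < M n) -> class_LC N ->
  1 <= K -> (forall p, M p <= K ^ p * N p) -> 0 < c ->
  (forall p, (p1 <= p)%nat -> c ^ p * INR (fact (r * p)) <= M p) ->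
  exists c3, 0 < c3 /\ forall p, c3 * INR (r * p) <= root_quot r N (r * p).
Proof.
  intros Hr HM HN HK HMN Hc Hg.
  assert (HrR : 0 < INR r) by (apply lt_0_INR; lia).
  assert (HcK : 0 < c / K) by (apply Rdiv_lt_0_compat; lra).
  pose proof (exp_pos 1) as He.
  set (c2 := Rpower (c / K) (/ INR r) / exp 1).
  assert (Hc2 : 0 < c2) by (apply Rdiv_lt_0_compat; [apply exp_pos|easy]).
  set (c1 := / INR (r * S p1)).
  assert (Hc1 : 0 < c1) by (apply Rinv_0_lt_compat, lt_0_INR; nia).
  exists (Rmin c1 c2). split; [now apply Rmin_glb_lt|]. intros p.
  pose proof (pos_INR (r * p)) as Hrp.
  destruct (le_lt_dec p1 p) as [Hp|Hp].
  - destruct p as [|p'] eqn:Ep.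
    { rewrite Nat.mul_0_r. simpl (INR 0). rewrite Rmult_0_r.
      pose proof (root_quot_ge_1 N HN r Hr 0). lra. }
    rewrite <- Ep in *. assert (Hp0 : (1 <= p)%nat) by lia. clear p' Ep.
    apply Rle_trans with (c2 * INR (r * p)); [apply Rmult_le_compat_r; [easy|apply Rmin_r]|].
    apply Rle_trans with (root_quot r N (r * (p - 1))).
    2: { apply root_quot_mono; auto. nia. }
    pose proof (root_quot_block N r Hr (p - 1) 0 ltac:(lia)) as Hrb.
    rewrite Nat.add_0_r in Hrb. replace (S (p - 1)) with p in Hrb by lia. rewrite Hrb. clear Hrb.
    assert (Hq1 : 1 <= quotients N p).
    { replace p with (S (p - 1)) by lia. now apply quotients_ge_1. }
    assert (H1 : (c / K * (INR (r * p) / exp 1) ^ r) ^ p <= quotients N p ^ p).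
    { apply Rle_trans with (N p).
      - assert (HKp : 0 < K ^ p) by (apply pow_lt; lra).
        apply Rmult_le_reg_l with (K ^ p); [easy|].
        apply Rle_trans with (2 := HMN p). apply Rle_trans with (2 := Hg p Hp).
        rewrite Rpow_mult_distr, <- pow_mult. unfold Rdiv. rewrite !Rpow_mult_distr, !pow_inv.
        replace (K ^ p * (c ^ p * / K ^ p * (INR (r * p) ^ (r * p) * / exp 1 ^ (r * p)))) with
          (c ^ p * (INR (r * p) ^ (r * p) * / exp 1 ^ (r * p)))
          by (field; split; [apply pow_nonzero|]; lra).
        apply Rmult_le_compat_l; [apply pow_le; lra|].
        pose proof (pow_div_fact_le_exp (INR (r * p)) (r * p) Hrp) as Hex.
        rewrite exp_INR in Hex. apply Rle_div_l in Hex; [|apply INR_fact_lt_0].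
        apply Rle_div_l; [now apply pow_lt|]. lra.
      - pose proof (LC_le_quotient_pow N HN 0 p p ltac:(lia)) as H. rewrite Nat.add_0_l in H.
        destruct HN as [_ [[H0 _] _]]. rewrite H0 in H. lra. }
    assert (Hbase : 0 <= c / K * (INR (r * p) / exp 1) ^ r).
    { apply Rmult_le_pos; [lra|]. apply pow_le. apply Rmult_le_pos; [easy|].
      left. now apply Rinv_0_lt_compat. }
    assert (H2 : c / K * (INR (r * p) / exp 1) ^ r <= quotients N p).
    { destruct (Rle_lt_dec (c / K * (INR (r * p) / exp 1) ^ r) (quotients N p)) as [|Hlt]; [easy|].
      exfalso.
      assert (Hx : 0 < c / K * (INR (r * p) / exp 1) ^ r) by lra.
      pose proof (Rpower_root_le _ (quotients N p) p Hp0 (pow_lt _ p Hx) ltac:(lra) H1) as H2.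
      rewrite <- (Rpower_pow p) in H2 by easy.
      rewrite Rpower_mult, Rinv_r, Rpower_1 in H2; [lra|easy|]. apply not_0_INR. lia. }
    assert (Hrp1 : 0 < INR (r * p)) by (apply lt_0_INR; nia).
    replace (c2 * INR (r * p)) with (Rpower ((c2 * INR (r * p)) ^ r) (/ INR r)).
    + apply Rle_Rpower_l; [left; now apply Rinv_0_lt_compat|].
      split; [apply pow_lt; now apply Rmult_lt_0_compat|].
      apply Rle_trans with (2 := H2). right. unfold c2.
      replace (Rpower (c / K) (/ INR r) / exp 1 * INR (r * p)) with
        (Rpower (c / K) (/ INR r) * (INR (r * p) / exp 1)) by (unfold Rdiv; ring).
      rewrite Rpow_mult_distr, Rpower_root_pow by auto. reflexivity.
    + rewrite <- Rpower_pow by now apply Rmult_lt_0_compat.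
      rewrite Rpower_mult, Rinv_r, Rpower_1; [easy|now apply Rmult_lt_0_compat|lra].
  - apply Rle_trans with 1; [|now apply root_quot_ge_1].
    apply Rle_trans with (c1 * INR (r * p)); [apply Rmult_le_compat_r; [easy|apply Rmin_l]|].
    unfold c1. rewrite Rmult_comm. apply Rle_div_l; [apply lt_0_INR; nia|].
    rewrite Rmult_1_l. apply le_INR. nia.
Qed.

Lemma cond_SV_necessary (r : nat) (M N : nat -> R) (K h A1 H c : R) (p1 : nat) :
  (1 <= r)%nat -> class_LC M -> class_LC N ->
  1 <= K -> (forall p, M p <= K ^ p * N p) ->
  0 < h -> 0 < A1 -> 1 <= H -> 0 < c -> 2 * 2 ^ r <= h * c ->
  (forall p, (p1 <= p)%nat -> c ^ p * INR (fact (r * p)) <= M p) ->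
  (forall p eta J, 0 < eta -> exists F, deriv_family unit_open F /\
    (forall n x, unit_open x -> Rabs (F (r * n)%nat x) <= A1 / (h ^ p * M p) * (H ^ n * N n)) /\
    exists d, 0 < d /\ forall x n, 0 < x < d -> (n <= J)%nat ->
      Rabs (F n x - (if Nat.eq_dec n (r * p) then 1 else 0)) <= eta) ->
  cond_SV r M N.
Proof.
  intros Hr HM HN HK HMN Hh HA1 HH Hc Hhc Hg Hpre.
  pose proof (LC_pos M HM) as HM0. pose proof (LC_pos N HN) as HN0.
  assert (HrR : 0 < INR r) by (apply lt_0_INR; lia).
  assert (Hir : 0 < / INR r) by now apply Rinv_0_lt_compat.
  assert (Hr1 : 1 <= INR r) by (change 1 with (INR 1); apply le_INR; lia).
  destruct (root_quot_growth r M N K c p1) as [c3 [Hc3 Hgrow]]; auto.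
  destruct (intermediate_derivatives r H Hr HH) as [A' [HA' Hint]].
  set (e := root_quot r N) in *.
  assert (He1 : forall i, 1 <= e i) by (intros i; now apply root_quot_ge_1).
  assert (Hem : forall j k, (j <= k)%nat -> e j <= e k) by (intros j k Hjk; now apply root_quot_mono).
  (* The summand [2 / c3] guarantees the hypothesis of [monomial_lower_bound] at [x0 = / 2]. *)
  set (Q := H + 2 / c3).
  assert (Hc3' : 0 < 2 / c3) by (apply Rdiv_lt_0_compat; lra).
  assert (HQ : 1 <= Q) by (unfold Q; lra).
  set (D := fun p => A' * (A1 / (h ^ p * M p))).
  assert (HD : forall p, 0 < D p).
  { intros p. apply Rmult_lt_0_compat; [easy|]. apply Rdiv_lt_0_compat; [easy|].
    apply Rmult_lt_0_compat; [now apply pow_lt|easy]. }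
  (* The distance Bang's argument covers in [r * m] levels above order [r * p]. *)
  set (dist := fun p m => psum (fun i => / (4 * (Q * e (r * p + i)%nat))) (r * m)).
  assert (Hcore : forall p m x0, 0 < x0 <= / 2 -> INR (r * p) <= Q * e (r * p)%nat * x0 ->
    x0 <= dist p m -> forall n, (n < r * p)%nat ->
    monomial (r * p) n x0 <= 3 * (D p * (H ^ n * pprod e n))).
  { intros p m x0 Hx0 HP Hd. apply (monomial_lower_bound e (r * p) (r * m) (D p) H Q x0); auto.
    - unfold Q. lra.
    - intros eta J Heta. destruct (Hpre p eta J Heta) as [F [HF [HFb HFd]]].
      exists F. split; [exact HF|]. split; [|exact HFd].
      apply Hint; auto. left. apply Rdiv_lt_0_compat; [easy|].
      apply Rmult_lt_0_compat; [now apply pow_lt|easy]. }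
  (* [s] has to exceed [K] for [lambda_le_quotient], and $s^p$ has to absorb $3A'A_1H^{rj}/h^p$ for
     all $j<p$. *)
  destruct (INR_unbounded (K + (1 + 3 * (A' * A1)) * (H ^ r / h))) as [s0 Hs0].
  set (s := S s0).
  assert (HAA : 0 < A' * A1) by now apply Rmult_lt_0_compat.
  assert (HHr : 1 <= H ^ r) by now apply pow_R1_Rle.
  assert (HHh : 0 < H ^ r / h) by (apply Rdiv_lt_0_compat; lra).
  assert (HKs : K <= INR s) by (unfold s; rewrite S_INR; nra).
  assert (Hss : (1 + 3 * (A' * A1)) * (H ^ r / h) <= INR s) by (unfold s; rewrite S_INR; lra).
  set (lam := fun p => lambda M N p s).
  assert (Hlam0 : forall p, (1 <= p)%nat -> 0 < lam p) by (intros p Hp; apply lambda_pos; unfold s; lia).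
  assert (Hlamq : forall p, (1 <= p)%nat -> lam p <= quotients N p).
  { intros p Hp. apply lambda_le_quotient with K; auto; [lra|unfold s; lia]. }
  (* Only the orders [r * j] are read. With $n=r(p-j)$ and $n!\le(rp)^n$ the bound on $x_0^n/n!$
     becomes one on $M_p/(s^pN_j)$, that is, on [lambda]. *)
  assert (Hlamx : forall p x0, (1 <= p)%nat -> 0 < x0 ->
    (forall n, (n < r * p)%nat -> monomial (r * p) n x0 <= 3 * (D p * (H ^ n * pprod e n))) ->
    Rpower (lam p) (/ INR r) <= INR (r * p) / x0).
  { intros p x0 Hp Hx0 Hmon.
    assert (Hrp : 0 < INR (r * p)) by (apply lt_0_INR; nia).
    assert (Hrx : 0 < INR (r * p) / x0) by now apply Rdiv_lt_0_compat.
    apply Rpower_root_le; auto; [lra|].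
    apply lambda_le; auto; [unfold s; lia|apply pow_le; lra|]. intros j Hj.
    specialize (Hmon (r * j)%nat ltac:(nia)). unfold monomial in Hmon.
    destruct (Nat.leb_spec (r * j) (r * p)); [|nia].
    unfold e in Hmon. rewrite pprod_root_quot in Hmon by auto.
    rewrite <- pow_mult. replace (r * p - r * j)%nat with (r * (p - j))%nat in Hmon by nia.
    set (n := (r * (p - j))%nat) in *.
    pose proof (HN0 j) as HNj. pose proof (HM0 p) as HMp.
    assert (Hs1 : 0 < INR s) by lra.
    assert (Hsp : 0 < INR s ^ p) by now apply pow_lt.
    assert (Hhp : 0 < h ^ p) by now apply pow_lt.
    assert (Hxn : 0 < x0 ^ n) by now apply pow_lt.
    apply Rle_div_l; [now apply Rmult_lt_0_compat|].
    unfold Rdiv at 1. rewrite Rpow_mult_distr, pow_inv.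
    apply (proj1 (Rle_div_l _ _ _ (INR_fact_lt_0 n))) in Hmon.
    apply Rmult_le_reg_l with (x0 ^ n); [easy|].
    replace (x0 ^ n * (INR (r * p) ^ n * / x0 ^ n * (INR s ^ p * N j))) with
      (INR (r * p) ^ n * (INR s ^ p * N j)) by (field; lra).
    apply Rle_trans with (3 * (D p * (H ^ (r * j) * N j)) * INR (fact n) * M p).
    - apply Rmult_le_compat_r; lra.
    - assert (Hfn : INR (fact n) <= INR (r * p) ^ n) by (apply fact_le_pow_mono; unfold n; nia).
      assert (Hsbig : 3 * (A' * A1) * H ^ (r * j) <= INR s ^ p * h ^ p).
      { rewrite <- Rpow_mult_distr.
        apply Rle_trans with (((1 + 3 * (A' * A1)) * H ^ r) ^ p).
        - rewrite Rpow_mult_distr, <- pow_mult. apply Rmult_le_compat.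
          + lra.
          + apply pow_le. lra.
          + destruct p as [|p']; [lia|]. simpl.
            assert (1 <= (1 + 3 * (A' * A1)) ^ p') by (apply pow_R1_Rle; lra). nra.
          + apply Rle_pow; [easy|nia].
        - apply pow_incr. split; [apply Rmult_le_pos; lra|].
          apply Rle_div_l; [easy|]. unfold Rdiv in *. lra. }
      replace (3 * (D p * (H ^ (r * j) * N j)) * INR (fact n) * M p) with
        (3 * (A' * A1) * H ^ (r * j) / h ^ p * (INR (fact n) * N j)) by (unfold D; field; lra).
      replace (INR (r * p) ^ n * (INR s ^ p * N j)) with (INR s ^ p * (INR (r * p) ^ n * N j)) by ring.
      apply Rmult_le_compat.
      + apply Rmult_le_pos; [|left; now apply Rinv_0_lt_compat].
        apply Rmult_le_pos; [lra|apply pow_le; lra].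
      + apply Rmult_le_pos; [apply pos_INR|lra].
      + apply Rle_div_l; easy.
      + apply Rmult_le_compat_r; lra. }
  destruct (Pow_x_infinity 2 ltac:(rewrite Rabs_pos_eq; lra) (3 * (A' * A1) + 1)) as [p2 Hp2].
  set (p3 := S (p1 + p2)).
  assert (Hmain : forall p, (p3 <= p)%nat -> forall m,
    dist p m < 1 /\ Rpower (lam p) (/ INR r) * dist p m <= 2 * INR (r * p)).
  { intros p Hp m. unfold p3 in Hp.
    assert (Hrp : 0 < INR (r * p)) by (apply lt_0_INR; nia).
    (* Otherwise [x0 = / 2] is reachable, and order 0 yields $h^pM_p\le 3A'A_12^{rp}(rp)!$. This
       contradicts the growth of [M], because $hc\ge 2\cdot 2^r$ and $2^p>3A'A_1$. *)
    assert (Hlt : dist p m < 1).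
    { destruct (Rlt_le_dec (dist p m) 1) as [|Hge]; [easy|]. exfalso.
      pose proof (Hcore p m (/ 2) ltac:(lra)) as Hmon.
      assert (HPQ : INR (r * p) <= Q * e (r * p)%nat * / 2).
      { apply Rle_trans with (2 / c3 * e (r * p)%nat * / 2).
        - specialize (Hgrow p).
          replace (2 / c3 * e (r * p)%nat * / 2) with (e (r * p)%nat / c3) by (field; lra).
          apply Rle_div_r; [easy|]. lra.
        - apply Rmult_le_compat_r; [lra|]. apply Rmult_le_compat_r; [specialize (He1 (r * p)%nat); lra|].
          unfold Q. lra. }
      specialize (Hmon HPQ ltac:(lra) O ltac:(nia)). unfold monomial in Hmon.
      simpl Nat.leb in Hmon. cbv iota in Hmon. rewrite Nat.sub_0_r in Hmon. simpl (H ^ 0) in Hmon.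
      simpl (pprod e 0) in Hmon. unfold D in Hmon.
      pose proof (HM0 p) as HMp. pose proof (INR_fact_lt_0 (r * p)) as Hf.
      assert (Hhp : 0 < h ^ p) by now apply pow_lt.
      assert (H2rp : 0 < 2 ^ (r * p)) by (apply pow_lt; lra).
      rewrite pow_inv in Hmon.
      apply (proj1 (Rle_div_l _ _ _ Hf)) in Hmon.
      assert (H1 : h ^ p * M p <= 3 * (A' * A1) * 2 ^ (r * p) * INR (fact (r * p))).
      { apply Rmult_le_compat_l with (r := 2 ^ (r * p) * (h ^ p * M p)) in Hmon.
        - replace (2 ^ (r * p) * (h ^ p * M p) * / 2 ^ (r * p)) with (h ^ p * M p) in Hmon
            by (field; lra).
          apply Rle_trans with (1 := Hmon). right. field. lra.
        - apply Rmult_le_pos; [lra|]. apply Rmult_le_pos; lra. }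
      specialize (Hg p ltac:(lia)). specialize (Hp2 p ltac:(lia)).
      rewrite Rabs_pos_eq in Hp2 by (apply pow_le; lra).
      assert (H2 : (2 * 2 ^ r) ^ p <= (h * c) ^ p).
      { apply pow_incr. split; [|easy]. apply Rmult_le_pos; [lra|apply pow_le; lra]. }
      rewrite !Rpow_mult_distr, <- pow_mult in H2.
      assert (H3 : h ^ p * (c ^ p * INR (fact (r * p))) <= h ^ p * M p)
        by (apply Rmult_le_compat_l; lra).
      assert (H4 : 2 ^ p * 2 ^ (r * p) * INR (fact (r * p)) <=
        3 * (A' * A1) * 2 ^ (r * p) * INR (fact (r * p))).
      { apply Rle_trans with (2 := H1). apply Rle_trans with (2 := H3).
        rewrite <- Rmult_assoc. apply Rmult_le_compat_r; lra. }
      apply Rmult_le_reg_r in H4; [|easy]. apply Rmult_le_reg_r in H4; [|easy]. lra. }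
    split; [exact Hlt|].
    destruct (Rle_lt_dec (dist p m) 0) as [H0|H0].
    { pose proof (exp_pos (/ INR r * ln (lam p))) as Hx. fold (Rpower (lam p) (/ INR r)) in Hx. nra. }
    (* If half the distance is too short for [monomial_lower_bound], then [Q * e (r * p) * dist p m]
       is below [2 * INR (r * p)], and $\lambda^{1/r}\le e_{rp}$ gives the same conclusion. *)
    destruct (Rle_lt_dec (INR (r * p)) (Q * e (r * p)%nat * (dist p m / 2))) as [HP|HP].
    - pose proof (Hcore p m (dist p m / 2) ltac:(lra) HP ltac:(lra)) as Hmon.
      apply Hlamx in Hmon; [|lia|lra].
      apply Rle_div_r in Hmon; lra.
    - assert (Hl : Rpower (lam p) (/ INR r) <= e (r * p)%nat).
      { apply Rle_Rpower_l; [lra|]. split; [apply Hlam0; lia|].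
        apply Rle_trans with (1 := Hlamq p ltac:(lia)).
        replace p with (S (p - 1)) at 1 by lia. apply quotients_mono; [easy|].
        apply Nat.div_le_lower_bound; nia. }
      assert (Rpower (lam p) (/ INR r) * dist p m <= e (r * p)%nat * dist p m)
        by (apply Rmult_le_compat_r; lra).
      assert (e (r * p)%nat * dist p m <= Q * e (r * p)%nat * dist p m).
      { apply Rmult_le_compat_r; [lra|]. specialize (He1 (r * p)%nat). nra. }
      lra. }
  set (t := fun k => Rpower (/ quotients N k) (/ INR r)).
  assert (Ht0 : forall k, 0 < t k) by (intros k; apply exp_pos).
  assert (Hq1 : forall p, 1 <= quotients N p).
  { intros [|p]; [simpl; lra|now apply quotients_ge_1]. }
  assert (Htinv : forall k, t k = / Rpower (quotients N k) (/ INR r)).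
  { intros k. apply Rpower_Rinv. specialize (Hq1 k). lra. }
  (* Order [r * p] belongs to the quotient of index [S p], so the distance sees the tail from [S p]
     on; the term [t p] is supplied by [HtR]. *)
  assert (Hdist : forall p m, dist p m = INR r / (4 * Q) * psum (fun k => t (S p + k)%nat) m).
  { intros p m. unfold dist.
    rewrite (psum_blocks r _ (fun k => / (4 * Q) * t (S p + k)%nat)).
    - unfold Rdiv. rewrite Rmult_assoc. f_equal.
      apply psum_scal.
    - intros k j Hj. unfold e. replace (r * p + (r * k + j))%nat with (r * (p + k) + j)%nat by ring.
      rewrite root_quot_block by auto. rewrite Htinv, Nat.add_succ_l.
      rewrite <- Rinv_mult. f_equal. ring. }
  set (k0 := INR r / (4 * Q)).
  assert (Hk0 : 0 < k0) by (apply Rdiv_lt_0_compat; lra).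
  assert (Hps : forall p, (p3 <= p)%nat -> forall m, psum (fun k => t (S p + k)%nat) m <= / k0).
  { intros p Hp m. destruct (Hmain p Hp m) as [Hd _]. rewrite Hdist in Hd. fold k0 in Hd.
    apply Rmult_le_reg_l with k0; [easy|]. rewrite Rinv_r by lra. lra. }
  assert (Hext : ex_series t).
  { apply (ex_series_incr_n t (S p3)).
    apply (Series_of_psum_le (fun k => t (S p3 + k)%nat) (/ k0)); [|now apply Hps].
    intros i. left. apply Ht0. }
  assert (Hexp : forall p, ex_series (fun k => t (p + k)%nat)).
  { intros p. now apply ex_series_incr_n. }
  exists s. split; [unfold s; lia|]. fold t. split; [intros p _; apply Hexp|].
  set (val := fun p => Rpower (lambda M N p s) (/ INR r) / INR p * Series (fun k => t (p + k)%nat)).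
  destruct (finite_bound val p3) as [B1 HB1].
  exists (Rmax B1 (1 + 8 * Q)). intros p Hp. fold (val p).
  destruct (le_lt_dec p3 p) as [Hp3|Hp3].
  2: { apply Rle_trans with (2 := Rmax_l _ _). now apply HB1. }
  apply Rle_trans with (2 := Rmax_r _ _).
  assert (HpR : 1 <= INR p) by (change 1 with (INR 1); now apply le_INR).
  set (R1 := Rpower (lam p) (/ INR r)).
  assert (HR1 : 0 < R1) by apply exp_pos.
  assert (HS : Series (fun k => t (p + k)%nat) = t p + Series (fun k => t (S p + k)%nat)).
  { rewrite Series_incr_1 by auto. rewrite Nat.add_0_r. f_equal.
    apply Series_ext. intros k. f_equal. lia. }
  assert (HtR : R1 * t p <= 1).
  { rewrite Htinv. apply Rle_div_l; [apply exp_pos|]. rewrite Rmult_1_l.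
    apply Rle_Rpower_l; [lra|]. split; [now apply Hlam0|now apply Hlamq]. }
  assert (Htail : Series (fun k => t (S p + k)%nat) <= 8 * Q * INR p / R1).
  { apply (Series_of_psum_le (fun k => t (S p + k)%nat)).
    - intros i. left. apply Ht0.
    - intros m. destruct (Hmain p Hp3 m) as [_ Hd]. rewrite Hdist in Hd. fold R1 in Hd.
      rewrite mult_INR in Hd. apply Rle_div_r; [easy|].
      apply Rmult_le_reg_l with (INR r / (4 * Q)); [exact Hk0|].
      replace (INR r / (4 * Q) * (8 * Q * INR p)) with (2 * (INR r * INR p)) by (field; lra).
      lra. }
  unfold val. fold (lam p). fold R1. rewrite HS.
  apply Rle_div_r in Htail; [|easy].
  replace (R1 / INR p * (t p + Series (fun k => t (S p + k)%nat))) with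
    ((R1 * t p + Series (fun k => t (S p + k)%nat) * R1) / INR p) by (field; lra).
  apply Rle_div_l; lra.
Qed.

Lemma LimInf_seq_pos (u : nat -> R) :
  Rbar_lt 0 (LimInf_seq u) -> exists c p1, 0 < c /\ forall p, (p1 <= p)%nat -> c <= u p.
Proof.
  intros H. unfold LimInf_seq in H. destruct (ex_LimInf_seq u) as [l Hl]. simpl in H.
  destruct l as [l| |]; simpl in *; [| |easy].
  - assert (Hl2 : 0 < l / 2) by lra.
    destruct (Hl (mkposreal _ Hl2)) as [_ [p1 H1]]. exists (l / 2), p1. split; [easy|].
    intros p Hp. specialize (H1 p Hp). simpl in H1. lra.
  - destruct (Hl 1) as [p1 H1]. exists 1, p1. split; [lra|].
    intros p Hp. specialize (H1 p Hp). lra.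
Qed.

Theorem theorem5p5 :
  forall (r : nat) (M N : nat -> R),
    (1 <= r)%nat ->
    class_LC M -> class_LC N ->
    (exists K : R, 1 <= K /\ forall p, M p <= K ^ p * N p) ->
    (Rbar_lt 0 (LimInf_seq (fun p =>
        Rpower (Rpower (M p) (/ INR r) / INR (fact p)) (/ INR p))) ->
      forall A : fun_class,
        (forall a : nat -> C, Lambda Roumieu M a -> jets A Roumieu r N a)
        <-> cond_SV r M N)
    /\
    (is_lim_seq (fun p =>
        Rpower (Rpower (M p) (/ INR r) / INR (fact p)) (/ INR p)) p_infty ->
      forall A : fun_class,
        (forall a : nat -> C, Lambda Beurling M a -> jets A Beurling r N a)
        <-> cond_SV r M N).
Proof.
  intros r M N Hr HM HN [K [HK HMN]].
  pose proof (LC_pos M HM) as HM0. pose proof (LC_pos N HN) as HN0.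
  assert (HrR : 0 < INR r) by (apply lt_0_INR; lia).
  assert (H2r : 0 < 2 ^ r) by (apply pow_lt; lra).
  set (u := fun p => Rpower (Rpower (M p) (/ INR r) / INR (fact p)) (/ INR p)).
  assert (Hgrow : forall c p1, 0 < c -> (forall p, (p1 <= p)%nat -> c <= u p) ->
    forall p, (S p1 <= p)%nat -> ((c / INR r) ^ r) ^ p * INR (fact (r * p)) <= M p).
  { intros c p1 Hc Hu p Hp. apply fact_growth; auto; [lia|]. apply Hu. lia. }
  split; intros Hlim A; (split; [intros Hsurj|intros HSV a; now apply cond_SV_sufficient with K]).
  - destruct (LimInf_seq_pos u Hlim) as [c [p1 [Hc Hu]]].
    set (c' := (c / INR r) ^ r).
    assert (Hc' : 0 < c') by (apply pow_lt; now apply Rdiv_lt_0_compat).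
    (* The growth constant is given, so the free scale [h] is adapted to it. *)
    destruct (uniform_preimages A Roumieu r M N (2 * 2 ^ r / c')) as
      [h [A1 [H [Hh [HA1 [HH [Et Hpre]]]]]]]; auto.
    { apply Rdiv_lt_0_compat; lra. }
    apply cond_SV_necessary with K h A1 H c' (S p1); auto; [|now apply Hgrow].
    rewrite Et by easy. right. field. lra.
  - destruct (uniform_preimages A Beurling r M N 1) as
      [h [A1 [H [Hh [HA1 [HH [_ Hpre]]]]]]]; auto; [lra|].
    (* Here [h] is given, and the infinite limit provides whatever growth constant it requires. *)
    set (c' := 2 * 2 ^ r / h).
    assert (Hc' : 0 < c') by (apply Rdiv_lt_0_compat; lra).
    set (c := Rpower c' (/ INR r) * INR r).
    assert (Hc : 0 < c) by (apply Rmult_lt_0_compat; [apply exp_pos|easy]).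
    destruct (proj2 (is_lim_seq_spec _ _) Hlim c) as [p1 Hp1].
    assert (Ec : (c / INR r) ^ r = c').
    { unfold c. replace (Rpower c' (/ INR r) * INR r / INR r) with (Rpower c' (/ INR r))
        by (field; lra). now apply Rpower_root_pow. }
    apply cond_SV_necessary with K h A1 H c' (S p1); auto.
    + right. unfold c'. field. lra.
    + rewrite <- Ec. apply Hgrow; [easy|]. intros p Hp. left. now apply Hp1.
Qed.
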